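(* Let $a_1,a_2\in L^\infty(\mathbf R)$ be smooth, let $0\le\epsilon\le2$, and suppose that there are $g\in\mathcal G$ and a constant $k=k(n,a_1,a_2,g)$ independent of $R$ such that $$\int_{x_1^2+x_2^2\le R^2}e^{-\int_0^{x_1}a_1(t)\,dt}\,e^{-\int_0^{x_2}a_2(t)\,dt}\,dx_1\,dx_2\le k\,R^{2-\epsilon}g(R)\quad\text{for all } R>1.$$ If $n\le 3+\epsilon$, then every monotone and asymptotically convergent classical solution $u$ of $$-\Delta u+a_1(x_1)\,\partial_{x_1}u+a_2(x_2)\,\partial_{x_2}u=u-u^3\quad\text{in }\ \mathbf R^2\times\mathbf R^{n-2}=\mathbf R^n$$ is at most $3$-dimensional.
   Context: Here $n\ge3$ is an integer and $(x_1,x_2)$ are the first two coordinates of $\mathbf x\in\mathbf R^2\times\mathbf R^{n-2}$. The class $\mathcal G$ is the set of nondecreasing functions $g:\mathbf R^+\to\mathbf R^+$ with $\int_1^\infty \frac{1}{r g(r)}\,dr=\infty$. Write also $\mathbf x=(\mathbf x''',x_n)\in\mathbf R^{n-1}\times\mathbf R$. A classical solution $u$ is monotone if $\partial_{x_n}u(\mathbf x)>0$ for all $\mathbf x\in\mathbf R^n$; it is asymptotically convergent if $\lim_{x_n\to\pm\infty}u(\mathbf x''',x_n)=\pm1$ for every $\mathbf x'''\in\mathbf R^{n-1}$ (pointwise, not necessarily uniformly). A function $u$ on $\mathbf R^n$ is at most $m$-dimensional if it depends on at most $m$ variables (up to a linear change of coordinates), i.e. there are a linear map $L:\mathbf R^n\to\mathbf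 R^m$ and a function $w:\mathbf R^m\to\mathbf R$ with $u=w\circ L$. *)

(* Defs.v *)
From HB Require Import structures.
From mathcomp Require Export all_boot all_order all_algebra.
From mathcomp Require Export all_classical all_reals all_analysis.
Export Order.TTheory GRing.Theory Num.Theory.
Export numFieldNormedType.Exports.

Set Implicit Arguments.
Unset Strict Implicit.
Unset Printing Implicit Defensive.

Local Open Scope classical_set_scope.
Local Open Scope ring_scope.

Section OneVariable.
Variable R : realType.
Implicit Types (a g : R -> R).

Definition smooth a : Prop := forall (k : nat) (x : R), derivable (derive1n k a) x 1.

(* The oriented integral $\int_0^x a(t)\,dt$: minus the integral over [x, 0]
   when x < 0. *)
Definition integral_from0 a (x : R) : R :=
  if 0 <= x then \int[@lebesgue_measure R]_(t in `[0, x]) a t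
  else - \int[@lebesgue_measure R]_(t in `[x, 0]) a t.

Definition weighted_disc_integral a1 a2 (r : R) : \bar R :=
  (\int[(@lebesgue_measure R) \x (@lebesgue_measure R)]_(
      y in [set y : R * R | (y.1 ^+ 2 + y.2 ^+ 2 <= r ^+ 2)%R])
    (expR (- integral_from0 a1 y.1) * expR (- integral_from0 a2 y.2))%:E)%E.

(* A function g : R^+ -> R^+, with R^+ = ]0, +oo[, is represented by a total
   function whose values outside ]0, +oo[ are irrelevant. *)
Definition classG g : Prop :=
  [/\ forall r : R, 0 < r -> 0 < g r,
      forall r s : R, 0 < r -> r <= s -> g r <= g s
    & (\int[@lebesgue_measure R]_(r in `[1%R, +oo[) ((r * g r)^-1)%:E = +oo)%E].

End OneVariable.

Section SeveralVariables.
Variables (R : realType) (n : nat).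
Implicit Type u : 'rV[R]_n -> R.

Definition partial (i : 'I_n) u : 'rV[R]_n -> R :=
  'D_(delta_mx ord0 i : 'rV[R]_n) u.

Definition has_partial (i : 'I_n) u : Prop :=
  forall x : 'rV[R]_n, derivable u x (delta_mx ord0 i).

Definition laplacian u (x : 'rV[R]_n) : R :=
  \sum_(i < n) partial i (partial i u) x.

Definition class_C2 u : Prop :=
  [/\ continuous u,
      forall i, has_partial i u /\ continuous (partial i u)
    & forall i j, has_partial j (partial i u) /\
                  continuous (partial j (partial i u))].

Definition at_most_dimensional (m : nat) u : Prop :=
  exists (L : {linear 'rV[R]_n -> 'rV[R]_m}) (w : 'rV[R]_m -> R),
    forall x, u x = w (L x).

End SeveralVariables.

Section LastVariable.
Variables (R : realType) (n : nat).
Implicit Type u : 'rV[R]_n.+1 -> R.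

Definition append_last (x : 'rV[R]_n) (t : R) : 'rV[R]_n.+1 :=
  \row_i (if unlift ord_max i is Some j then x ord0 j else t).

Definition monotone_last u : Prop := forall x, 0 < partial ord_max u x.

Definition asymptotically_convergent u : Prop :=
  forall x : 'rV[R]_n,
    u (append_last x t) @[t --> +oo] --> (1 : R) /\
    u (append_last x t) @[t --> -oo] --> (- 1 : R).

End LastVariable.

(* Dimensions n >= 3 are written n = p.+3. The coordinates x_1, x_2 and x_n are
   those of index 0, 1 and ord_max; they are distinct. *)
Section Equation.
Variables (R : realType) (p : nat).

Definition idx1 : 'I_p.+3 := @Ordinal p.+3 0 isT.
Definition idx2 : 'I_p.+3 := @Ordinal p.+3 1 isT.

Definition classical_solution (a1 a2 : R -> R) (u : 'rV[R]_p.+3 -> R) : Prop :=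
  class_C2 u /\
  forall x : 'rV[R]_p.+3,
    - laplacian u x + a1 (x ord0 idx1) * partial idx1 u x
      + a2 (x ord0 idx2) * partial idx2 u x = u x - u x ^+ 3.

End Equation.

(* Main.v *)
Require Import Defs.
From mathcomp Require Import measurable_realfun.
From mathcomp Require Import ring lra.

Set Implicit Arguments.
Unset Strict Implicit.
Unset Printing Implicit Defensive.

Local Open Scope classical_set_scope.
Local Open Scope ring_scope.

(** Write [d_i u] for the partial derivatives of [u] and [d_n u > 0] for the last one. The
    theorem is proved by showing that for every index [i] other than the first two the
    quotient [sigma_i = d_i u / d_n u] is a constant [c_i]. Then [u] is invariant under
    translations along [e_i - c_i e_n], so that it depends only on [x_1], [x_2] and the sum of
    the [c_i x_i] over the other indices ([three_dimensional_of_ratio]).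

    The drift is removed by the weight [w = exp (- int a_1 - int a_2)], which depends on
    [x_1, x_2] only. Hence [d_i u] and [d_n u] both solve the linearization of
    [- div (w grad u) = w (u - u^3)] ([linearized_equation]), and their quotient satisfies
    [div (w (d_n u)^2 grad sigma_i) = 0] ([quotient_equation]). Testing this with
    [eta^2 sigma_i], for a cutoff [eta] of the box of half-side [2 r], gives for the Dirichlet
    integrals [D(r)] of [sigma_i] with weight [w (d_n u)^2]
      [D(2r) <= lam (D(2r) - D(r)) + K / (lam r^2) * int w (d_i u)^2]  for all [lam > 0]
    ([caccioppoli]), the last integral being over a box of side of order [r].

    The integral of [w (d_i u)^2] is at most twice the weighted energy of the box, and the
    monotonicity and the limits of [u] in [x_n] bound this energy by the weighted volume of
    an [n - 1] dimensional section ([energy_estimate]). This volume is the integral of the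
    growth hypothesis times [r^(n-3)], hence at most of order [r^2 g(r)] when [n <= 3 + eps]
    ([volume_growth]). So, with [D_j = D(2^j)] and the best [lam],
    [D_(j+1)^2 <= C g(2^j) (D_(j+1) - D_j)] up to a shift in the argument of [g]. If some
    [D_j] were positive, the sum of the [1 / g(2^j)] would be bounded by a telescoping sum
    ([dyadic_liouville]); but it diverges for a function of the class
    ([dyadic_divergence]). Hence [D = 0], and [sigma_i] is constant.

    The energy estimate needs gradient bounds for [u]: they are obtained by a barrier
    argument ([derivative_bound_cube], [gradient_bound]). All integrals over the whole
    space have compactly supported continuous integrands; they are limits of Riemann sums
    along an ultrafilter, for which integration by parts reduces to a translation of the
    grid ([rV_integral_partial]). *)

(** * Calculus along lines and in coordinates *)

(** Continuity rules on an abstract topological space: on row vectors,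
    unification would otherwise unfold the product topology. *)
Section ContinuityRules.
Variables (R : realType) (T : topologicalType).
Implicit Types f g : T -> R.

Lemma continuous_add f g : continuous f -> continuous g ->
  continuous (fun x => f x + g x).
Proof. by move=> cf cg x; apply: cvgD; [exact: cf|exact: cg]. Qed.

Lemma continuous_mul f g : continuous f -> continuous g ->
  continuous (fun x => f x * g x).
Proof. by move=> cf cg x; apply: cvgM; [exact: cf|exact: cg]. Qed.

Lemma continuous_opp f : continuous f -> continuous (fun x => - f x).
Proof. by move=> cf x; apply: cvgN; exact: cf. Qed.

Lemma continuous_inv f : (forall x, f x != 0) -> continuous f ->
  continuous (fun x => (f x)^-1).
Proof. by move=> f0 cf x; apply: cvgV => //; exact: cf. Qed.

Lemma continuous_const (c : R) : continuous (fun _ : T => c).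
Proof. by move=> x; exact: cvg_cst. Qed.

Lemma continuous_pow f k : continuous f -> continuous (fun x => f x ^+ k).
Proof.
move=> cf; elim: k => [|k ih].
  by under eq_fun do rewrite expr0; exact: continuous_const.
by under eq_fun do rewrite exprS; exact: continuous_mul.
Qed.

Lemma continuous_abs f : continuous f -> continuous (fun x => `|f x|).
Proof. by move=> cf x; apply: cvg_norm; exact: cf. Qed.

Lemma continuous_sum (I : Type) (s : seq I) (P : pred I) (F : I -> T -> R) :
  (forall i, continuous (F i)) ->
  continuous (fun x => \sum_(i <- s | P i) F i x).
Proof.
move=> cF; elim: s => [|i s ih].
  by under eq_fun do rewrite big_nil; exact: continuous_const.
by under eq_fun do rewrite big_cons; case: (P i) => //; exact: continuous_add.
Qed.

Lemma continuous_prod (I : Type) (s : seq I) (P : pred I) (F : I -> T -> R) :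
  (forall i, continuous (F i)) ->
  continuous (fun x => \prod_(i <- s | P i) F i x).
Proof.
move=> cF; elim: s => [|i s ih].
  by under eq_fun do rewrite big_nil; exact: continuous_const.
by under eq_fun do rewrite big_cons; case: (P i) => //; exact: continuous_mul.
Qed.

Lemma continuous_after (c : R -> R) f : continuous c -> continuous f ->
  continuous (fun x => c (f x)).
Proof. by move=> cc cf x; apply: continuous_comp; [exact: cf|exact: cc]. Qed.

End ContinuityRules.

Section DerivativeRules.
Variables (R : realType) (V : normedModType R).
Implicit Types (f g : V -> R) (x v : V) (df dg : R).

Lemma is_derive_add f g x v df dg : is_derive x v f df -> is_derive x v g dg ->
  is_derive x v (fun y => f y + g y) (df + dg).
Proof. exact: is_deriveD. Qed.

Lemma is_derive_sub f g x v df dg : is_derive x v f df -> is_derive x v g dg ->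
  is_derive x v (fun y => f y - g y) (df - dg).
Proof. exact: is_deriveB. Qed.

Lemma is_derive_mul f g x v df dg : is_derive x v f df -> is_derive x v g dg ->
  is_derive x v (fun y => f y * g y) (df * g x + f x * dg).
Proof.
move=> dfx dgx; apply: (is_derive_eq (is_deriveM dfx dgx)).
by rewrite addrC mulrC.
Qed.

Lemma is_derive_const (c : R) x v : is_derive x v (fun=> c) 0.
Proof. exact: is_derive_cst. Qed.

Lemma is_derive_scale (c : R) f x v df : is_derive x v f df ->
  is_derive x v (fun y => c * f y) (c * df).
Proof.
move=> dfx; apply: (is_derive_eq (is_derive_mul (is_derive_const c x v) dfx)).
by rewrite mul0r add0r.
Qed.

Lemma is_derive_sum (I : Type) (s : seq I) (P : pred I) (F : I -> V -> R)
    (dF : I -> R) x v : (forall i, is_derive x v (F i) (dF i)) ->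
  is_derive x v (fun y => \sum_(i <- s | P i) F i y) (\sum_(i <- s | P i) dF i).
Proof.
move=> dFi; elim: s => [|i s ih].
  under eq_fun do rewrite big_nil.
  by rewrite big_nil; exact: is_derive_const.
under eq_fun do rewrite big_cons; rewrite big_cons; case: (P i) => //.
exact: is_derive_add.
Qed.

Lemma is_derive_unique f x v df : is_derive x v f df -> 'D_v f x = df.
Proof. by case. Qed.

Lemma is_derive_ex f x v df : is_derive x v f df -> derivable f x v.
Proof. by case. Qed.

Lemma is_derive_line f x v t : derivable f (x + t *: v) v ->
  is_derive t 1 (fun s => f (x + s *: v)) ('D_v f (x + t *: v)).
Proof.
move=> df.
have E : (fun h : R => h^-1 *: (f (x + (h *: 1 + t) *: v) - f (x + t *: v))) =
  (fun h : R => h^-1 *: (f (h *: v + (x + t *: v)) - f (x + t *: v))).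
  apply/funext => h; congr (_ *: (f _ - _)).
  by rewrite [h *: 1]mulr1 scalerDl addrCA.
split; first by rewrite /derivable E.
by rewrite /derive E.
Qed.

Lemma is_derive_of_line f x v df :
  is_derive (0 : R) 1 (fun s => f (x + s *: v)) df -> is_derive x v f df.
Proof.
have E : (fun h : R => h^-1 *: (f (x + (h *: (1 : R) + 0 : R) *: v) -
                               f (x + (0 : R) *: v))) =
  (fun h : R => h^-1 *: (f (h *: v + x) - f x)).
  apply/funext => h; rewrite scale0r !addr0; congr (_ *: (f _ - _)).
  by rewrite addrC [h *: (1 : R)]mulr1.
case=> [d1 d2]; split; first by move: d1; rewrite /derivable E.
by move: d2; rewrite /derive E.
Qed.

(** Composition with a function of one variable needs differentiability of [f]
    along the single direction [v] only. *)
Lemma is_derive_comp (c : R -> R) f x v dc df :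
  is_derive (f x) 1 c dc -> is_derive x v f df ->
  is_derive x v (fun y => c (f y)) (dc * df).
Proof.
move=> dcx dfx; apply: is_derive_of_line.
have dl : is_derive (0 : R) 1 (fun s => f (x + s *: v)) df.
  have := @is_derive_line f x v 0; rewrite scale0r addr0 (is_derive_unique dfx).
  by apply; exact: is_derive_ex dfx.
apply: (@is_derive1_comp R c (fun s => f (x + s *: v)) 0 dc df) => //=.
by rewrite scale0r addr0.
Qed.

Lemma is_derive_continuous (c dc : R -> R) :
  (forall t : R, is_derive t 1 c (dc t)) -> continuous c.
Proof.
move=> cdc t; apply: differentiable_continuous; apply/derivable1_diffP.
by have [] := cdc t.
Qed.

End DerivativeRules.

Section MeanValue.
Variables (R : realType) (V : normedModType R).
Implicit Types (f g : V -> R) (x v : V).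

Lemma mvt_line f x v h : (forall s, derivable f (x + s *: v) v) ->
  exists2 th, 0 <= th <= 1 &
    f (x + h *: v) - f x = h * 'D_v f (x + (th * h) *: v).
Proof.
move=> df.
have dl' (s : R) : is_derive s 1 (fun s : R => f (x + (s * h) *: v))
    (h * 'D_v f (x + (s * h) *: v)).
  have d1 : is_derive s 1 (fun s : R => s * h) h.
    have := is_derive_mul (is_derive_id s 1) (is_derive_const h s 1).
    by rewrite mul1r mulr0 addr0.
  have := @is_derive1_comp R (fun s => f (x + s *: v)) (fun s => s * h) s _ _
    (is_derive_line (df (s * h))) d1.
  by rewrite /comp mulrC.
have [|c] := @MVT_segment R (fun s => f (x + (s * h) *: v))
  (fun s => h * 'D_v f (x + (s * h) *: v)) 0 1 ler01.
- apply: continuous_subspaceT => s.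
  apply: differentiable_continuous; apply/derivable1_diffP.
  by have [] := dl' s.
- rewrite in_itv /= => c01; rewrite mul1r mul0r scale0r addr0 subr0 mulr1.
  by move=> ->; exists c.
Qed.

End MeanValue.

Section CoordinateCalculus.
Variables (R : realType) (n : nat).
Local Notation V := ('rV[R]_n).
Implicit Types (f g : V -> R) (x y v : V) (i j k : 'I_n) (d e h : R).

Definition basis i : V := delta_mx ord0 i.

Lemma coord_shift x i t j : (x + t *: basis i) ord0 j = x ord0 j + t * (j == i)%:R.
Proof. by rewrite !mxE eqxx. Qed.

Lemma is_derive_coord x i j : is_derive x (basis i) (fun y => y ord0 j) (j == i)%:R.
Proof.
apply: is_derive_of_line.
under eq_fun do rewrite coord_shift.
have := is_derive_add (is_derive_const (x ord0 j) (0 : R) 1)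
  (is_derive_mul (is_derive_id (0 : R) 1) (is_derive_const (j == i)%:R (0 : R) 1)).
by rewrite add0r mulr0 addr0 mul1r.
Qed.

Definition C1 f : Prop :=
  continuous f /\ forall i, has_partial i f /\ continuous (partial i f).

Lemma C1_continuous f : C1 f -> continuous f. Proof. by case. Qed.

Lemma C1_partial_continuous f i : C1 f -> continuous (partial i f).
Proof. by case=> _ /(_ i)[]. Qed.

Arguments C1_partial_continuous [f] i _ _.

Lemma C1_is_derive f i x : C1 f -> is_derive x (basis i) f (partial i f x).
Proof. by case=> _ /(_ i)[/(_ x) ? _]; exact: derivableP. Qed.

Lemma C1_of f (df : 'I_n -> V -> R) : continuous f ->
    (forall i, continuous (df i)) ->
    (forall i x, is_derive x (basis i) f (df i x)) ->
  C1 f /\ forall i, partial i f = df i.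
Proof.
move=> cf cdf dfi.
have E i : partial i f = df i.
  by apply/funext => x; exact: is_derive_unique.
split=> //; split=> // i; rewrite E; split => // x; exact: is_derive_ex (dfi i x).
Qed.

Lemma C1_mul f g : C1 f -> C1 g -> C1 (fun x => f x * g x) /\
  forall i, partial i (fun x => f x * g x) =
            fun x => partial i f x * g x + f x * partial i g x.
Proof.
move=> f1 g1.
have [[cf cg] [cdf cdg]] := ((C1_continuous f1, C1_continuous g1),
  ((fun i => C1_partial_continuous i f1), (fun i => C1_partial_continuous i g1))).
apply: C1_of => [x|i x|i x].
- exact: continuous_mul.
- by apply: continuous_add; apply: continuous_mul.
- by apply: is_derive_mul; exact: C1_is_derive.
Qed.

Lemma C1_comp (c dc : R -> R) f : (forall t : R, is_derive t 1 c (dc t)) ->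
  continuous dc -> C1 f -> C1 (fun x => c (f x)) /\
  forall i, partial i (fun x => c (f x)) = fun x => dc (f x) * partial i f x.
Proof.
move=> cdc cont f1; have cf := C1_continuous f1.
apply: C1_of => [|i|i x].
- exact: continuous_after (is_derive_continuous cdc) cf.
- apply: continuous_mul (C1_partial_continuous i f1).
  exact: continuous_after cont cf.
- by apply: is_derive_comp; exact: C1_is_derive.
Qed.

Lemma C1_coord (c dc : R -> R) j : (forall t : R, is_derive t 1 c (dc t)) ->
  continuous dc -> C1 (fun x => c (x ord0 j)) /\
  forall i, partial i (fun x => c (x ord0 j)) =
            fun x => dc (x ord0 j) * (j == i)%:R.
Proof.
move=> cdc cont; have cj := @coord_continuous R 1 n ord0 j.
apply: C1_of => [|i|i x].
- exact: continuous_after (is_derive_continuous cdc) cj.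
- apply: continuous_mul; last exact: continuous_const.
  exact: continuous_after cont cj.
- by apply: is_derive_comp; exact: is_derive_coord.
Qed.

Lemma C1_inv f : (forall x, f x != 0) -> C1 f -> C1 (fun x => (f x)^-1) /\
  forall i, partial i (fun x => (f x)^-1) =
            fun x => - (f x) ^- 2 * partial i f x.
Proof.
move=> f0 f1; have cf := C1_continuous f1; apply: C1_of => [|i|i x].
- exact: continuous_inv.
- apply: continuous_mul (C1_partial_continuous i f1).
  apply: continuous_opp; apply: continuous_inv; last exact: continuous_pow.
  by move=> x; rewrite expf_neq0.
- have dx := C1_is_derive i x f1.
  split; first exact: derivableV (is_derive_ex dx).
  by rewrite (deriveV (f0 x) (is_derive_ex dx)) (is_derive_unique dx).
Qed.

Lemma mvt_coord f i x h : has_partial i f ->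
  exists2 th, 0 <= th <= 1 &
    f (x + h *: basis i) - f x = h * partial i f (x + (th * h) *: basis i).
Proof. by move=> df; apply: mvt_line => s; exact: df. Qed.

End CoordinateCalculus.

Arguments basis {R n} i.
Arguments C1_partial_continuous [R n f] i _ _.

(** * Continuous functions on boxes and symmetry of second derivatives *)

Section Compactness.
Variables (R : realType) (n : nat).
Local Notation V := ('rV[R]_n).
Implicit Types (f g : V -> R) (x y v : V) (i j k : 'I_n) (d e h : R).

Lemma continuous_eps f x e : continuous f -> 0 < e -> exists2 d : R, 0 < d &
  forall y, (forall k, `|y ord0 k - x ord0 k| < d) -> `|f y - f x| < e.
Proof.
move=> cf e0; have /(_ _ (nbhsx_ballx _ _ e0)) := cf x.
rewrite nbhs_filterE => /nbhs_ballP[d /= d0 dP]; exists d => // y yx.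
suff : ball (f x) e (f y) by rewrite /ball/= distrC.
apply: dP; split=> // i k; rewrite !ord1 /ball/= distrC; exact: yx.
Qed.

Lemma box_compact (A : R) : compact [set x : V | forall k, `|x ord0 k| <= A].
Proof.
have := @rV_compact R n (fun=> `[-A, A]%classic) (fun=> @segment_compact _ _ _).
congr compact; apply/seteqP; split=> x /= xA k; have := xA k; rewrite ?in_itv/=;
  by rewrite ler_norml.
Qed.

Lemma uniform_continuity_on_box f (A e : R) : continuous f -> 0 < e ->
  exists2 d : R, 0 < d & forall x y, (forall k, `|x ord0 k| <= A) ->
    (forall k, `|y ord0 k - x ord0 k| < d) -> `|f y - f x| < e.
Proof.
move=> cf e0.
have /compact_near_coveringP/(_ R (0^'+)
  (fun d x => forall y, (forall k, `|y ord0 k - x ord0 k| < d) ->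
     `|f y - f x| < e)) := @box_compact A.
case=> [x _|].
  have e20 : 0 < e / 2 by rewrite divr_gt0.
  have [d d0 dP] := continuous_eps x cf e20.
  exists (ball x (d / 2), [set t | t < d / 2]).
    split; first by apply: nbhsx_ballx; rewrite divr_gt0.
    by apply: nbhs_right_lt; rewrite divr_gt0.
  move=> [z t] [/= [_ xz] td] y yz.
  have E : f y - f z = (f y - f x) - (f z - f x) by ring.
  rewrite E (le_lt_trans (ler_normB _ _))// [e]splitr ltrD//; apply: dP => k.
    have -> : y ord0 k - x ord0 k = (y ord0 k - z ord0 k) - (x ord0 k - z ord0 k).
      by ring.
    rewrite (le_lt_trans (ler_normB _ _))// [d]splitr ltrD//.
      exact: lt_trans (yz k) td.
    exact: xz.
  have := xz ord0 k; rewrite /ball/= distrC => /lt_le_trans; apply.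
  lra.
move=> d /= d0 dP.
exists (d / 2) => [|x y xA]; first by rewrite divr_gt0.
apply: (dP (d / 2) _ _ x xA) => /=; last by rewrite divr_gt0.
by rewrite sub0r normrN gtr0_norm ?divr_gt0//; lra.
Qed.

Lemma bounded_on_box f (A : R) : continuous f ->
  exists2 B : R, 0 < B & forall x, (forall k, `|x ord0 k| <= A) -> `|f x| <= B.
Proof.
move=> cf; case: (pselect (exists x : V, forall k, `|x ord0 k| <= A)); last first.
  by move=> nex; exists 1 => // x xA; case: nex; exists x.
move=> [x0 x0A].
have [|c _ cP] := @EVT_max_rV R n (fun x => `|f x|) _ (ex_intro _ x0 x0A)
  (@box_compact A).
  by apply: continuous_subspaceT; exact: continuous_abs.
exists (`|f c| + 1) => [|x xA]; first by rewrite ltr_wpDl.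
have := cP x; rewrite !inE => /(_ xA) /le_trans; apply; rewrite lerDl; exact: ler01.
Qed.

Lemma is_derive_translate f i x w : has_partial i f ->
  is_derive x (basis i) (fun y => f (y + w)) (partial i f (x + w)).
Proof.
move=> df; apply: is_derive_of_line.
have E : (fun s : R => f (x + s *: basis i + w)) =
         (fun s : R => f (x + w + s *: basis i)).
  by apply/funext => s; rewrite addrAC.
rewrite E; have := @is_derive_line R V f (x + w) (basis i) 0 (df _).
by rewrite scale0r addr0.
Qed.

Lemma second_difference f i j x h : has_partial i f ->
    has_partial j (partial i f) ->
  exists th : R * R, [/\ 0 <= th.1 <= 1, 0 <= th.2 <= 1 &
    f (x + h *: basis i + h *: basis j) - f (x + h *: basis i)
    - (f (x + h *: basis j) - f x)
    = h * h * partial j (partial i f)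
        (x + (th.1 * h) *: basis i + (th.2 * h) *: basis j)].
Proof.
move=> fi fij.
pose g := fun y : V => f (y + h *: basis j) - f y.
have dg y : is_derive y (basis i) g (partial i f (y + h *: basis j) - partial i f y).
  by apply: is_derive_sub; [exact: is_derive_translate|exact: derivableP].
have [|t t01 E] := @mvt_coord R n g i x h; first by move=> y; exact: is_derive_ex (dg y).
have [s s01 E'] := mvt_coord (x + (t * h) *: basis i) h fij.
exists (t, s); split=> //=.
by move: E; rewrite /g => ->; rewrite -mulrA -E' [partial i g _](is_derive_unique (dg _)).
Qed.

(** Equality of mixed partial derivatives: the mean value theorem evaluates the
    same second difference over a small square in either order. *)
Lemma partial_comm f i j : class_C2 f ->
  partial i (partial j f) = partial j (partial i f).
Proof.
move=> [_ f1 f2]; apply/funext => x.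
apply/eqP; rewrite -subr_eq0 -normr_eq0 eq_le normr_ge0 andbT.
apply/ler_addgt0Pl => e e0; rewrite addr0.
have e20 : 0 < e / 2 by rewrite divr_gt0.
have [d d0 dP] := continuous_eps x (f2 j i).2 e20.
have [d' d'0 d'P] := continuous_eps x (f2 i j).2 e20.
have m0 : 0 < Num.min d d' by rewrite lt_min d0.
have [h h0 hm] : exists2 h, 0 < h & h + h < Num.min d d'.
  by exists (Num.min d d' / 3); [rewrite divr_gt0|lra].
have tri (a b c : R) : `|c - a| < e / 2 -> `|c - b| < e / 2 -> `|a - b| <= e.
  move=> ca cb; have -> : a - b = (c - b) - (c - a) by ring.
  by rewrite (le_trans (ler_normB _ _))// [e]splitr lerD// ltW.
have hh : h * h != 0 by rewrite -expr2 expf_neq0// lt0r_neq0.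
have near_x (s t : R) k l : 0 <= s <= 1 -> 0 <= t <= 1 -> forall q,
    `|(x + (s * h) *: basis k + (t * h) *: basis l) ord0 q - x ord0 q|
    < Num.min d d'.
  move=> s01 t01 q; rewrite !coord_shift.
  have -> (a b c : R) : a + b + c - a = b + c by ring.
  have bnd (r : R) (b : bool) : 0 <= r <= 1 -> `|r * h * b%:R| <= h.
    move=> r01; rewrite ger0_norm; last by rewrite !mulr_ge0//; lra.
    by case: b => /=; rewrite ?mulr1 ?mulr0; nra.
  rewrite (le_lt_trans (ler_normD _ _))// (le_lt_trans (lerD (bnd _ _ s01) (bnd _ _ t01)))//.
have [[s t] /= [s01 t01 E]] := second_difference x h (f1 i).1 (f2 i j).1.
have [[s' t'] /= [s'01 t'01 E']] := second_difference x h (f1 j).1 (f2 j i).1.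
have EE : h * h * partial j (partial i f) (x + (s * h) *: basis i + (t * h) *: basis j)
  = h * h * partial i (partial j f) (x + (s' * h) *: basis j + (t' * h) *: basis i).
  have sw (a b c b' a' : R) : a = a' -> a - b - (c - b') = a' - c - (b - b').
    by move=> ->; ring.
  apply: (etrans (esym E)); apply: (etrans _ E'); apply: sw; congr (f _).
  by rewrite addrAC.
have {}EE := mulfI hh EE.
have l1 : Num.min d d' <= d by rewrite ge_min lexx.
have l2 : Num.min d d' <= d' by rewrite ge_min lexx orbT.
have B1 := dP _ (fun k => lt_le_trans (near_x _ _ j i s'01 t'01 k) l1).
have B2 := d'P _ (fun k => lt_le_trans (near_x _ _ i j s01 t01 k) l2).
by rewrite EE in B2; exact: tri B1 B2.
Qed.

End Compactness.

(** * Limits along an ultrafilter and grids *)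

Section UltraLimit.
Variable R : realType.
Implicit Types (s t : nat -> R) (l B e : R).

(** Taking limits along a fixed nonprincipal ultrafilter gives every bounded sequence a
    limit, compatible with sums, products and order. The integral below is therefore
    defined, linear and monotone before any Riemann sum is known to converge. *)
Definition infinite_ultrafilter : set_system nat :=
  sval (cid (ultraFilterLemma eventually_filter)).

Local Notation U := infinite_ultrafilter.

#[global] Instance infinite_ultrafilter_ultra : UltraFilter U.
Proof. by rewrite /U; case: cid => G []. Qed.

Lemma eventually_infinite_ultrafilter : eventually `<=` U.
Proof. by rewrite /U; case: cid => G []. Qed.

Definition ulim s : R := lim (s @ U).

Lemma eventually_le_ultra (P : nat -> Prop) N :
  (forall m, (N <= m)%N -> P m) -> \forall m \near U, P m.
Proof. by move=> NP; apply: eventually_infinite_ultrafilter; exists N. Qed.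

Lemma ulim_cvg s B : (forall m, `|s m| <= B) -> s @ U --> ulim s.
Proof.
move=> sB.
have FU : UltraFilter (s @ U).
  split; first exact: fmap_proper_filter.
  move=> G GF sG; apply/seteqP; split=> // A GA.
  have [//|nA] := in_ultra_setVsetC (s @^-1` A) infinite_ultrafilter_ultra.
  have /filterI/(_ GA) : G (~` A) by exact: sG.
  by rewrite setICl => /filter_not_empty.
have := @segment_compact R (- B) B; rewrite compact_ultra.
case/(_ _ FU) => [|l [_ sl]].
  rewrite nbhs_filterE /fmap /=; apply: filterE => m /=; rewrite in_itv/= -ler_norml; exact: sB.
have E : ulim s = l by apply: cvg_lim; first exact: Rhausdorff.
by rewrite E.
Qed.

Lemma ulim_unique s l :
  (forall e, 0 < e -> exists N, forall m, (N <= m)%N -> `|s m - l| <= e) ->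
  ulim s = l.
Proof.
move=> sl; apply: cvg_lim; first exact: Rhausdorff.
apply/cvgrPdist_le => e e0.
have [N Ns] := sl _ e0; apply: (eventually_le_ultra (N := N)) => m Nm.
by rewrite distrC; exact: Ns.
Qed.

End UltraLimit.

Section RiemannSums.
Variable R : realType.

Definition mesh m : R := m.+1%:R^-1.

(** The points [-(m+1) + k/(m+1)] for [k < 2 (m+1)^2] fill [-(m+1), m+1). Written as a
    successor, their number makes the index type visibly nonempty. *)
Definition nodes m : nat := (m.+1 * m.+1).*2.-1.+1.

Definition node m (k : nat) : R := k%:R * mesh m - m.+1%:R.

Lemma mesh_gt0 m : 0 < mesh m. Proof. by rewrite invr_gt0 ltr0n. Qed.

Lemma mesh_le1 m : mesh m <= 1.
Proof. by rewrite invf_le1 ?ler1n ?ltr0n. Qed.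

Lemma mesh_small e : 0 < e -> exists N, forall m, (N <= m)%N -> mesh m < e.
Proof.
move=> e0; have [N _ NP] := near_infty_natSinv_lt (PosNum e0).
by exists N => m Nm; apply: NP.
Qed.

Lemma nodes_gt_eventually (A : R) : exists N, forall m, (N <= m)%N -> A < m.+1%:R.
Proof.
exists (Num.truncn `|A|) => m Nm.
rewrite (le_lt_trans (ler_norm A))// (lt_le_trans (truncnS_gt _))//.
by rewrite ler_nat ltnS.
Qed.

Lemma nodeS m k : node m k.+1 = node m k + mesh m.
Proof. by rewrite /node -natr1; ring. Qed.

Lemma node0 m : node m 0 = - m.+1%:R.
Proof. by rewrite /node mul0r sub0r. Qed.

Lemma node_last m : node m (nodes m) = m.+1%:R.
Proof.
have -> : nodes m = (m.+1 * m.+1).*2 by rewrite /nodes prednK// double_gt0.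
have h0 : (m.+1%:R : R) != 0 by rewrite pnatr_eq0.
rewrite /node /mesh -addnn natrD natrM -mulrDl -mulrA divff//; ring.
Qed.

Lemma telescope_nodes m (G : R -> R) :
  \sum_(k < nodes m) (G (node m k + mesh m) - G (node m k)) =
  G m.+1%:R - G (- m.+1%:R).
Proof.
under eq_bigr do rewrite -nodeS.
rewrite -(big_mkord xpredT (fun k => G (node m k.+1) - G (node m k))).
by rewrite (telescope_sumr (fun k => G (node m k)))// node0 node_last.
Qed.

(** The number of nodes in [-A, A], bounded by telescoping the clamp function
    to [-A, A + 1], which grows by a full mesh at each of them. *)
Lemma count_nodes m (A : R) : 0 <= A ->
  mesh m * \sum_(k < nodes m) (`|node m k| <= A)%R%:R <= 2 * A + 1.
Proof.
move=> A0; pose c (t : R) := Num.max (- A) (Num.min t (A + 1)).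
have cb t : - A <= c t <= A + 1.
  by rewrite /c le_max lexx ge_max ge_min lexx orbT andbT /=; lra.
apply: (@le_trans _ _ (\sum_(k < nodes m) (c (node m k + mesh m) - c (node m k)))).
  rewrite mulr_sumr; apply: ler_sum => k _.
  have h0 := mesh_gt0 m; have h1 := mesh_le1 m.
  have cm : c (node m k) <= c (node m k + mesh m).
    by rewrite /c; apply: le_max2; rewrite ?lexx//; apply: le_min2; lra.
  case: (boolP (`|node m k| <= A)) => [|_]; last by rewrite mulr0 subr_ge0.
  rewrite ler_norml mulr1 => /andP[kA Ak].
  rewrite /c !min_l ?max_r; lra.
rewrite telescope_nodes; have := cb m.+1%:R; have := cb (- m.+1%:R); lra.
Qed.

End RiemannSums.

(** * The integral of compactly supported continuous functions *)

Section Integral.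
Variables (R : realType) (n : nat).
Local Notation V := ('rV[R]_n).
Implicit Types (f g : V -> R) (x y : V) (i j k : 'I_n) (A B e : R).

Definition Cc f : Prop := continuous f /\
  exists2 A : R, 0 <= A & forall x k, A < `|x ord0 k| -> f x = 0.

Definition grid_point m (q : {ffun 'I_n -> 'I_(nodes m)}) : V :=
  \row_k node R m (q k).

Definition riemann_sum m f : R := mesh R m ^+ n * \sum_q f (@grid_point m q).

Definition rV_integral f : R := ulim (fun m => riemann_sum m f).

Lemma riemann_sum_prod m (g : 'I_n -> R -> R) :
  riemann_sum m (fun x => \prod_k g k (x ord0 k)) =
  \prod_k (mesh R m * \sum_(a < nodes m) g k (node R m a)).
Proof.
rewrite big_split /= prodr_const card_ord bigA_distr_bigA /=; congr (_ * _).
by apply: eq_bigr => q _; apply: eq_bigr => k _; rewrite mxE.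
Qed.

Lemma ler_riemann_sum m f g : (forall x, f x <= g x) ->
  riemann_sum m f <= riemann_sum m g.
Proof.
move=> fg; rewrite ler_pM2l ?exprn_gt0 ?mesh_gt0//.
by apply: ler_sum.
Qed.

Lemma riemann_sum_bound m f A B : 0 <= A -> 0 <= B ->
    (forall x, (forall k, `|x ord0 k| <= A) -> `|f x| <= B) ->
    (forall x k, A < `|x ord0 k| -> f x = 0) ->
  `|riemann_sum m f| <= B * (2 * A + 1) ^+ n.
Proof.
move=> A0 B0 fB f0.
pose g x := B * \prod_k (`|x ord0 k| <= A)%R%:R.
have fg x : `|f x| <= g x.
  case: (pselect (forall k, `|x ord0 k| <= A)) => [xA|].
    by rewrite /g big1 ?mulr1; [exact: fB|move=> k _; rewrite xA].
  move=> /existsNP[k /negP]; rewrite -ltNge => xk.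
  by rewrite (f0 _ _ xk) normr0 mulr_ge0// prodr_ge0.
have le_g : `|riemann_sum m f| <= riemann_sum m g.
  rewrite /riemann_sum normrM ger0_norm ?exprn_ge0 ?(ltW (mesh_gt0 _ _))//.
  rewrite ler_pM2l ?exprn_gt0 ?mesh_gt0//.
  by rewrite (le_trans (ler_norm_sum _ _ _))// ler_sum.
apply: (le_trans le_g).
have -> : riemann_sum m g = B * riemann_sum m (fun x => \prod_k (`|x ord0 k| <= A)%R%:R).
  by rewrite /riemann_sum mulrCA -mulr_sumr.
rewrite ler_wpM2l// (riemann_sum_prod m (fun _ t => (`|t| <= A)%R%:R)).
rewrite -[X in _ <= _ ^+ X]card_ord -prodr_const; apply: ler_prod => k _.
rewrite count_nodes// andbT mulr_ge0 ?(ltW (mesh_gt0 _ _))//.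
by apply: sumr_ge0.
Qed.

Lemma rV_integral_cvg f : Cc f ->
  riemann_sum ^~ f @ @infinite_ultrafilter --> rV_integral f.
Proof.
move=> [cf [A A0 f0]]; have [B B0 fB] := bounded_on_box A cf.
by apply: (@ulim_cvg _ _ (B * (2 * A + 1) ^+ n)) => m;
  exact: riemann_sum_bound (ltW B0) _ _.
Qed.

End Integral.

Section CompactSupport.
Variables (R : realType) (n : nat).
Local Notation V := ('rV[R]_n).
Implicit Types (f g : V -> R) (x y : V) (i j k : 'I_n) (A B e c : R).

Lemma Cc_continuous f : Cc f -> continuous f. Proof. by case. Qed.

Lemma Cc_mulr f g : Cc f -> continuous g -> Cc (fun x => f x * g x).
Proof.
move=> [cf [A A0 f0]] cg; split; first exact: continuous_mul.
by exists A => // x k xk; rewrite (f0 x k) ?mul0r.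
Qed.

Lemma Cc_mull f g : Cc f -> continuous g -> Cc (fun x => g x * f x).
Proof. by move=> cf cg; under eq_fun do rewrite mulrC; exact: Cc_mulr. Qed.

Lemma Cc_scale c f : Cc f -> Cc (fun x => c * f x).
Proof. by move=> cf; apply: Cc_mull cf _; exact: continuous_const. Qed.

Lemma Cc_add f g : Cc f -> Cc g -> Cc (fun x => f x + g x).
Proof.
move=> [cf [A A0 f0]] [cg [B B0 g0]]; split; first exact: continuous_add.
exists (Num.max A B) => [|x k]; first by rewrite le_max A0.
by rewrite gt_max => /andP[/f0-> /g0->]; rewrite addr0.
Qed.

Lemma Cc_opp f : Cc f -> Cc (fun x => - f x).
Proof. by move=> cf; under eq_fun do rewrite -mulN1r; exact: Cc_scale. Qed.

Lemma Cc_sub f g : Cc f -> Cc g -> Cc (fun x => f x - g x).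
Proof. by move=> cf cg; apply: Cc_add => //; exact: Cc_opp. Qed.

Lemma Cc_abs f : Cc f -> Cc (fun x => `|f x|).
Proof.
move=> [cf [A A0 f0]]; split; first exact: continuous_abs.
by exists A => // x k /f0->; rewrite normr0.
Qed.

Lemma Cc_zero : Cc (fun _ : V => 0).
Proof. by split; [exact: continuous_const|exists 0]. Qed.

Lemma Cc_sum (J : Type) (s : seq J) (P : pred J) (F : J -> V -> R) :
  (forall a, Cc (F a)) -> Cc (fun x => \sum_(a <- s | P a) F a x).
Proof.
move=> cF; elim: s => [|i s ih].
  by under eq_fun do rewrite big_nil; exact: Cc_zero.
by under eq_fun do rewrite big_cons; case: (P i) => //; exact: Cc_add.
Qed.

Lemma Cc_prod (g : 'I_n -> R -> R) (k0 : 'I_n) A : 0 <= A ->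
    (forall k, continuous (g k)) -> (forall k t, A < `|t| -> g k t = 0) ->
  Cc (fun x => \prod_k g k (x ord0 k)).
Proof.
move=> A0 cg g0; split.
  apply: continuous_prod => k; apply: continuous_after (cg k) _.
  exact: (@coord_continuous R 1 n ord0 k).
by exists A => // x k xk; rewrite (bigD1 k)//= (g0 _ _ xk) mul0r.
Qed.

Lemma rV_integral_unique f l :
  (forall e, 0 < e -> exists N, forall m, (N <= m)%N -> `|riemann_sum m f - l| <= e) ->
  rV_integral f = l.
Proof. exact: ulim_unique. Qed.

Lemma rV_integral_add f g : Cc f -> Cc g ->
  rV_integral (fun x => f x + g x) = rV_integral f + rV_integral g.
Proof.
move=> cf cg; apply: (@cvg_lim _ (@Rhausdorff R)).
have E : (fun m => riemann_sum m f + riemann_sum m g) =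
         (fun m => riemann_sum m (fun x => f x + g x)).
  by apply/funext => m; rewrite /riemann_sum big_split mulrDr.
by have := cvgD (rV_integral_cvg cf) (rV_integral_cvg cg); rewrite [X in X @ _]E; apply.
Qed.

Lemma rV_integral_scale c f : Cc f -> rV_integral (fun x => c * f x) = c * rV_integral f.
Proof.
move=> cf; apply: (@cvg_lim _ (@Rhausdorff R)).
have E : (fun m => c * riemann_sum m f) =
         (fun m => riemann_sum m (fun x => c * f x)).
  by apply/funext => m; rewrite /riemann_sum mulrCA -mulr_sumr.
by have := cvgM (cvg_cst c) (rV_integral_cvg cf); rewrite [X in X @ _]E; apply.
Qed.

Lemma rV_integral_opp f : Cc f -> rV_integral (fun x => - f x) = - rV_integral f.
Proof.
by move=> cf; under eq_fun do rewrite -mulN1r; rewrite rV_integral_scale// mulN1r.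
Qed.

Lemma rV_integral_sub f g : Cc f -> Cc g ->
  rV_integral (fun x => f x - g x) = rV_integral f - rV_integral g.
Proof.
by move=> cf cg; rewrite rV_integral_add ?rV_integral_opp//; exact: Cc_opp.
Qed.

Lemma rV_integral_zero : rV_integral (fun _ : V => 0) = 0.
Proof.
apply: rV_integral_unique => e e0; exists 0 => m _.
by rewrite /riemann_sum big1 ?mulr0 ?subrr ?normr0 ?ltW.
Qed.

Lemma rV_integral_sum (J : Type) (s : seq J) (P : pred J) (F : J -> V -> R) :
    (forall a, Cc (F a)) ->
  rV_integral (fun x => \sum_(a <- s | P a) F a x) =
  \sum_(a <- s | P a) rV_integral (F a).
Proof.
move=> cF; elim: s => [|i s ih].
  by under eq_fun do rewrite big_nil; rewrite big_nil rV_integral_zero.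
under eq_fun do rewrite big_cons; rewrite big_cons; case: (P i) => //.
by rewrite rV_integral_add ?ih//; exact: Cc_sum.
Qed.

Lemma le_rV_integral f g : Cc f -> Cc g -> (forall x, f x <= g x) ->
  rV_integral f <= rV_integral g.
Proof.
move=> cf cg fg.
have /(cvgP (rV_integral f)) c1 := rV_integral_cvg cf.
have /(cvgP (rV_integral g)) c2 := rV_integral_cvg cg.
apply: (ler_lim c1 c2); apply: filterE => m; exact: ler_riemann_sum.
Qed.

Lemma rV_integral_ge0 f : Cc f -> (forall x, 0 <= f x) -> 0 <= rV_integral f.
Proof. by move=> cf f0; rewrite -rV_integral_zero; apply: le_rV_integral => //; exact: Cc_zero. Qed.

Lemma ler_norm_rV_integral f : Cc f -> `|rV_integral f| <= rV_integral (fun x => `|f x|).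
Proof.
move=> cf; rewrite ler_norml -rV_integral_opp; last exact: Cc_abs.
apply/andP; split; apply: le_rV_integral => //; try exact: Cc_abs.
- by apply: Cc_opp; exact: Cc_abs.
- by move=> x; rewrite lerNl ler_normr lexx orbT.
- by move=> x; exact: ler_norm.
Qed.

End CompactSupport.

(** * Integrals of derivatives and of products *)

Section IntegralOfDerivative.
Variables (R : realType) (n : nat).
Local Notation V := ('rV[R]_n).
Implicit Types (f g : V -> R) (x y : V) (i j k : 'I_n) (A B e c : R).

(** [f] vanishes near a point outside its box, hence so does its derivative. *)
Lemma partial_support f i A : (forall x k, A < `|x ord0 k| -> f x = 0) ->
  forall x k, A < `|x ord0 k| -> partial i f x = 0.
Proof.
move=> f0 x k xk; apply: is_derive_unique.
apply: (@near_eq_is_derive _ _ _ (fun=> 0)).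
apply/nbhs_ballP; exists (`|x ord0 k| - A) => [|y [_ xy]] /=.
  by rewrite /= subr_gt0.
rewrite (f0 _ k)//; have := xy ord0 k; rewrite /ball/= => xyk.
by have := ler_normD (x ord0 k - y ord0 k) (y ord0 k); rewrite subrK; lra.
Qed.

Lemma Cc_partial f i : Cc f -> continuous (partial i f) -> Cc (partial i f).
Proof.
move=> [cf [A A0 f0]] cdf; split=> //; exists A => //; exact: partial_support.
Qed.

(** On the grid, a difference quotient in the direction [i] is summed cyclically:
    a translation by one node permutes the grid up to points of the boundary,
    where [f] vanishes. *)
Lemma riemann_sum_difference m f i A : A < m.+1%:R ->
    (forall x k, A < `|x ord0 k| -> f x = 0) ->
  riemann_sum m (fun x => f (x + mesh R m *: basis i) - f x) = 0.
Proof.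
move=> Am f0; rewrite /riemann_sum sumrB.
pose S (q : {ffun 'I_n -> 'I_(nodes m)}) : {ffun 'I_n -> 'I_(nodes m)} :=
  [ffun k => if k == i then ordS (q k) else q k].
have Sinj : injective S.
  move=> q q' /ffunP SS; apply/ffunP => k; have := SS k; rewrite !ffunE.
  by case: (k == i) => // /(can_inj (@ordSK _)).
rewrite [X in _ * (_ - X)](reindex_inj Sinj)/= -sumrB big1 ?mulr0// => q _.
apply/eqP; rewrite subr_eq0; apply/eqP.
have [qi|qi] := ltnP (q i).+1 (nodes m).
  congr f; apply/rowP => k; rewrite coord_shift !mxE ffunE.
  case: eqP => [->|_]; last by rewrite mulr0 addr0.
  by rewrite mulr1 /= modn_small// nodeS.
have {}qi : (q i).+1 = nodes m by apply/eqP; rewrite eqn_leq qi ltn_ord.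
rewrite (f0 _ i) ?(f0 _ i)//.
  by rewrite mxE ffunE eqxx /= qi modnn node0 normrN ger0_norm.
by rewrite coord_shift mxE eqxx mulr1 -nodeS qi node_last ger0_norm.
Qed.

(** The difference quotients of [f] along [i] have zero Riemann sums and converge
    uniformly to the derivative. All integrations by parts below apply this to a product. *)
Lemma rV_integral_partial f i : Cc f -> has_partial i f ->
  continuous (partial i f) -> rV_integral (partial i f) = 0.
Proof.
move=> [cf [A A0 f0]] df cdf; have df0 := partial_support i f0.
apply: rV_integral_unique => e e0.
pose K := (2 * (A + 1) + 1) ^+ n.
have K0 : 0 < K by rewrite exprn_gt0//; lra.
have [d d0 dP] := uniform_continuity_on_box (A + 1) cdf (divr_gt0 e0 K0).
have [N1 hd] := mesh_small d0; have [N2 hA] := nodes_gt_eventually A.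
exists (maxn N1 N2) => m; rewrite geq_max => /andP[/hd hm /hA Am].
rewrite subr0.
have h0 := mesh_gt0 R m; have h1 := mesh_le1 R m.
pose D x := (f (x + mesh R m *: basis i) - f x) / mesh R m.
have JD : riemann_sum m D = 0.
  have -> : riemann_sum m D =
      (mesh R m)^-1 * riemann_sum m (fun x => f (x + mesh R m *: basis i) - f x).
    rewrite /riemann_sum mulrCA [X in _ = _ * X]mulr_sumr; congr (_ * _); apply: eq_bigr => q _.
    by rewrite /D mulrC.
  by rewrite (riemann_sum_difference i Am f0) mulr0.
have -> : riemann_sum m (partial i f) = riemann_sum m (fun x => partial i f x - D x).
  by rewrite /riemann_sum sumrB mulrBr -[X in _ - X]/(riemann_sum m D) JD subr0.
have -> : e = e / K * K by rewrite divfK// gt_eqF.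
apply: riemann_sum_bound; [by lra|by rewrite divr_ge0 ?ltW| |].
  move=> x xA; have [t t01 E] := mvt_coord x (mesh R m) df.
  rewrite /D E mulrAC divff ?gt_eqF// mul1r distrC ltW//; apply: dP => // k.
  rewrite coord_shift addrAC subrr add0r ger0_norm ?mulr_ge0//; try by lra.
  by case: (k == i) => /=; rewrite ?mulr1 ?mulr0//; nra.
move=> x k xk; rewrite (df0 x k); last by lra.
rewrite sub0r /D (f0 x k); last by lra.
rewrite (f0 _ k) ?subrr ?mul0r ?oppr0// coord_shift.
have le1 : `|mesh R m * (k == i)%:R| <= 1.
  by case: (k == i) => /=; rewrite ?mulr1 ?mulr0 ?normr0// gtr0_norm.
by have := lerB_normD (x ord0 k) (mesh R m * (k == i)%:R); lra.
Qed.

Lemma mvt (G g : R -> R) (s h : R) : (forall t : R, is_derive t 1 G (g t)) ->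
  exists2 th, 0 <= th <= 1 & G (s + h) - G s = h * g (s + th * h).
Proof.
move=> dG.
have [|th th01 E] := @mvt_line R R G s 1 h.
  by move=> t; exact: is_derive_ex (dG _).
exists th => //; move: E; rewrite [h *: 1]mulr1 => ->.
by rewrite (is_derive_unique (dG _)) [_ *: 1]mulr1.
Qed.

(** On each cell the increment of [G] is the mesh times a value of [g] nearby; the
    increments telescope and only the nodes in [-(A+1), A+1] contribute an error. *)
Lemma riemann_sum1_cvg (g G : R -> R) A : 0 <= A ->
    (forall t : R, is_derive t 1 G (g t)) -> continuous g ->
    (forall t, A <= `|t| -> g t = 0) ->
  forall e, 0 < e -> exists N, forall m, (N <= m)%N ->
    `|mesh R m * \sum_(a < nodes m) g (node R m a) - (G A - G (- A))| <= e.
Proof.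
move=> A0 dG cg g0 e e0.
pose K := 2 * (A + 1) + 1; have K0 : 0 < K by rewrite /K; lra.
have cg1 : continuous (fun x : 'rV[R]_1 => g (x ord0 ord0)).
  exact: continuous_after cg (@coord_continuous R 1 1 ord0 ord0).
have [d d0 dP] := uniform_continuity_on_box (A + 1) cg1 (divr_gt0 e0 K0).
have {}dP (s t : R) : `|s| <= A + 1 -> `|t - s| < d -> `|g t - g s| < e / K.
  move=> sA ts; have := dP (const_mx s) (const_mx t); rewrite !mxE.
  by apply=> k; rewrite !mxE.
have [N1 hd] := mesh_small d0; have [N2 hA] := nodes_gt_eventually A.
exists (maxn N1 N2) => m; rewrite geq_max => /andP[/hd hm /hA Am].
have h0 := mesh_gt0 R m; have h1 := mesh_le1 R m.
have -> : G A - G (- A) = G m.+1%:R - G (- m.+1%:R).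
  have [t t01 E] := mvt A (m.+1%:R - A) dG.
  have [s s01 E'] := mvt (- m.+1%:R) (m.+1%:R - A) dG.
  have gt0 : g (A + t * (m.+1%:R - A)) = 0 by apply: g0; rewrite ger0_norm; nra.
  have gs0 : g (- m.+1%:R + s * (m.+1%:R - A)) = 0.
    by apply: g0; rewrite -normrN ger0_norm; nra.
  have e1 : A + (m.+1%:R - A) = m.+1%:R by ring.
  have e2 : - m.+1%:R + (m.+1%:R - A) = - A by ring.
  by move: E E'; rewrite gt0 gs0 !mulr0 e1 e2; lra.
rewrite -telescope_nodes mulr_sumr -sumrB (le_trans (ler_norm_sum _ _ _))//.
apply: (@le_trans _ _ (\sum_(a < nodes m)
    (e / K) * (mesh R m * (`|node R m a| <= A + 1)%R%:R))); last first.
  rewrite -mulr_sumr -mulr_sumr -[leRHS](divfK (lt0r_neq0 K0)).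
  by rewrite ler_wpM2l ?divr_ge0 ?(ltW e0) ?(ltW K0)// count_nodes//; lra.
apply: ler_sum => a _.
have [t t01 ->] := mvt (node R m a) (mesh R m) dG.
rewrite -mulrBr normrM (gtr0_norm h0) [leRHS]mulrCA ler_pM2l//.
have [xa|xa] := lerP `|node R m a| (A + 1); rewrite ?mulr1 ?mulr0.
  rewrite distrC ltW//; apply: dP => //.
  by rewrite addrAC subrr add0r ger0_norm; nra.
rewrite !g0 ?subrr ?normr0//; last by lra.
have := lerB_normD (node R m a) (t * mesh R m).
have -> : `|t * mesh R m| = t * mesh R m by rewrite ger0_norm//; nra.
by nra.
Qed.

Lemma cvg_prod_eps (I : finType) (F : I -> nat -> R) (L : I -> R) :
    (forall (a : I) e, 0 < e ->
       exists N, forall m, (N <= m)%N -> `|F a m - L a| <= e) ->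
  forall e, 0 < e -> exists N, forall m, (N <= m)%N ->
    `|\prod_a F a m - \prod_a L a| <= e.
Proof.
move=> FL e e0.
have : \prod_a F a m @[m --> \oo] --> \prod_a L a.
  apply: cvg_big => [|a _]; first exact: mul_continuous.
  apply/cvgrPdist_le => e' e'0; have [N NP] := FL a _ e'0.
  by exists N => // m /= Nm; rewrite distrC; exact: NP.
move/cvgrPdist_le => /(_ e e0)[N _ NP]; exists N => m Nm.
by rewrite distrC; exact: NP.
Qed.

(** Fubini for products of functions of one variable: the Riemann sums themselves
    factor. *)
Lemma rV_integral_prod (g G : 'I_n -> R -> R) A : 0 <= A ->
    (forall k (t : R), is_derive t 1 (G k) (g k t)) ->
    (forall k, continuous (g k)) -> (forall k t, A <= `|t| -> g k t = 0) ->
  rV_integral (fun x : V => \prod_k g k (x ord0 k)) = \prod_k (G k A - G k (- A)).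
Proof.
move=> A0 dG cg g0; apply: rV_integral_unique => e e0.
have [N NP] := cvg_prod_eps (fun k => riemann_sum1_cvg A0 (dG k) (cg k) (g0 k)) e0.
by exists N => m Nm; rewrite riemann_sum_prod; exact: NP.
Qed.

End IntegralOfDerivative.

(** * Primitives and cutoff functions of one variable *)

Section OneVariableTools.
Variable R : realType.
Implicit Types (a : R -> R) (s t x M : R).

Lemma continuous_integrable a s t : continuous a ->
  (@lebesgue_measure R).-integrable `[s, t] (EFin \o a).
Proof.
move=> ca; apply: continuous_compact_integrable; first exact: segment_compact.
exact: continuous_subspaceT.
Qed.

Lemma integral_from0_base a M x : continuous a -> - M <= x -> 0 < M ->
  integral_from0 a x = \int[@lebesgue_measure R]_(t in `[- M, x]) a t
    - \int[@lebesgue_measure R]_(t in `[- M, 0]) a t.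
Proof.
move=> ca Mx M0; rewrite /integral_from0; case: ifPn => [x0|].
  rewrite Rintegral_itvB ?bnd_simp//; [|exact: continuous_integrable|lra].
  rewrite Rintegral_itv_obnd_cbnd//;
  apply: (integrableS _ _ _ (continuous_integrable 0 x ca)) => //.
  exact: subset_itv_oc_cc.
rewrite -ltNge => x0; rewrite -opprB; congr (- _).
rewrite Rintegral_itvB ?bnd_simp//; [|exact: continuous_integrable|exact: ltW].
rewrite Rintegral_itv_obnd_cbnd//; apply: (integrableS _ _ _ (continuous_integrable x 0 ca)) => //.
exact: subset_itv_oc_cc.
Qed.

(** Moving the base point of the integral to [- M], to the left of [x], makes the one-
    sided fundamental theorem of calculus applicable at [x]. *)
Lemma is_derive_integral_from0 a x : continuous a ->
  is_derive x 1 (integral_from0 a) (a x).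
Proof.
move=> ca; pose M := `|x| + 1.
have M0 : 0 < M by rewrite /M; have := normr_ge0 x; lra.
have xM : - M < x < M.
  by rewrite -ltr_norml /M; lra.
pose F y := \int[@lebesgue_measure R]_(t in `[- M, y]) a t.
have /andP[Mx xM'] := xM.
have [dF F'] := @continuous_FTC1_closed R a (- M) x M xM'
  (continuous_integrable _ _ ca) Mx (ca x).
have dFx : is_derive x 1 F (a x) by split; [exact: dF|rewrite -F' derive1E].
apply: (@near_eq_is_derive _ _ _ (fun y => F y - F 0)); last first.
  have := is_derive_sub dFx (is_derive_const (F 0) x 1).
  by rewrite subr0.
apply/nbhs_ballP; exists (x + M) => [|y] /=; first by lra.
rewrite /ball/= ltr_norml => /andP[_ xy].
by rewrite (integral_from0_base ca _ M0)//; lra.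
Qed.

Definition cutoffs (chi dchi : R -> R -> R) (c : R) : Prop :=
  forall r : R, 0 < r ->
  [/\ forall t : R, is_derive t 1 (chi r) (dchi r t), continuous (dchi r),
      forall t, 0 <= chi r t <= 1,
      forall t, `|t| <= r -> chi r t = 1 /\ dchi r t = 0
    & (forall t, 2 * r <= `|t| -> chi r t = 0 /\ dchi r t = 0) /\
      forall t, `|dchi r t| <= c / r].

(** The normalized primitive [S] of the continuous bump [max(0, t (1 - t))] rises from 0
    to 1 on [0, 1]; the cutoff is [S(2 - t) S(2 + t)]. *)
Lemma cutoff_exists : exists (chi dchi : R -> R) (c : R),
  [/\ forall t : R, is_derive t 1 chi (dchi t), continuous dchi,
      forall t, 0 <= chi t <= 1,
      forall t, `|t| <= 1 -> chi t = 1 /\ dchi t = 0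
    & (forall t, 2 <= `|t| -> chi t = 0 /\ dchi t = 0) /\ forall t, `|dchi t| <= c].
Proof.
pose b (t : R) : R := Num.max 0 (t * (1 - t)).
have cb : continuous b.
  move=> t; apply: (@continuous_max _ R (fun=> 0) (fun t => t * (1 - t))).
    exact: cvg_cst.
  by apply: cvgM; [exact: cvg_id|apply: cvgB; [exact: cvg_cst|exact: cvg_id]].
have b0 t : 0 <= b t by rewrite /b le_max lexx.
have bz t : ~~ (0 < t < 1) -> b t = 0.
  by move=> t01; apply/max_idPl; nra.
have b1 t : b t <= 1.
  by rewrite /b ge_max ler01 /=; nra.
have dX t := is_derive_integral_from0 t cb.
set X := integral_from0 b in dX.
have Xmono s t : s <= t -> X s <= X t.
  move=> st; have [th _ E] := mvt s (t - s) dX.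
  by rewrite -subr_ge0; move: E; rewrite subrKC => ->; rewrite mulr_ge0// subr_ge0.
pose m := X 1 - X 0.
have m0 : 0 < m.
  have [th th01] := mvt (1 / 4) (1 / 2) dX.
  have -> : 1 / 4 + 1 / 2 = 3 / 4 :> R by lra.
  set y := _ + th * _ => E.
  have : 0 < b y by rewrite /b lt_max /y; apply/orP; right; nra.
  have := Xmono 0 (1 / 4); have := Xmono (3 / 4) 1; rewrite /m; lra.
pose S t := (X t - X 0) / m.
have dS (t : R) : is_derive t 1 S (b t / m).
  have := is_derive_scale m^-1 (is_derive_sub (dX t) (is_derive_const (X 0) t 1)).
  by rewrite subr0 /S [b t / m]mulrC; congr is_derive; apply/funext => u; rewrite mulrC.
have S01 t : 0 <= S t <= 1.
  have Xlo : X 0 <= X t.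
    have [/Xmono//|t0] := lerP 0 t.
    have [th th01] := mvt t (- t) dX; rewrite subrr (bz (_ + _)) ?mulr0; first by lra.
    by apply/negP => ?; nra.
  have Xhi : X t <= X 1.
    have [t1|/ltW/Xmono//] := lerP 1 t.
    have [th th01] := mvt 1 (t - 1) dX; rewrite subrKC (bz (_ + _)) ?mulr0; first by lra.
    by apply/negP => ?; nra.
  rewrite /S ler_pdivlMr// mul0r subr_ge0 Xlo ler_pdivrMr// mul1r /m; lra.
have Slo t : t <= 0 -> S t = 0.
  move=> t0; have := Xmono _ _ t0; have := S01 t; rewrite /S => /andP[+ _].
  rewrite ler_pdivlMr// mul0r => p q; have -> : X t = X 0 by lra.
  by rewrite subrr mul0r.
have Shi t : 1 <= t -> S t = 1.
  move=> t1; have := Xmono _ _ t1; have := S01 t; rewrite /S => /andP[_ +].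
  rewrite ler_pdivrMr// mul1r => p q; have -> : X t = X 1 by rewrite /m in p; lra.
  by rewrite divff// gt_eqF.
exists (fun t => S (2 - t) * S (2 + t)).
exists (fun t => - (b (2 - t) / m) * S (2 + t) + S (2 - t) * (b (2 + t) / m)).
exists (2 / m); split.
- move=> t.
  have dl : is_derive t 1 (fun t : R => 2 - t) (- 1).
    have := is_derive_sub (is_derive_const (2 : R) t 1) (is_derive_id t 1).
    by rewrite sub0r.
  have dr : is_derive t 1 (fun t : R => 2 + t) 1.
    have := is_derive_add (is_derive_const (2 : R) t 1) (is_derive_id t 1).
    by rewrite add0r.
  have := is_derive_mul (is_derive_comp (dS _) dl) (is_derive_comp (dS _) dr).
  by rewrite mulr1 mulrN1.
- have cl : continuous (fun t : R => 2 - t).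
    by move=> t; apply: cvgB; [exact: cvg_cst|exact: cvg_id].
  have cr : continuous (fun t : R => 2 + t).
    by move=> t; apply: cvgD; [exact: cvg_cst|exact: cvg_id].
  have cS := is_derive_continuous dS.
  have cbm : continuous (fun t => b t / m).
    by apply: continuous_mul => //; exact: continuous_const.
  apply: continuous_add; apply: continuous_mul.
  + by apply: continuous_opp; exact: continuous_after cbm cl.
  + exact: continuous_after cS cr.
  + exact: continuous_after cS cl.
  + exact: continuous_after cbm cr.
- move=> t; have := S01 (2 - t); have := S01 (2 + t); nra.
- move=> t; rewrite ler_norml => t1.
  rewrite !Shi; [|lra|lra]; rewrite !bz ?mul0r ?oppr0 ?mul0r ?mulr0 ?addr0 ?mulr1//;
  by apply/negP => ?; lra.
- split=> t.
    rewrite ler_normr => /orP[t2|t2].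
      rewrite (Slo (2 - t)) ?(bz (2 - t)) ?mul0r ?oppr0 ?mul0r ?addr0//; last by lra.
      by apply/negP => ?; lra.
    rewrite (Slo (2 + t)) ?(bz (2 + t)) ?mul0r ?mulr0 ?add0r//; last by lra.
    by apply/negP => ?; lra.
  have bm s : 0 <= b s / m <= m^-1.
    by rewrite divr_ge0 ?(ltW m0)//= ler_pdivrMr// mulVf ?gt_eqF.
  have := S01 (2 - t); have := S01 (2 + t); have := bm (2 - t); have := bm (2 + t).
  move: (b _ / m) (b _ / m) (S _) (S _) => p q u v p1 q1 u1 v1.
  rewrite ler_norml; apply/andP; split; nra.
Qed.

Lemma cutoff_family : exists (chi dchi : R -> R -> R) (c : R),
  0 <= c /\ cutoffs chi dchi c.
Proof.
have [chi [dchi [c [d1 cd b01 b1 [b2 bc]]]]] := cutoff_exists.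
exists (fun r t => chi (t / r)), (fun r t => dchi (t / r) / r), c.
split=> [|r r0]; first exact: le_trans (normr_ge0 _) (bc 0).
have abs t : `|t / r| = `|t| / r by rewrite normrM normfV (gtr0_norm r0).
split.
- move=> t; have dr : is_derive t 1 (fun t : R => t / r) r^-1.
    have := is_derive_mul (is_derive_id t 1) (is_derive_const r^-1 t 1).
    by rewrite mul1r mulr0 addr0.
  exact: is_derive_comp (d1 _) dr.
- apply: continuous_mul; last exact: continuous_const.
  apply: continuous_after cd _; apply: continuous_mul; last exact: continuous_const.
  by move=> t; exact: cvg_id.
- by move=> t; exact: b01.
- move=> t tr; have [|-> ->] := b1 (t / r); last by rewrite mul0r.
  by rewrite abs ler_pdivrMr// mul1r.
- split=> t; last by rewrite normrM normfV (gtr0_norm r0) ler_pM2r ?invr_gt0.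
  by move=> tr; have [|-> ->] := b2 (t / r); rewrite ?mul0r// abs ler_pdivlMr.
Qed.

(** A comparison of integrals expressed by primitives: [g <= f] and [g] is supported in
    [b1, b2]. *)
Lemma antiderivative_increment (g f G F : R -> R) (b1 b2 A : R) :
    (forall t : R, is_derive t 1 G (g t)) -> (forall t : R, is_derive t 1 F (f t)) ->
    - A <= b1 -> b1 <= b2 -> b2 <= A ->
    (forall t, t <= b1 \/ b2 <= t -> g t = 0) -> (forall t, 0 <= g t <= f t) ->
  0 <= G A - G (- A) <= F b2 - F b1.
Proof.
move=> dG dF Ab1 b12 b2A g0 gf.
have [th th01 E] := mvt b2 (A - b2) dG.
have [th' th'01 E'] := mvt (- A) (b1 + A) dG.
have [s s01 Es] := mvt b1 (b2 - b1) dG.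
have [s' s'01 Es'] := mvt b1 (b2 - b1) (fun t => is_derive_sub (dF t) (dG t)).
move: E E' Es Es'; rewrite !subrKC.
have -> : - A + (b1 + A) = b1 by ring.
rewrite g0; last by right; nra.
rewrite g0; last by left; nra.
have := gf (b1 + s * (b2 - b1)); have := gf (b1 + s' * (b2 - b1)).
move: (g _) (g _) (f _) (f _) => p q v w; nra.
Qed.

End OneVariableTools.

(** * The growth class on dyadic scales *)

Section GrowthClass.
Variable R : realType.
Implicit Types (g : R -> R) (B : R).
Local Notation mu := (@lebesgue_measure R).

Lemma measurable_reciprocal g : classG g ->
  measurable_fun (`[1%R, +oo[%classic : set (measurableTypeR R))
    (fun r : measurableTypeR R => (r * g r)^-1 : measurableTypeR R).
Proof.
move=> [gp gm _].
pose m (r : R) := Num.max r 1.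
have m1 r : 1 <= m r by rewrite /m le_max lexx orbT.
apply: (@eq_measurable_fun _ _ _ _ _ (fun r => (m r * g (m r))^-1)) => [r|].
  by rewrite inE/= in_itv/= andbT => r1; rewrite /m max_l.
apply: nonincreasing_measurable; first exact: measurable_itv.
move=> r s rs; have rs' : m r <= m s by exact: le_max2.
have p0 := gp _ (lt_le_trans ltr01 (m1 r)).
have p1 := gm _ _ (lt_le_trans ltr01 (m1 r)) rs'.
have mr := m1 r; have ms := m1 s.
rewrite lef_pV2 ?posrE ?mulr_gt0//; try lra; first by apply: ler_pM => //; lra.
Qed.

Lemma dyadic_cover : `[1%R, +oo[%classic = \bigcup_k `[(2 ^+ k : R), 2 ^+ k.+1[%classic.
Proof.
apply/seteqP; split=> r /=; rewrite in_itv/= ?andbT; last first.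
  move=> [k _]; rewrite /= in_itv/= => /andP[+ _]; apply: le_trans.
  by rewrite exprn_ege1// ler1n.
move=> r1; have [N rN] : exists N, r < 2 ^+ N.
  exists (Num.truncn r).+1; rewrite (lt_trans (truncnS_gt r))// -natrX ltr_nat.
  exact: ltn_expl.
elim: N rN => [|N ih rN]; first by rewrite expr0 => ?; lra.
have [rN'|rN'] := ltP r (2 ^+ N); first exact: ih.
by exists N => //=; rewrite in_itv/= rN'.
Qed.

(** As [g] is nondecreasing, the integral of [1 / (r g(r))] over [2^j, 2^(j+1)] is at most
    [1 / g(2^j)]. The divergence is used in this discrete form only. *)
Lemma dyadic_divergence g q B : classG g ->
  exists J, B < \sum_(q <= j < J) (g (2 ^+ j))^-1.
Proof.
move=> gG; have [gp gm goo] := gG.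
have p2 k : 0 < 2 ^+ k :> R by rewrite exprn_gt0.
apply/not_existsP => noJ.
have bound J : \sum_(q <= j < J) (g (2 ^+ j))^-1 <= B by rewrite leNgt; apply/negP/noJ.
have gi k : 0 <= (g (2 ^+ k))^-1 by rewrite invr_ge0 ltW// gp.
pose S := \sum_(0 <= j < q) (g (2 ^+ j))^-1.
have bound' J : \sum_(0 <= j < J) (g (2 ^+ j))^-1 <= S + B.
  have [Jq|qJ] := leqP J q.
    have B0 : 0 <= B by have := bound q; rewrite big_geq.
    apply: (@le_trans _ _ S); last by rewrite lerDl.
    rewrite /S [leRHS](big_cat_nat (n := J))//= lerDl.
    exact: sumr_ge0.
  by rewrite (big_cat_nat (n := q)) ?(ltnW qJ)//= lerD2l bound.
move: goo; rewrite dyadic_cover ge0_integral_bigcup//=; first last.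
- apply/trivIsetP => i j _ _ ij; apply/seteqP; split => // r /=.
  wlog : i j ij / (i < j)%N.
    move=> W; case: (ltngtP i j) => ij'; [exact: W|move=> [? ?]; apply: (W j i) => //|].
      by rewrite eq_sym.
    by rewrite ij' eqxx in ij.
  move=> ij' [] /=; rewrite !in_itv/= => /andP[_ r1] /andP[r2 _].
  have : 2 ^+ i.+1 <= 2 ^+ j :> R by rewrite ler_weXn2l// ler1n.
  by lra.
- move=> r [k _] /=; rewrite in_itv/= => /andP[kr _]; rewrite lee_fin invr_ge0.
  have r0 : 0 < r by exact: lt_le_trans kr.
  by rewrite mulr_ge0 ?ltW// gp.
- by rewrite -dyadic_cover; apply/measurable_EFinP; exact: measurable_reciprocal.
apply/eqP; rewrite lt_eqF//; apply: (@le_lt_trans _ _ (S + B)%:E); last exact: ltry.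
apply: lime_le; first by apply: is_cvg_nneseries => k _ _; apply: integral_ge0 => r;
  rewrite /= in_itv/= => /andP[kr _]; rewrite lee_fin invr_ge0 mulr_ge0// ltW//;
  [exact: lt_le_trans kr|apply: gp; exact: lt_le_trans kr].
apply: nearW => J; apply: le_trans (_ : ((\sum_(0 <= j < J) (g (2 ^+ j))^-1)%:E <= _)%E);
  last first.
  by rewrite lee_fin.
rewrite -sumEFin; apply: lee_sum => k _.
apply: le_trans.
  apply: (@ge0_le_integral _ _ _ mu _ _ _ (cst ((2 ^+ k * g (2 ^+ k))^-1)%:E)) => //=.
  - move=> r; rewrite in_itv/= => /andP[kr _]; rewrite lee_fin invr_ge0.
    have r0 : 0 < r by exact: lt_le_trans kr.
    by rewrite mulr_ge0 ?ltW// gp.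
  - apply/measurable_EFinP; apply: (measurable_funS _ _ (measurable_reciprocal gG)) => //=.
    move=> r /=; rewrite !in_itv/= andbT => /andP[+ _]; apply: le_trans.
    by rewrite exprn_ege1// ler1n.
  - move=> r; rewrite in_itv/= => /andP[kr _]; rewrite lee_fin.
    have r0 : 0 < r by exact: lt_le_trans kr.
    rewrite lef_pV2 ?posrE ?mulr_gt0 ?gp//.
    apply: ler_pM => //; [exact: ltW (gp _ _)|exact: gm].
rewrite integral_cst//= lebesgue_measure_itv/= lte_fin ltr_eXn2l ?ltr1n// ltnS leqnn.
rewrite -EFinB -EFinM lee_fin exprS.
have -> : 2 * 2 ^+ k - 2 ^+ k = 2 ^+ k :> R by ring.
by rewrite invfM mulrAC mulVf ?mul1r// gt_eqF.
Qed.

End GrowthClass.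

(** * The coefficients and the weight *)

Section Coefficients.
Variable R : realType.
Implicit Types (a w : R -> R) (s t x r : R).
Local Notation mu := (@lebesgue_measure R).

Lemma smooth_continuous a : smooth a -> continuous a.
Proof.
move=> sa x; apply: differentiable_continuous; apply/derivable1_diffP.
exact: sa 0%N x.
Qed.

(** A continuous essentially bounded function is bounded, since nonempty open sets
    have positive measure. *)
Lemma Linfty_bounded a : a \in Lfun mu +oo%E -> continuous a ->
  exists2 B : R, 0 < B & forall x, `|a x| <= B.
Proof.
rewrite inE/= => /andP[_]; rewrite inE/= /finite_norm unlock /Lnorm.
have -> : (0 < mu [set: R])%E.
  rewrite -set_itvNyy lebesgue_measure_itv /=. exact: ltry.
move=> aoo ca.
have [M Mess] : exists M : R, (ess_sup_inf.ess_sup mu (abse \o (EFin \o a)) <= M%:E)%E.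
  move: aoo; case: (ess_sup_inf.ess_sup _ _) => [M _|//|_]; first by exists M.
  by exists 0; rewrite leNye.
have aeM : \forall x \ae mu, ((abse \o (EFin \o a)) x <= M%:E)%E.
  exact/ess_sup_inf.ess_supP.
exists (`|M| + 1) => [|x]; first by rewrite ltr_wpDl.
rewrite leNgt; apply/negP => Mx.
case: aeM => N [mN N0 sub].
have ca' : continuous (fun y => `|a y|) by exact: continuous_abs.
have : \forall y \near x, M < `|a y|.
  have Mx' : M < `|a x| by have := ler_norm M; lra.
  exact: (cvgr_gt _ (ca' x) _ Mx').
move=> /nbhs_ballP[d /= d0 dP].
have : (mu (ball x d) <= mu N)%E.
  apply: le_measure; rewrite ?inE//; first by rewrite ball_itv; exact: measurable_itv.
  by move=> y /dP /= My; apply: sub => /=; rewrite lee_fin; apply/negP; rewrite -ltNge.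
rewrite N0 ball_itv lebesgue_measure_itv/= lte_fin ifT; last by lra.
by rewrite -EFinB lee_fin; lra.
Qed.

Lemma weight_calculus a : continuous a -> let w t := expR (- integral_from0 a t) in
  [/\ forall t, 0 < w t, forall t, is_derive t 1 w (- a t * w t) & continuous w].
Proof.
move=> ca w; have dw t : is_derive t 1 w (- a t * w t).
  have d1 : is_derive t 1 (fun t => - integral_from0 a t) (- a t).
    have := is_derive_scale (- 1) (is_derive_integral_from0 t ca).
    by rewrite mulN1r; congr is_derive; apply/funext => u; rewrite mulN1r.
  have := @is_derive_comp R R expR (fun t => - integral_from0 a t) t 1 _ _
    (is_derive_expR _) d1.
  by rewrite mulrC.
split=> // [t|]; first exact: expR_gt0.
exact: is_derive_continuous dw.
Qed.

(** A disc of radius [r] contains the square of half-side [s] as soon as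
    [2 s^2 <= r^2], and the weight is a product. *)
Lemma square_in_disc a1 a2 s r : continuous a1 -> continuous a2 -> 0 < s ->
    2 * s ^+ 2 <= r ^+ 2 ->
  (((\int[mu]_(t in `[- s, s]) expR (- integral_from0 a1 t)) *
    (\int[mu]_(t in `[- s, s]) expR (- integral_from0 a2 t)))%:E
   <= weighted_disc_integral a1 a2 r)%E.
Proof.
move=> c1 c2 s0 sr; rewrite /weighted_disc_integral.
have [_ _ cw1] := weight_calculus c1; have [_ _ cw2] := weight_calculus c2.
set w1 := fun t => expR (- integral_from0 a1 t) in cw1 *.
set w2 := fun t => expR (- integral_from0 a2 t) in cw2 *.
have w1p t : 0 <= w1 t by exact: expR_ge0.
have w2p t : 0 <= w2 t by exact: expR_ge0.
pose I := `[- s, s]%classic : set (measurableTypeR R).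
have mw (w : R -> R) : continuous w ->
    measurable_fun [set: measurableTypeR R] (w : measurableTypeR R -> measurableTypeR R).
  exact: continuous_measurable_fun.
have finI (w : R -> R) : continuous w ->
    (\int[mu]_(t in I) (w t)%:E)%E = (\int[mu]_(t in I) w t)%:E.
  move=> cw; rewrite /Rintegral fineK//; apply: integrable_fin_num => //.
    exact: measurable_itv.
  exact: continuous_integrable.
have mf : measurable_fun [set: measurableTypeR R * measurableTypeR R]
   (fun y => (w1 y.1 * w2 y.2)%:E).
  apply/measurable_EFinP; apply: measurable_funM.
    by apply: measurableT_comp; [exact: mw|exact: measurable_fst].
  by apply: measurableT_comp; [exact: mw|exact: measurable_snd].
have mQ : measurable (I `*` I) by apply: measurableX; exact: measurable_itv.
have mD : measurable [set y : measurableTypeR R * measurableTypeR R |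
    (y.1 ^+ 2 + y.2 ^+ 2 <= r ^+ 2)%R].
  have mh : measurable_fun [set: measurableTypeR R * measurableTypeR R]
      (fun y => y.1 ^+ 2 + y.2 ^+ 2 : measurableTypeR R).
    by apply: measurable_funD; apply: measurable_funX;
      [exact: measurable_fst|exact: measurable_snd].
  have := mh measurableT `]-oo, (r ^+ 2)]%classic (measurable_itv _).
  by rewrite setTI; congr measurable; apply/seteqP; split=> y /=; rewrite in_itv.
apply: (@le_trans _ _ (\int[(mu \x mu)%E]_(y in I `*` I) (w1 y.1 * w2 y.2)%:E)%E); last first.
  apply: ge0_subset_integral => //.
  - exact: measurable_funS mf.
  - by move=> y _; rewrite lee_fin mulr_ge0.
  - move=> [y z]; rewrite /I /= !in_itv/= => -[/andP[? ?] /andP[? ?]]; nra.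
rewrite integral_mkcond fubini_tonelli1/=; first last.
- by move=> y; apply: erestrict_ge0 => z _; rewrite lee_fin mulr_ge0.
- apply/(measurable_restrictT _ _).1; first exact: mQ.
  exact: measurable_funS mf.
rewrite /fubini_F.
have inner x : (\int[mu]_y ((fun y => (w1 y.1 * w2 y.2)%:E) \_ (I `*` I)) (x, y) =
    ((fun x => (w1 x * \int[mu]_(t in I) w2 t)%:E) \_ I) x)%E.
  rewrite patchE; case: (boolP (x \in I)) => xI; last first.
    apply: integral0_eq => y _; rewrite patchE ifF//.
    by apply/negP; rewrite inE => -[/= xI' _]; move/negP: xI; apply; rewrite inE.
  have E y : ((fun y => (w1 y.1 * w2 y.2)%:E) \_ (I `*` I)) (x, y) =
      ((w1 x)%:E * ((EFin \o w2) \_ I) y)%E.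
    rewrite !patchE; case: (boolP (y \in I)) => yI.
      by rewrite ifT//; rewrite inE; split=> /=; rewrite -inE.
    rewrite mule0 ifF//; apply/negP; rewrite inE => -[/= _ yI'].
    by move/negP: yI; apply; rewrite inE.
  under eq_integral do rewrite E.
  rewrite ge0_integralZl//; last 3 first.
  - apply/(measurable_restrictT _ _).1; first exact: measurable_itv.
    apply/measurable_EFinP; apply: measurable_funS (mw _ cw2) => //.
  - by move=> y _; apply: erestrict_ge0 => z _; rewrite lee_fin.
  - by rewrite lee_fin.
  by rewrite -integral_mkcond finI.
under eq_integral do rewrite inner.
rewrite -integral_mkcond.
under eq_integral do rewrite EFinM.
rewrite ge0_integralZr ?finI//.
- exact: measurable_itv.
- by apply/measurable_EFinP; apply: measurable_funS (mw _ cw1).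
- by move=> x _; rewrite lee_fin.
- by rewrite lee_fin; apply: Rintegral_ge0.
Qed.

End Coefficients.

(** * Interior gradient bounds *)

Lemma continuous_of_near (R : realType) (T : topologicalType) (f : T -> R) :
  (forall x e, 0 < e -> \forall y \near x, `|f y - f x| < e) -> continuous f.
Proof.
move=> H x; apply/cvgrPdist_lt => e e0; near=> y; rewrite distrC; near: y.
exact: H.
Unshelve. all: by end_near. Qed.

Section GradientBound.
Variables (R : realType) (n : nat).
Local Notation V := ('rV[R]_n).
Implicit Types (u : V -> R) (x y : V) (i j k : 'I_n) (c d r s t L M N S : R).

(** Otherwise [dh], which vanishes at 0, is positive just to the right of it. *)
Lemma second_derivative_at_max (h dh ddh : R -> R) d :
    (forall t : R, is_derive t 1 h (dh t)) ->
    (forall t : R, is_derive t 1 dh (ddh t)) -> continuous ddh -> 0 < d ->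
    (forall t, `|t| < d -> h t <= h 0) ->
  ddh 0 <= 0.
Proof.
move=> h1 h2 c2 d0 hmax.
have dh0 : dh 0 = 0.
  rewrite -(is_derive_unique (h1 0)); apply: is_derive_unique.
  apply: (@derive1_at_max R h (- d) d 0).
  - lra.
  - by move=> t _; exact: is_derive_ex (h1 t).
  - by rewrite in_itv/= oppr_lt0 d0.
  - by move=> t; rewrite in_itv/= => td; apply: hmax; rewrite ltr_norml.
rewrite leNgt; apply/negP => b0.
have : \forall t \near (0 : R), 0 < ddh t by exact: (cvgr_gt _ (c2 0) _ b0).
move=> /nbhs_ballP[e /= e0 eP].
pose s := Num.min e d / 2.
have m0 : 0 < Num.min e d by rewrite lt_min e0.
have me : Num.min e d <= e by rewrite ge_min lexx.
have md : Num.min e d <= d by rewrite ge_min lexx orbT.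
have s0 : 0 < s by rewrite divr_gt0.
have [|c] := @MVT R h dh 0 s s0.
  by apply: continuous_subspaceT; exact: is_derive_continuous h1.
rewrite in_itv/= => /andP[c0 cs] E.
have [th th01] := mvt 0 c h2; rewrite add0r dh0 subr0 => E'.
have pos : 0 < ddh (0 + th * c).
  by apply: eP; rewrite /ball/= !add0r normrN ger0_norm; rewrite /s in cs; nra.
have hs : h s <= h 0 by apply: hmax; rewrite gtr0_norm// /s; lra.
have dc : 0 < dh c by rewrite E' mulr_gt0.
by have : 0 < dh c * s; [rewrite mulr_gt0|rewrite subr0 in E; lra].
Qed.

Lemma continuous_of_eps (f : V -> R) :
  (forall x e, 0 < e -> exists2 d, 0 < d &
     forall y, (forall k, `|y ord0 k - x ord0 k| < d) -> `|f y - f x| < e) ->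
  continuous f.
Proof.
move=> H; apply: continuous_of_near => x e e0; have [d d0 dP] := H x _ e0.
apply/nbhs_ballP; exists d => // y [_ xy] /=.
by apply: dP => k; have := xy ord0 k; rewrite /ball/= distrC.
Qed.

Lemma partial2_line u x j s : class_C2 u ->
  is_derive s 1 (fun s => u (x + s *: basis j)) (partial j u (x + s *: basis j)) /\
  is_derive s 1 (fun s => partial j u (x + s *: basis j))
    (partial j (partial j u) (x + s *: basis j)).
Proof.
move=> [_ u1 u2]; split; apply: is_derive_line; [exact: (u1 j).1|exact: (u2 j j).1].
Qed.

Lemma continuous_line (f : V -> R) x j : continuous f ->
  continuous (fun s : R => f (x + s *: basis j)).
Proof.
move=> cf; apply: continuous_of_near => s e e0.
have [d d0 dP] := continuous_eps (x + s *: basis j) cf e0.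
apply/nbhs_ballP; exists d => // t /=; rewrite /ball/= distrC => st.
apply: dP => k; rewrite !coord_shift.
have -> (a b : R) : a + t * b - (a + s * b) = (t - s) * b by ring.
by case: (k == j); rewrite ?mulr1 ?mulr0 ?normr0.
Qed.

(** The reflection in the hyperplane through [x0] orthogonal to the direction [i]. *)
Definition mirror i (x0 x : V) : V := x + (2 * (x0 ord0 i - x ord0 i)) *: basis i.

Lemma mirror_coord i x0 x k :
  mirror i x0 x ord0 k = if k == i then 2 * x0 ord0 i - x ord0 i else x ord0 k.
Proof.
rewrite /mirror coord_shift; case: eqP => [->|_]; last by rewrite mulr0 addr0.
by rewrite mulr1; ring.
Qed.

Lemma mirror_shift i x0 x j s :
  mirror i x0 (x + s *: basis j) =
  mirror i x0 x + ((-1) ^+ (j == i) * s) *: basis j.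
Proof.
apply/rowP => k; rewrite [LHS]mirror_coord [RHS]coord_shift mirror_coord !coord_shift.
case: (eqVneq k i) => [->|ki]; last first.
  have [kj|kj] := eqVneq k j; last by rewrite !mulr0.
  by rewrite -kj (negPf ki) expr0 mul1r.
rewrite [i == j]eq_sym; case: (j == i); rewrite ?expr1 ?mulr1 ?mulr0; ring.
Qed.

Lemma continuous_mirror u i x0 : continuous u ->
  continuous (fun x => u (mirror i x0 x)).
Proof.
move=> cu; apply: continuous_of_eps => x e e0.
have [d d0 dP] := continuous_eps (mirror i x0 x) cu e0.
exists d => // y yx; apply: dP => k; rewrite !mirror_coord.
case: eqP => _; last exact: yx.
have -> : 2 * x0 ord0 i - y ord0 i - (2 * x0 ord0 i - x ord0 i) =
  - (y ord0 i - x ord0 i) by ring.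
by rewrite normrN; exact: yx.
Qed.

(** A barrier argument on the half cube [K] where [x_i >= x0_i]. The odd part [(u x - u
    (mirror x)) / 2] vanishes on the flat face, is at most [M], and has a Laplacian
    larger than [- N]. The barrier, the sum of the [q j], is nonnegative on [K], at
    least [M] on the other faces, and has Laplacian [- N]; so the odd part minus the
    barrier, called [w], has no positive maximum. Comparing both near [x0] on the axis
    gives the derivative. *)
Lemma derivative_bound_cube u i x0 c d M N : class_C2 u -> 0 < d ->
    (forall y, (forall k, `|y ord0 k - x0 ord0 k| <= d) -> `|u y - c| <= M) ->
    (forall y, (forall k, `|y ord0 k - x0 ord0 k| <= d) -> `|laplacian u y| < N) ->
  partial i u x0 <= n%:R * M / d + N * d / 2.
Proof.
move=> u2 d0 uM uN.
have x0d k : `|x0 ord0 k - x0 ord0 k| <= d by rewrite subrr normr0 ltW.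
have M0 : 0 <= M by apply: le_trans (uM x0 x0d).
have N0 : 0 < N by apply: le_lt_trans (uN x0 x0d).
have n1 : 1 <= n%:R :> R by rewrite ler1n (leq_ltn_trans _ (ltn_ord i)).
pose A j := if j == i then - ((n%:R - 1) * M / d ^+ 2) - N / 2 else M / d ^+ 2.
pose B := n%:R * M / d + N * d / 2.
pose q j (t : R) := A j * t ^+ 2 + (if j == i then B else 0) * t.
pose w x := (u x - u (mirror i x0 x)) / 2 - \sum_j q j (x ord0 j - x0 ord0 j).
pose K := [set x : V | (forall k, `|x ord0 k - x0 ord0 k| <= d) /\
                       x0 ord0 i <= x ord0 i].
have cK : compact K.
  pose F k := if k == i then `[x0 ord0 k, x0 ord0 k + d]%classic
    else `[x0 ord0 k - d, x0 ord0 k + d]%classic.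
  have cF k : compact (F k) by rewrite /F; case: (k == i); exact: segment_compact.
  have := @rV_compact R n F cF; congr compact; apply/seteqP; split=> x /=.
    move=> xF; split=> [k|]; last first.
      by have := xF i; rewrite /F eqxx /= in_itv/= => /andP[].
    have := xF k; rewrite /F ler_distl; case: (k == i) => /=;
      by rewrite in_itv/= => /andP[h1 h2]; lra.
  move=> [xd xi] k; have := xd k; rewrite ler_distl /F => /andP[xk1 xk2].
  have [ki|_] := eqVneq k i; rewrite /= in_itv/=; last by rewrite xk1.
  by rewrite xk2 ki xi.
have cu : continuous u by case: u2.
have cw : continuous w.
  apply: continuous_add.
    apply: continuous_mul; last exact: continuous_const.
    by apply: continuous_add => //; apply: continuous_opp; exact: continuous_mirror.
  apply: continuous_opp; apply: continuous_sum => j.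
  have cz : continuous (fun x : V => x ord0 j - x0 ord0 j).
    by apply: continuous_add; [exact: coord_continuous|exact: continuous_const].
  apply: continuous_add; apply: continuous_mul; try exact: continuous_const.
    exact: continuous_pow.
  exact: cz.
have K0 : K x0 by split.
have [x /set_mem Kx xmax] := @EVT_max_rV R n w K (ex_intro _ x0 K0) cK
  (continuous_subspaceT cw).
have qi t : 0 <= t <= d -> 0 <= q i t.
  move=> td; rewrite /q /A /B eqxx.
  have -> : (- ((n%:R - 1) * M / d ^+ 2) - N / 2) * t ^+ 2 + (n%:R * M / d + N * d / 2) * t
    = M / d ^+ 2 * (t * (d + (n%:R - 1) * (d - t))) + N / 2 * (t * (d - t)).
    by field; rewrite gt_eqF.
  have Md : 0 <= M / d ^+ 2 by rewrite divr_ge0// exprn_ge0// ltW.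
  have nd : 0 <= (n%:R - 1) * (d - t) by apply: mulr_ge0; lra.
  by apply: addr_ge0; apply: mulr_ge0 => //; try lra; apply: mulr_ge0; lra.
have qid : q i d = M.
  by rewrite /q /A /B eqxx; field; rewrite gt_eqF.
have qj j t : j != i -> q j t = M / d ^+ 2 * t ^+ 2.
  by move=> ji; rewrite /q /A (negPf ji) mul0r addr0.
have qj0 j t : j != i -> 0 <= q j t.
  by move=> ji; rewrite qj// mulr_ge0 ?sqr_ge0// divr_ge0// exprn_ge0// ltW.
have cube_mirror y : K y -> forall k, `|mirror i x0 y ord0 k - x0 ord0 k| <= d.
  move=> [yd _] k; rewrite mirror_coord; case: eqP => [->|_]; last exact: yd.
  have -> : 2 * x0 ord0 i - y ord0 i - x0 ord0 i = - (y ord0 i - x0 ord0 i) by ring.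
  by rewrite normrN; exact: yd.
have zi y : K y -> 0 <= y ord0 i - x0 ord0 i <= d.
  move=> [yd yi]; have := yd i; rewrite ler_norml => /andP[_ ->]; lra.
have phiM y : K y -> (u y - u (mirror i x0 y)) / 2 <= M.
  move=> Ky; have := uM y Ky.1; have := uM _ (cube_mirror y Ky).
  rewrite !ler_norml; lra.
have wx : w x <= 0.
  rewrite leNgt; apply/negP => wx.
  have psi_ge k : q k (x ord0 k - x0 ord0 k) <= \sum_j q j (x ord0 j - x0 ord0 j).
    rewrite [leRHS](bigD1 k)//= lerDl; apply: sumr_ge0 => j _.
    by have [->|ji] := eqVneq j i; [exact/qi/zi|exact: qj0].
  have zi0 : 0 < x ord0 i - x0 ord0 i.
    rewrite lt_neqAle (andP (zi _ Kx)).1 andbT eq_sym; apply/eqP => z0.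
    have rx : mirror i x0 x = x.
      by rewrite /mirror -opprB z0 oppr0 mulr0 scale0r addr0.
    have := psi_ge i; move: wx; rewrite /w rx subrr mul0r z0.
    have := qi 0; lra.
  have zk k : `|x ord0 k - x0 ord0 k| < d.
    rewrite lt_neqAle Kx.1 andbT; apply/eqP => zd.
    have : M <= q k (x ord0 k - x0 ord0 k).
      have [ki|ki] := eqVneq k i.
        by rewrite ki; rewrite ki gtr0_norm// in zd; rewrite zd qid.
      by rewrite qj// -[(x ord0 k - _) ^+ 2]real_normK ?num_real// zd divfK ?expf_neq0 ?gt_eqF.
    by move: wx (psi_ge k) (phiM _ Kx); rewrite /w; lra.
  have line j : (partial j (partial j u) x -
      partial j (partial j u) (mirror i x0 x)) / 2 - 2 * A j <= 0.
    pose z := x ord0 j - x0 ord0 j; pose e : R := (-1) ^+ (j == i).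
    have ee : e * e = 1 by rewrite -expr2 /e sqrr_sign.
    pose h s := (u (x + s *: basis j) - u (mirror i x0 x + (e * s) *: basis j)) / 2
      - q j (z + s).
    pose dh s := (partial j u (x + s *: basis j)
      - e * partial j u (mirror i x0 x + (e * s) *: basis j)) / 2
      - (2 * A j * (z + s) + (if j == i then B else 0)).
    pose ddh s := (partial j (partial j u) (x + s *: basis j)
      - partial j (partial j u) (mirror i x0 x + (e * s) *: basis j)) / 2 - 2 * A j.
    have : ddh 0 <= 0.
      have dq s : is_derive s 1 (fun s => q j (z + s))
          (2 * A j * (z + s) + (if j == i then B else 0)).
        have dz : is_derive s 1 (fun s : R => z + s) 1.
          have := is_derive_add (is_derive_const z s 1) (is_derive_id s 1).
          by rewrite add0r.
        have := is_derive_add (is_derive_scale (A j) (is_derive_mul dz dz))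
          (is_derive_scale (if j == i then B else 0) dz).
        move=> D; apply: (is_derive_eq D); ring.
      have des s : is_derive s 1 (fun s : R => e * s) e.
        by have := is_derive_scale e (is_derive_id s 1); rewrite mulr1.
      have half (f : R -> R) (df s : R) : is_derive s 1 f df ->
          is_derive s 1 (fun s => f s / 2) (df / 2).
        move=> D; have := is_derive_mul D (is_derive_const (2^-1 : R) s 1).
        by rewrite mulr0 addr0.
      have d1 s : is_derive s 1 h (dh s).
        apply: is_derive_sub (dq s); apply: half; apply: is_derive_sub.
          exact: (partial2_line x j s u2).1.
        have := is_derive_comp (partial2_line (mirror i x0 x) j (e * s) u2).1 (des s).
        by rewrite mulrC.
      have d2 s : is_derive s 1 dh (ddh s).
        apply: is_derive_sub; last first.
          have dz : is_derive s 1 (fun s : R => z + s) 1.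
            have := is_derive_add (is_derive_const z s 1) (is_derive_id s 1).
            by rewrite add0r.
          have := is_derive_add (is_derive_scale (2 * A j) dz)
            (is_derive_const (if j == i then B else 0) s 1).
          by rewrite mulr1 addr0.
        apply: half; apply: is_derive_sub.
          exact: (partial2_line x j s u2).2.
        have D := is_derive_scale e
          (is_derive_comp (partial2_line (mirror i x0 x) j (e * s) u2).2 (des s)).
        by apply: (is_derive_eq D); rewrite mulrCA ee mulr1.
      have c2 : continuous ddh.
        have [_ _ /(_ j j)[_ cjj]] := u2.
        apply: continuous_add; last exact: continuous_const.
        apply: continuous_mul; last exact: continuous_const.
        apply: continuous_add; first exact: continuous_line.
        apply: continuous_opp.
        apply: (@continuous_after R R (fun s => partial j (partial j u)
           (mirror i x0 x + s *: basis j)) (fun s => e * s)).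
          exact: continuous_line.
        by apply: continuous_mul; [exact: continuous_const|move=> s; exact: cvg_id].
      pose d' := Num.min (d - `|z|) (if j == i then z else 1).
      have d'0 : 0 < d'.
        rewrite lt_min subr_gt0 zk /=; case: eqP => // ji.
        by rewrite /z ji.
      apply: (second_derivative_at_max d1 d2 c2 d'0) => t; rewrite lt_min => /andP[td ti].
      have Kt : K (x + t *: basis j).
        split=> [k|]; rewrite coord_shift.
          have [->|kj] := eqVneq k j; last by rewrite mulr0 addr0; exact: Kx.1.
          rewrite mulr1 addrAC (le_trans (ler_normD _ _))//.
          by rewrite -lerBrDl ltW.
        have [ij|ij] := eqVneq i j; last by rewrite mulr0 addr0; exact: Kx.2.
        move: ti; rewrite -ij eqxx mulr1 /z -ij ltr_norml; lra.
      have := xmax _ (mem_set Kt); rewrite /w mirror_shift (bigD1 j)//=.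
      rewrite [X in _ <= _ - X](bigD1 j)//= coord_shift eqxx mulr1.
      rewrite (eq_bigr (fun k => q k (x ord0 k - x0 ord0 k))) => [|k kj]; last first.
        by rewrite coord_shift (negPf kj) mulr0 addr0.
      rewrite /h mulr0 scale0r !addr0 -/z -/e [x ord0 j + t - _]addrAC -/z.
      rewrite !opprD !addrA lerD2r; exact.
    by rewrite /ddh mulr0 !scale0r !addr0.
  have : \sum_j ((partial j (partial j u) x -
      partial j (partial j u) (mirror i x0 x)) / 2 - 2 * A j) <= 0.
    by apply: sumr_le0 => j _; exact: line.
  rewrite sumrB -mulr_suml sumrB -mulr_sumr.
  have -> : \sum_j A j = - (N / 2).
    rewrite (bigD1 i)//= {1}/A eqxx.
    rewrite (eq_bigr (fun=> M / d ^+ 2)) => [|j ji]; last by rewrite /A (negPf ji).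
    have nn : (n.-1)%:R = n%:R - 1 :> R.
      have n0 : (0 < n)%N by exact: leq_ltn_trans (ltn_ord i).
      by rewrite -[in RHS](prednK n0) -natr1 addrK.
    rewrite sumr_const cardC1 card_ord -[_ *+ n.-1]mulr_natr nn.
    by field; rewrite gt_eqF.
  have := uN x Kx.1; have := uN _ (cube_mirror x Kx).
  rewrite -[X in (X - _) / 2 - _]/(laplacian u x).
  rewrite -[X in (_ - X) / 2 - _]/(laplacian u (mirror i x0 x)).
  move: (laplacian u x) (laplacian u _) => a b.
  by rewrite !ltr_norml => /andP[? ?] /andP[? ?] ?; lra.
(* Only the term [q i] of the barrier survives on the axis through [x0]. *)
have axis t : 0 <= t <= d -> u (x0 + t *: basis i) - u (x0 + (- t) *: basis i) <= 2 * (B * t).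
  move=> td; have Kt : K (x0 + t *: basis i).
    split=> [k|]; rewrite coord_shift ?eqxx ?mulr1; last by lra.
    rewrite addrAC subrr add0r; case: (k == i); rewrite ?mulr1 ?mulr0 ?normr0 ?(ltW d0)//.
    by rewrite ger0_norm; lra.
  have := xmax _ (mem_set Kt) => /le_trans/(_ wx); rewrite /w.
  have -> : mirror i x0 (x0 + t *: basis i) = x0 + (- t) *: basis i.
    apply/rowP => k; rewrite mirror_coord !coord_shift eqxx.
    by have [->|ki] := eqVneq k i; rewrite /= ?mulr1 ?mulr0; ring.
  rewrite (bigD1 i)//= big1 => [|j ji]; last first.
    by rewrite coord_shift (negPf ji) mulr0 addr0 subrr qj// expr0n mulr0.
  rewrite coord_shift eqxx mulr1 addr0 [x0 _ _ + t]addrC addrK /q eqxx.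
  have : A i * t ^+ 2 <= 0.
    rewrite nmulr_rle0 ?sqr_ge0// /A eqxx.
    have : 0 <= (n%:R - 1) * M / d ^+ 2.
      by apply: divr_ge0; [apply: mulr_ge0 => //; lra|exact: exprn_ge0 (ltW d0)].
    by lra.
  by lra.
rewrite leNgt; apply/negP => Bu.
have [_ /(_ i)[dui cui] _] := u2.
have [e e0 eP] := continuous_eps x0 cui (ltac:(by rewrite subr_gt0; exact: Bu) :
  0 < partial i u x0 - B).
pose t := Num.min e d / 2.
have m0 : 0 < Num.min e d by rewrite lt_min e0.
have me : Num.min e d <= e by rewrite ge_min lexx.
have md : Num.min e d <= d by rewrite ge_min lexx orbT.
have t0 : 0 < t by rewrite divr_gt0.
have big s : `|s| <= t -> B < partial i u (x0 + s *: basis i).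
  move=> st; have := eP (x0 + s *: basis i); rewrite ltr_norml => H.
  have /andP[+ _] : - (partial i u x0 - B) < partial i u (x0 + s *: basis i) - partial i u x0
     < partial i u x0 - B.
    apply: H => k; rewrite coord_shift addrAC subrr add0r.
    have : `|s * (k == i)%:R| <= t.
      by case: (k == i); rewrite ?mulr1 ?mulr0 ?normr0 ?(ltW t0).
    by rewrite /t; lra.
  by lra.
have [th th01 E] := mvt_coord x0 t dui.
have [th' th'01 E'] := mvt_coord x0 (- t) dui.
have b1 := big (th * t); have b2 := big (th' * - t).
have ht (r : R) : 0 <= r <= 1 -> `|r * t| <= t.
  case/andP=> r0 r1; rewrite ger0_norm; last exact: mulr_ge0 r0 (ltW t0).
  exact: ler_piMl (ltW t0) r1.
have {}b1 := b1 (ht _ th01).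
have {}b2 : B < partial i u (x0 + (th' * - t) *: basis i).
  by apply: b2; rewrite mulrN normrN; exact: ht.
have td : 0 <= t <= d by rewrite (ltW t0)/= /t; lra.
have tri (a b v p r l : R) : a - v = p -> b - v = r -> a - b <= l -> p - r <= l.
  by move=> <- <-; rewrite opprB addrA subrK.
have := tri _ _ _ _ _ _ E E' (axis t td).
move: b1 b2; move: (partial i u _) (partial i u _) => p1 p2 b1 b2.
have h1 : t * B < t * p1 by rewrite ltr_pM2l.
have h2 : t * B < t * p2 by rewrite ltr_pM2l.
by rewrite mulNr opprK; lra.
Qed.

End GradientBound.

Section GradientEstimate.
Variables (R : realType) (n : nat).
Local Notation V := ('rV[R]_n).
Implicit Types (u : V -> R) (x y : V) (i j k : 'I_n) (c d r s t L M N S : R).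

Lemma partial_opp u i : has_partial i u ->
  has_partial i (fun x => - u x) /\
  partial i (fun x => - u x) = fun x => - partial i u x.
Proof.
move=> du; have D x : is_derive x (basis i) (fun x => - u x) (- partial i u x).
  have := is_derive_scale (- 1) (derivableP (du x)).
  by rewrite mulN1r; congr is_derive; apply/funext => y; rewrite mulN1r.
split=> [x|]; first exact: is_derive_ex (D x).
by apply/funext => x; exact: is_derive_unique.
Qed.

Lemma class_C2_opp u : class_C2 u -> class_C2 (fun x => - u x) /\
  laplacian (fun x => - u x) = fun x => - laplacian u x.
Proof.
move=> [cu u1 u2].
have E i := (partial_opp (u1 i).1).2.
split; last first.
  apply/funext => x; rewrite /laplacian -sumrN; apply: eq_bigr => i _.
  by rewrite E (partial_opp (u2 i i).1).2.
split; first exact: continuous_opp.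
- move=> i; split; first exact: (partial_opp (u1 i).1).1.
  by rewrite E; apply: continuous_opp; exact: (u1 i).2.
- move=> i j; rewrite E; have [D ->] := partial_opp (u2 i j).1; split=> //.
  by apply: continuous_opp; exact: (u2 i j).2.
Qed.

Lemma derivative_bound_cube_abs u i x0 c d M N : class_C2 u -> 0 < d ->
    (forall y, (forall k, `|y ord0 k - x0 ord0 k| <= d) -> `|u y - c| <= M) ->
    (forall y, (forall k, `|y ord0 k - x0 ord0 k| <= d) -> `|laplacian u y| < N) ->
  `|partial i u x0| <= n%:R * M / d + N * d / 2.
Proof.
move=> u2 d0 uM uN; rewrite ler_norml (derivative_bound_cube i u2 d0 uM uN) andbT.
have [u2' lap] := class_C2_opp u2.
have := @derivative_bound_cube _ _ (fun x => - u x) i x0 (- c) d M N u2' d0.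
rewrite lap (partial_opp _).2; last by case: u2 => _ /(_ i)[].
move=> H; rewrite lerNl; apply: H => y yd; last by rewrite normrN; exact: uN.
by rewrite -opprD normrN; exact: uM.
Qed.

(** Interior gradient bound for [Delta u = O(|grad u|) + O(1)]. The first order term is
    absorbed by weighting the gradient with the distance to the boundary: for the
    supremum [S] of [r * |grad u (y)|] over cubes of half-side [r] centred at [y] and
    contained in the unit cube, the bound on a small cube gives [S <= A + S / 2]. *)
Lemma gradient_bound L : 0 <= L -> exists2 C : R, 0 < C &
  forall u c M x0, class_C2 u -> 0 < M ->
    (forall y, (forall k, `|y ord0 k - x0 ord0 k| <= 1) ->
       `|u y - c| <= M /\
       `|laplacian u y| <= L * \sum_j `|partial j u y| + M) ->
    forall i, `|partial i u x0| <= C * M.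
Proof.
move=> L0; pose nr : R := n%:R; have nr0 : 0 <= nr by exact: ler0n.
pose kap : R := (2 * (1 + nr * L))^-1.
have nL : 0 <= nr * L by exact: mulr_ge0.
have kap0 : 0 < kap by rewrite invr_gt0; lra.
have kapE : kap * (2 * (1 + nr * L)) = 1 by rewrite mulVf// gt_eqF//; lra.
have kap12 : kap <= 1 / 2 by nra.
have kapnL : nr * L * kap <= 1 / 2 by nra.
pose K1 := nr * (nr / kap + kap).
have K10 : 0 <= K1 by rewrite mulr_ge0// addr_ge0 ?divr_ge0// ltW.
exists (2 * K1 + 1); first by lra.
move=> u c M x0 u2 M0 H i.
pose G y := \sum_j `|partial j u y|.
have G0 y : 0 <= G y by exact: sumr_ge0.
pose E := [set z : R | exists y r, [/\ 0 <= r, forall k, `|y ord0 k - x0 ord0 k| + r <= 1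
   & z = r * G y]].
have Ex0 : E (1 * G x0).
  by exists x0, 1; split=> // k; rewrite subrr normr0 add0r.
have cG : continuous G.
  by apply: continuous_sum => j; apply: continuous_abs; case: u2 => _ /(_ j)[].
pose A0 := 1 + \sum_k `|x0 ord0 k|.
have [B B0 GB] := bounded_on_box A0 cG.
have hsE : has_sup E.
  split; first by exists (1 * G x0).
  exists B => z [y [r [r0 yr ->]]].
  have GyB : G y <= B.
    rewrite -(ger0_norm (G0 y)); apply: GB => k.
    have := yr k; have := lerB_dist (y ord0 k) (x0 ord0 k).
    have : `|x0 ord0 k| <= \sum_k `|x0 ord0 k| by rewrite (bigD1 k)//= lerDl sumr_ge0.
    rewrite /A0; lra.
  have r1 : r <= 1 by have := yr i; have := normr_ge0 (y ord0 i - x0 ord0 i); lra.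
  by have := G0 y; nra.
pose S := sup E.
have S0 : 0 <= S.
  by apply: le_trans (ub_le_sup hsE.2 Ex0); rewrite mul1r.
have step : S <= K1 * M + S / 2.
  apply: ge_sup; first by exists (1 * G x0).
  move=> z [y [r [r0 yr ->]]].
  have [->|rn0] := eqVneq r 0; first by rewrite mul0r; have := mulr_ge0 K10 (ltW M0); lra.
  have {}r0 : 0 < r by rewrite lt_neqAle eq_sym rn0.
  have r1 : r <= 1 by have := yr i; have := normr_ge0 (y ord0 i - x0 ord0 i); lra.
  pose d := kap * r; have d0 : 0 < d by rewrite mulr_gt0.
  have d2 : d <= r / 2 by rewrite /d; nra.
  pose N := L * (2 * S / r) + 2 * M.
  have sub y' : (forall k, `|y' ord0 k - y ord0 k| <= d) ->
      forall k, `|y' ord0 k - x0 ord0 k| + r / 2 <= 1.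
    move=> y'd k; have := y'd k; have := yr k.
    have := ler_distD (y ord0 k) (y' ord0 k) (x0 ord0 k); lra.
  have bound j : `|partial j u y| <= nr * M / d + N * d / 2.
    apply: (@derivative_bound_cube_abs u j y c d M N u2 d0) => y' /sub y'x0.
      by apply: (H _ _).1 => k; have := y'x0 k; lra.
    have y'1 k : `|y' ord0 k - x0 ord0 k| <= 1 by have := y'x0 k; lra.
    apply: (le_lt_trans (H _ y'1).2); rewrite -/(G y').
    have : r / 2 * G y' <= S.
      by apply: ub_le_sup; [exact: hsE.2|exists y', (r / 2); split=> //; lra].
    have -> : N = L * (2 * S / r) + 2 * M by [].
    move=> GS; have : G y' <= 2 * S / r by rewrite ler_pdivlMr//; lra.
    by move=> /(ler_wpM2l L0); lra.
  have GG : G y <= nr * (nr * M / d + N * d / 2).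
    rewrite /G; apply: (le_trans (ler_sum _ (fun j _ => bound j))).
    by rewrite sumr_const card_ord -[_ *+ n]mulr_natl; exact: lexx.
  have rG : r * G y <= r * (nr * (nr * M / d + N * d / 2)) by rewrite ler_pM2l.
  apply: (le_trans rG).
  have -> : r * (nr * (nr * M / d + N * d / 2)) =
    nr * (nr / kap) * M + (nr * L * kap) * (S * r) + nr * kap * M * (r * r).
    by rewrite /N /d; field; rewrite !gt_eqF.
  have rr : r * r <= 1 by nra.
  have Sr : S * r <= S by nra.
  have e1 : (nr * L * kap) * (S * r) <= S / 2.
    have Sr0 : 0 <= S * r by nra.
    have : (nr * L * kap) * (S * r) <= 1 / 2 * (S * r) by exact: ler_wpM2r.
    by lra.
  have e2 : nr * kap * M * (r * r) <= nr * kap * M.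
    by rewrite ler_piMr// !mulr_ge0// ltW.
  by rewrite /K1; lra.
have GS : G x0 <= S by have := ub_le_sup hsE.2 Ex0; rewrite mul1r.
have : `|partial i u x0| <= G x0 by rewrite /G (bigD1 i)//= lerDl sumr_ge0.
by lra.
Qed.

End GradientEstimate.

(** * Bounds and decay of monotone solutions *)

Section ProductFunctions.
Variables (R : realType) (n : nat).
Local Notation V := ('rV[R]_n).
Implicit Types (g dg : 'I_n -> R -> R) (x : V) (j k : 'I_n) (A : R).

Lemma C1_prod g dg : (forall k (t : R), is_derive t 1 (g k) (dg k t)) ->
    (forall k, continuous (dg k)) ->
  C1 (fun x : V => \prod_k g k (x ord0 k)) /\
  forall j, partial j (fun x : V => \prod_k g k (x ord0 k)) =
    fun x => dg j (x ord0 j) * \prod_(k | k != j) g k (x ord0 k).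
Proof.
move=> d1 cd; have cx k := @coord_continuous R 1 n ord0 k.
have cg k : continuous (fun x : V => g k (x ord0 k)).
  exact: continuous_after (is_derive_continuous (d1 k)) (cx k).
apply: C1_of => [|j|j x].
- by apply: continuous_prod.
- apply: continuous_mul; last exact: continuous_prod.
  exact: continuous_after (cd j) (cx j).
- apply: is_derive_of_line.
  pose P := \prod_(k | k != j) g k (x ord0 k).
  have E : (fun s : R => \prod_k g k ((x + s *: basis j) ord0 k)) =
           (fun s : R => g j (x ord0 j + s) * P).
    apply/funext => s; rewrite (bigD1 j)//= coord_shift eqxx mulr1; congr (_ * _).
    by apply: eq_bigr => k kj; rewrite coord_shift (negPf kj) mulr0 addr0.
  rewrite E; have D : is_derive (0 : R) 1 (fun s : R => x ord0 j + s) 1.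
    have := is_derive_add (is_derive_const (x ord0 j) (0 : R) 1) (is_derive_id (0 : R) 1).
    by rewrite add0r.
  have := is_derive_mul (is_derive_comp (d1 j (x ord0 j + 0)) D)
    (is_derive_const P (0 : R) 1).
  by rewrite addr0 mulr1 mulr0 addr0.
Qed.

End ProductFunctions.

Section C2Functions.
Variables (R : realType) (n : nat) (u : 'rV[R]_n -> R).

Lemma C2_C1 : class_C2 u -> C1 u.
Proof. by move=> [cu u1 _]; split. Qed.

Lemma C2_partial_C1 i : class_C2 u -> C1 (partial i u).
Proof. by move=> [_ u1 u2]; split=> [|j]; [exact: (u1 i).2|exact: u2]. Qed.

End C2Functions.

Section BoundsOnSolutions.
Variables (R : realType) (p : nat).
Local Notation n := p.+3.
Local Notation V := ('rV[R]_n).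
Variables (a1 a2 : R -> R) (u : V -> R) (L : R).
Hypotheses (L0 : 0 <= L) (a1L : forall t, `|a1 t| <= L) (a2L : forall t, `|a2 t| <= L).
Hypotheses (u_solution : classical_solution a1 a2 u) (u_monotone : monotone_last u)
  (u_convergent : asymptotically_convergent u).
Implicit Types (x y : V) (i j k : 'I_n) (s t T A d : R).
Local Notation last := (@ord_max p.+2).

Lemma solution_C2 : class_C2 u. Proof. by case: u_solution. Qed.

Lemma solution_C1 : C1 u. Proof. exact: C2_C1 solution_C2. Qed.

Lemma solution_increasing x s : 0 <= s -> u x <= u (x + s *: basis last).
Proof.
move=> s0; have [_ /(_ last)[du _] _] := solution_C2.
have [th _ E] := mvt_coord x s du.
by rewrite -subr_ge0 E mulr_ge0// ltW// u_monotone.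
Qed.

Definition first_coordinates x : 'rV[R]_p.+2 := \row_j x ord0 (lift ord_max j).

Lemma append_last_line x s :
  x + s *: basis last = append_last (first_coordinates x) (x ord0 last + s).
Proof.
apply/rowP => k; rewrite coord_shift mxE; case: unliftP => [j ->|->].
  by rewrite mxE eq_sym (negPf (neq_lift _ _)) mulr0 addr0.
by rewrite eqxx mulr1.
Qed.

Lemma solution_limit x : u (x + s *: basis last) @[s --> +oo] --> (1 : R) /\
  u (x + s *: basis last) @[s --> -oo] --> (-1 : R).
Proof.
have [hp hm] := u_convergent (first_coordinates x).
have E : (fun s => u (x + s *: basis last)) =
  (fun t => u (append_last (first_coordinates x) t)) \o (fun s => x ord0 last + s).
  by apply/funext => s; rewrite append_last_line.
split.
- rewrite E; apply: cvg_comp hp; apply/cvgryPge => B.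
  near=> s; rewrite addrC -lerBlDr; near: s; apply: nbhs_pinfty_ge; exact: num_real.
- rewrite E; apply: cvg_comp hm; apply/cvgrNyPle => B.
  near=> s; rewrite addrC -lerBrDr; near: s; apply: nbhs_ninfty_le; exact: num_real.
Unshelve. all: by end_near. Qed.

Lemma solution_bound x : -1 <= u x <= 1.
Proof.
have [hp hm] := solution_limit x; apply/andP; split.
- rewrite leNgt; apply/negP => ux; near (ninfty_nbhs R) => s.
  have h1 : u x < u (x + s *: basis last).
    by near: s; exact: (cvgr_gt _ hm _ ux).
  have h2 : s <= 0 by near: s; apply: nbhs_ninfty_le; exact: num_real.
  have := solution_increasing (x + s *: basis last) (s := - s).
  by rewrite oppr_ge0 scaleNr addrK => /(_ h2); lra.
- rewrite leNgt; apply/negP => ux; near (pinfty_nbhs R) => s.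
  have h1 : u (x + s *: basis last) < u x.
    by near: s; exact: (cvgr_lt _ hp _ ux).
  have h2 : 0 <= s by near: s; apply: nbhs_pinfty_ge; exact: num_real.
  by have := solution_increasing x h2; lra.
Unshelve. all: by end_near. Qed.

Definition drift j x : R :=
  if j == idx1 p then a1 (x ord0 (idx1 p))
  else if j == idx2 p then a2 (x ord0 (idx2 p)) else 0.

Lemma drift_sum x (f : 'I_n -> R) : \sum_j drift j x * f j =
  a1 (x ord0 (idx1 p)) * f (idx1 p) + a2 (x ord0 (idx2 p)) * f (idx2 p).
Proof.
rewrite (bigD1 (idx1 p))//= (bigD1 (idx2 p))//= big1 ?addr0.
  by rewrite /drift !eqxx.
by move=> j /andP[j1 j2]; rewrite /drift (negPf j1) (negPf j2) mul0r.
Qed.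

Lemma drift_bound j x : `|drift j x| <= L.
Proof. by rewrite /drift; case: ifP => // _; case: ifP; rewrite ?normr0. Qed.

Lemma solution_equation x :
  laplacian u x = \sum_j drift j x * partial j u x - (u x - u x ^+ 3).
Proof. by rewrite drift_sum; have [_ /(_ x)] := u_solution; lra. Qed.

(** The drift is bounded by [L], so the equation bounds the Laplacian by the gradient
    plus the reaction term. *)
Lemma solution_gradient_bound : exists2 C : R, 0 < C & forall c M x0, 0 < M ->
    (forall y, (forall k, `|y ord0 k - x0 ord0 k| <= 1) ->
       `|u y - c| <= M /\ `|u y - u y ^+ 3| <= M) ->
    forall i, `|partial i u x0| <= C * M.
Proof.
have [C C0 H] := @gradient_bound R n L L0; exists C => // c M x0 M0 uM.
apply: (H u c M x0 solution_C2 M0) => y /uM[h1 h2]; split=> //.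
rewrite solution_equation (le_trans (ler_normB _ _))// lerD//.
rewrite (le_trans (ler_norm_sum _ _ _))// mulr_sumr; apply: ler_sum => j _.
by rewrite normrM ler_wpM2r// drift_bound.
Qed.

Lemma solution_gradient_bounded : exists2 G : R, 0 < G & forall x i, `|partial i u x| <= G.
Proof.
have [C C0 H] := solution_gradient_bound; exists (C * 2); first by rewrite mulr_gt0.
move=> x i; apply: (H 0) => // y _; have := solution_bound y; rewrite subr0 => uy.
split; first by rewrite ler_norml; lra.
by rewrite ler_norml; apply/andP; split; nra.
Qed.

(** Monotone pointwise convergence to a continuous limit is locally uniform. *)
Lemma solution_dini A d : 0 < d -> exists T, forall x,
  (forall k, k != last -> `|x ord0 k| <= A) -> T <= x ord0 last -> 1 - d < u x.
Proof.
move=> d0; have cu := C1_continuous solution_C1.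
have /compact_near_coveringP/(_ R (pinfty_nbhs R)
  (fun T x => 1 - d < u (x + T *: basis last))) := @box_compact R n `|A|.
case=> [x _|T [_ TP]].
  have [hp _] := solution_limit x.
  have : \forall s \near pinfty_nbhs R, 1 - d < u (x + s *: basis last).
    by apply: (cvgr_gt _ hp); lra.
  move=> [T [_ TP]]; have uT : 1 - d < u (x + (T + 1) *: basis last) by apply: TP; lra.
  have e0 : 0 < u (x + (T + 1) *: basis last) - (1 - d) by lra.
  have [e e00 eP] := continuous_eps (x + (T + 1) *: basis last) cu e0.
  exists (ball x e, [set s | T + 1 < s]).
    by split; [exact: nbhsx_ballx|exists (T + 1); split=> //; exact: num_real].
  move=> [y s] [/= [_ xy] Ts].
  have := eP (y + (T + 1) *: basis last).
  rewrite ltr_norml => H; have {H}/andP[H _] : - (u (x + (T + 1) *: basis last) - (1 - d))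
    < u (y + (T + 1) *: basis last) - u (x + (T + 1) *: basis last)
    < u (x + (T + 1) *: basis last) - (1 - d).
    apply: H => k; rewrite !coord_shift opprD addrACA subrr addr0.
    by have := xy ord0 k; rewrite /ball/= distrC.
  have : u (y + (T + 1) *: basis last) <= u (y + s *: basis last).
    have -> : y + s *: basis last =
      y + (T + 1) *: basis last + (s - (T + 1)) *: basis last.
      by rewrite -addrA -scalerDl subrKC.
    by apply: solution_increasing; lra.
  by lra.
exists (T + 1) => x xA Tx.
pose y := x + (- x ord0 last) *: basis last.
have -> : x = y + x ord0 last *: basis last by rewrite /y scaleNr subrK.
apply: (TP (x ord0 last)); first by lra.
move=> k /=; rewrite /y coord_shift; have [->|kl] := eqVneq k last.
  by rewrite mulr1 subrr normr0.
rewrite mulr0 addr0; apply: le_trans (ler_norm A); exact: xA.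
Qed.

(** By the previous estimate [u] is uniformly close to 1 on unit cubes far up, where the
    reaction term is small too; the gradient bound then applies to [u - 1]. *)
Lemma solution_decay : exists2 C : R, 0 < C & forall A d, 0 < d <= 1 -> exists T, forall x,
  (forall k, k != last -> `|x ord0 k| <= A) -> T <= x ord0 last ->
  1 - u x <= d /\ forall i, `|partial i u x| <= C * d.
Proof.
have [C C0 H] := solution_gradient_bound; exists (C * 2); first by rewrite mulr_gt0.
move=> A d d01; have /andP[d0 d1] := d01; have [T TP] := solution_dini (A + 1) d0.
exists (T + 1) => x xA Tx; split=> [|i].
  have : 1 - d < u x by apply: TP => [k /xA|]; lra.
  by lra.
rewrite -mulrA; apply: (H 1) => [|y yx]; first by lra.
have uy : 1 - d < u y.
  apply: TP => [k kl|]; last by have := yx last; rewrite ler_norml; lra.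
  have := ler_distD (x ord0 k) (y ord0 k) 0; rewrite !subr0.
  by have := xA k kl; have := yx k; lra.
have := solution_bound y => uy1; split; first by rewrite ler_norml; lra.
have -> : u y - u y ^+ 3 = (1 - u y) * (u y * (1 + u y)) by ring.
rewrite normrM mulrC ler_pM//; rewrite ler_norml; apply/andP; split; nra.
Qed.

End BoundsOnSolutions.

(** * The stress-energy identity *)

Section StressEnergy.
Variables (R : realType) (p : nat).
Local Notation n := p.+3.
Local Notation V := ('rV[R]_n).
Variables (a1 a2 : R -> R) (u : V -> R).
Hypotheses (u_solution : classical_solution a1 a2 u).
Hypotheses (a1_continuous : continuous a1) (a2_continuous : continuous a2).
Implicit Types (x y : V) (i j k : 'I_n) (s t T A d : R).
Local Notation last := (@ord_max p.+2).
Local Notation drift := (drift a1 a2).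

Definition weight1 t : R := expR (- integral_from0 a1 t).
Definition weight2 t : R := expR (- integral_from0 a2 t).
(** The integrating factor of the drift: the equation is [- div (weight grad u) = weight
    (u - u^3)]. *)
Definition weight x : R := weight1 (x ord0 (idx1 p)) * weight2 (x ord0 (idx2 p)).

Lemma weight_gt0 x : 0 < weight x.
Proof. by rewrite mulr_gt0// expR_gt0. Qed.

Lemma weight_C1 : C1 weight /\
  forall j, partial j weight = fun x => - drift j x * weight x.
Proof.
have [_ d1 c1] := weight_calculus a1_continuous.
have [_ d2 c2] := weight_calculus a2_continuous.
have cd (a w : R -> R) : continuous a -> continuous w -> continuous (fun t => - a t * w t).
  by move=> ca cw; apply: continuous_mul => //; exact: continuous_opp.
have [W1 P1] := C1_coord (n := n) (idx1 p) d1 (cd _ _ a1_continuous c1).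
have [W2 P2] := C1_coord (n := n) (idx2 p) d2 (cd _ _ a2_continuous c2).
have [C P] := C1_mul W1 W2; split; first exact: C.
move=> j; rewrite (P j); apply/funext => x; rewrite P1 P2 /drift /weight /weight1 /weight2.
move: (expR _) (expR _) => e1 e2; rewrite (eq_sym (idx1 p)) (eq_sym (idx2 p)).
have [->|j1] := eqVneq j (idx1 p).
  have -> : (idx1 p == idx2 p) = false by [].
  by rewrite mulr1 mulr0 mulr0 addr0 mulrA.
rewrite mulr0 mul0r add0r; have [_|_] := eqVneq j (idx2 p).
  by rewrite mulr1; ring.
by rewrite !mulr0 oppr0 mul0r.
Qed.

Lemma drift_last x : drift last x = 0.
Proof. by []. Qed.

Definition energy x : R :=
  2^-1 * \sum_j partial j u x ^+ 2 + 4^-1 * (1 - u x ^+ 2) ^+ 2.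

Let u2 : class_C2 u := solution_C2 u_solution.

Lemma is_derive_sqr (f : V -> R) x i df : is_derive x (basis i) f df ->
  is_derive x (basis i) (fun y => f y ^+ 2) (2 * f x * df).
Proof.
move=> D; have := is_derive_mul D D.
by under eq_fun do rewrite -expr2; congr is_derive; ring.
Qed.

Lemma energy_C1 : C1 energy /\ forall i, partial i energy =
  fun x => \sum_j partial j u x * partial i (partial j u) x
    + (u x ^+ 3 - u x) * partial i u x.
Proof.
have cu := C1_continuous (C2_C1 u2).
have cp j := C1_continuous (C2_partial_C1 j u2).
have cpp i j := C1_partial_continuous i (C2_partial_C1 j u2).
apply: C1_of => [|i|i x].
- apply: continuous_add; apply: continuous_mul; try exact: continuous_const.
    by apply: continuous_sum => j; exact: continuous_pow.
  apply: continuous_pow; apply: continuous_add; first exact: continuous_const.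
  by apply: continuous_opp; exact: continuous_pow.
- apply: continuous_add; first by apply: continuous_sum => j; exact: continuous_mul.
  apply: continuous_mul => //; apply: continuous_add; first exact: continuous_pow.
  exact: continuous_opp.
- have du := C1_is_derive i x (C2_C1 u2).
  have dp j := C1_is_derive i x (C2_partial_C1 j u2).
  have D1 := is_derive_scale 2^-1
    (is_derive_sum (index_enum 'I_n) xpredT (fun j => is_derive_sqr (dp j))).
  have D2 := is_derive_scale 4^-1 (is_derive_sqr (is_derive_sub
    (is_derive_const 1 x (basis i)) (is_derive_sqr du))).
  apply: (is_derive_eq (is_derive_add D1 D2)).
  rewrite mulr_sumr; congr (_ + _).
    apply: eq_bigr => j _; move: (partial j u x) (partial i _ x) => b c.
    by rewrite !mulrA mulVf ?mul1r// pnatr_eq0.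
  by move: (u x) (partial i u x) => b c; field.
Qed.

Lemma gradient_energy_le x : 2^-1 * \sum_j partial j u x ^+ 2 <= energy x.
Proof. by rewrite lerDl mulr_ge0// sqr_ge0. Qed.

Lemma energy_ge0 x : 0 <= energy x.
Proof.
apply: le_trans (gradient_energy_le x); rewrite mulr_ge0//.
by apply: sumr_ge0 => j _; exact: sqr_ge0.
Qed.

Definition flux (rho : V -> R) j x : R :=
  rho x * (weight x * (partial last u x * partial j u x)).

(** The stress-energy identity: the flux [weight * d_n u * grad u] has divergence
    [d_n (weight * energy)], because neither the weight nor the drift depends on the
    last variable. *)
Lemma stress_energy (rho : V -> R) : C1 rho -> Cc rho ->
  rV_integral (fun x => weight x * energy x * partial last rho x) =
  rV_integral (fun x => weight x * partial last u x *
                        \sum_j partial j u x * partial j rho x).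
Proof.
move=> r1 rc; have [W1 PW] := weight_C1; have [E1 PE] := energy_C1.
have P1 j := C2_partial_C1 j u2.
have [cr cW cE] := And3 (C1_continuous r1) (C1_continuous W1) (C1_continuous E1).
have cp j := C1_continuous (P1 j).
have drc j : Cc (partial j rho).
  by apply: Cc_partial => //; exact: C1_partial_continuous.
have flux1 j := C1_mul r1 (C1_mul W1 (C1_mul (P1 last) (P1 j)).1).1.
have flux_c j : Cc (flux rho j).
  by apply: Cc_mulr => //; do 2 apply: continuous_mul => //.
have e1 := C1_mul r1 (C1_mul W1 E1).1.
have e_c : Cc (fun x => rho x * (weight x * energy x)).
  by apply: Cc_mulr => //; exact: continuous_mul.
have pf_c j : Cc (partial j (flux rho j)).
  by apply: Cc_partial => //; exact: C1_partial_continuous (flux1 j).1.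
have pe_c : Cc (partial last (fun x => rho x * (weight x * energy x))).
  by apply: Cc_partial => //; exact: C1_partial_continuous e1.1.
have Zf j : rV_integral (partial j (flux rho j)) = 0.
  by apply: rV_integral_partial => //; have [_ /(_ j)[]] := (flux1 j).1.
have Ze : rV_integral (partial last (fun x => rho x * (weight x * energy x))) = 0.
  by apply: rV_integral_partial => //; have [_ /(_ last)[]] := e1.1.
have c1 : Cc (fun x => weight x * partial last u x * \sum_j partial j u x * partial j rho x).
  apply: Cc_mull; last exact: continuous_mul.
  by apply: Cc_sum => j; exact: Cc_mull.
have c2 : Cc (fun x => weight x * energy x * partial last rho x).
  by apply: Cc_mull => //; exact: continuous_mul.
apply/eqP; rewrite eq_sym -subr_eq0 -rV_integral_sub//; apply/eqP.
have -> : (fun x => weight x * partial last u x * (\sum_j partial j u x * partial j rho x)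
    - weight x * energy x * partial last rho x) =
  (fun x => \sum_j partial j (flux rho j) x
     - partial last (fun x => rho x * (weight x * energy x)) x).
  apply/funext => x; rewrite e1.2 (C1_mul W1 E1).2 PW PE drift_last.
  have -> : \sum_j partial j (flux rho j) x =
    weight x * partial last u x * (\sum_j partial j u x * partial j rho x)
    + rho x * weight x * partial last u x * (laplacian u x - \sum_j drift j x * partial j u x)
    + rho x * weight x * \sum_j partial j u x * partial last (partial j u) x.
    rewrite /laplacian -sumrB !mulr_sumr -!big_split /=; apply: eq_bigr => j _.
    rewrite (flux1 j).2 (C1_mul W1 (C1_mul (P1 last) (P1 j)).1).2.
    rewrite (C1_mul (P1 last) (P1 j)).2 PW (partial_comm last j u2).
    move: (partial j (partial last u) x) (partial j (partial j u) x) => b c.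
    move: (partial j u x) (partial last u x) (partial j rho x) => q v w; ring.
  rewrite (solution_equation u_solution) (addrC (\sum_j drift j x * _)) addrK.
  move: (\sum_j _) (\sum_j _) (partial last u x) (partial last rho x) => q v w z; ring.
rewrite rV_integral_sub//; last exact: Cc_sum.
by rewrite rV_integral_sum// Ze big1 ?subr0// => j _; exact: Zf.
Qed.

End StressEnergy.

(** * Weighted volume of boxes *)

Section WeightedVolume.
Variables (R : realType) (p : nat).
Local Notation n := p.+3.
Local Notation V := ('rV[R]_n).
Variables (a1 a2 : R -> R).
Hypotheses (a1_continuous : continuous a1) (a2_continuous : continuous a2).
Implicit Types (x y : V) (i j k : 'I_n) (s t T A d : R).
Local Notation last := (@ord_max p.+2).
Local Notation weight := (weight a1 a2).
Variables (chi dchi : R -> R -> R) (c : R).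
Hypothesis chiP : cutoffs chi dchi c.
Implicit Types r : R.

Definition prodlast (g h : R -> R) x : R :=
  \prod_k (if k == last then h else g) (x ord0 k).

Lemma prodlastE g h x :
  prodlast g h x = h (x ord0 last) * \prod_(k | k != last) g (x ord0 k).
Proof.
rewrite /prodlast (bigD1 last)//= eqxx; congr (_ * _).
by apply: eq_bigr => k /negPf->.
Qed.

Lemma Cc_prodlast g h A : 0 <= A -> continuous g -> continuous h ->
    (forall t, A < `|t| -> g t = 0) -> (forall t, A < `|t| -> h t = 0) ->
  Cc (prodlast g h).
Proof.
move=> A0 cg ch g0 h0; apply: (@Cc_prod R n (fun k => if k == last then h else g) last A A0);
  by move=> k; case: ifP.
Qed.

Lemma prodlast_C1 g dg h dh : (forall t : R, is_derive t 1 g (dg t)) ->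
    (forall t : R, is_derive t 1 h (dh t)) -> continuous dg -> continuous dh ->
  [/\ C1 (prodlast g h),
      partial last (prodlast g h) = prodlast g dh
    & forall j, j != last -> partial j (prodlast g h) = fun x =>
        dg (x ord0 j) * \prod_(k | k != j) (if k == last then h else g) (x ord0 k)].
Proof.
move=> d1 d2 c1 c2.
have [||C P] := @C1_prod R n (fun k => if k == last then h else g)
  (fun k => if k == last then dh else dg).
- by move=> k t; case: ifP.
- by move=> k; case: ifP.
split=> //.
  rewrite (P last); apply/funext => x; rewrite prodlastE eqxx; congr (_ * _).
  by apply: eq_bigr => k /negPf->.
by move=> j jl; rewrite (P j) (negPf jl).
Qed.

Lemma chi_continuous r : 0 < r -> continuous (chi r).
Proof. by move=> /chiP[d1 _ _ _ _]; exact: is_derive_continuous d1. Qed.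

Lemma chi_shift r s : 0 < r -> continuous (fun t => chi r (t - s)).
Proof.
move=> r0; apply: continuous_after (chi_continuous r0) _.
by move=> t; apply: cvgB; [exact: cvg_id|exact: cvg_cst].
Qed.

Lemma chi_le_double r t : 0 < r -> chi r t <= chi (2 * r) t.
Proof.
move=> r0; have r20 : 0 < 2 * r by rewrite mulr_gt0.
have [_ _ b01 _ [bz _]] := chiP r0; have [_ _ b01' b1 _] := chiP r20.
have [tr|tr] := lerP `|t| (2 * r).
  by rewrite (b1 _ tr).1; case/andP: (b01 t).
by rewrite (bz _ (ltW tr)).1; case/andP: (b01' t).
Qed.

Definition weight_mass1 r := integral_from0 (weight1 a1) r - integral_from0 (weight1 a1) (- r).
Definition weight_mass2 r := integral_from0 (weight2 a2) r - integral_from0 (weight2 a2) (- r).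
(** Up to a constant, the weighted volume of a box of half-side [4 r] in all variables
    but the last; each of the [p] variables without weight contributes a length [8 r]. *)
Definition volume r := weight_mass1 (4 * r) * weight_mass2 (4 * r) * (8 * r) ^+ p.

(** The number [p] of the remaining factors is read off the product of [p + 3] constant
    factors [b], from which [b^3] is cancelled. *)
Lemma prod_except_three (B : 'I_n -> R) (b1 b2 b3 b : R) : b != 0 ->
    B (idx1 p) = b1 -> B (idx2 p) = b2 -> B last = b3 ->
    (forall k, k != idx1 p -> k != idx2 p -> k != last -> B k = b) ->
  \prod_k B k = b1 * b2 * b ^+ p * b3.
Proof.
move=> b0 B1 B2 B3 Bk.
have split3 (F : 'I_n -> R) : \prod_k F k = F (idx1 p) * (F (idx2 p) * (F last *
    \prod_(k | [&& k != idx1 p, k != idx2 p & k != last]) F k)).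
  rewrite (bigD1 (idx1 p))//= (bigD1 (idx2 p))//= (bigD1 last)//=.
  by do 3 congr (_ * _); apply: eq_bigl => k; rewrite -!andbA.
have := split3 (fun=> b); rewrite prodr_const card_ord.
have -> : b ^+ n = b * (b * (b * b ^+ p)) by rewrite !exprS.
do 3 move/(mulfI b0); move=> E.
rewrite split3 B1 B2 B3.
rewrite (eq_bigr (fun=> b)) => [|k /and3P[? ? ?]]; last exact: Bk.
by rewrite -E; ring.
Qed.

(** The integrand is a product of functions of one variable, so each coordinate
    contributes its own integral. The last one is at most [4 r] wherever the box is
    centred in that direction. *)
Lemma weighted_box_volume r s : 0 < r ->
  let f x := weight x * prodlast (chi (2 * r)) (fun t => chi r (t - s)) x in
  Cc f /\ 0 <= rV_integral f <= volume r * (4 * r).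
Proof.
move=> r0 f; have r20 : 0 < 2 * r by rewrite mulr_gt0.
have [_ _ b01 _ [bz _]] := chiP r0; have [_ _ b01' _ [bz' _]] := chiP r20.
have [w1p _ cw1] := weight_calculus a1_continuous.
have [w2p _ cw2] := weight_calculus a2_continuous.
pose fw k (t : R) : R := if k == idx1 p then weight1 a1 t
  else if k == idx2 p then weight2 a2 t else 1.
pose g k t := fw k t * (if k == last then (fun t => chi r (t - s)) else chi (2 * r)) t.
have fE : f = fun x => \prod_k g k (x ord0 k).
  apply/funext => x; rewrite big_split /=; congr (_ * _).
  rewrite (@prod_except_three (fun k => fw k (x ord0 k)) (weight1 a1 (x ord0 (idx1 p)))
    (weight2 a2 (x ord0 (idx2 p))) 1 1) ?oner_neq0 ?expr1n ?mulr1//.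
  by move=> k k1 k2 _; rewrite /fw (negPf k1) (negPf k2).
have cfw k : continuous (fw k).
  rewrite /fw; case: (k == idx1 p); first exact: cw1.
  by case: (k == idx2 p); [exact: cw2|exact: continuous_const].
have cg k : continuous (g k).
  apply: continuous_mul => //; case: (k == last); first exact: chi_shift.
  exact: chi_continuous.
pose A := 6 * r + `|s|.
have sA : - `|s| <= s <= `|s| by rewrite -ler_norml.
have gz k t : A <= `|t| -> g k t = 0.
  rewrite {1}/A => At; have ts := lerB_dist t s; have s0 := normr_ge0 s.
  rewrite /g; case: (k == last).
    by rewrite (bz _ _).1 ?mulr0//; lra.
  by rewrite (bz' _ _).1 ?mulr0//; lra.
have s0 := normr_ge0 s.
have A0 : 0 <= A by rewrite /A; lra.
have dG k t := is_derive_integral_from0 t (cg k).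
split.
  rewrite fE; apply: (@Cc_prod R n g last A A0 cg) => k t At; exact: gz (ltW At).
rewrite fE (rV_integral_prod A0 dG cg gz).
have fw0 k t : 0 <= fw k t.
  rewrite /fw; case: ifP => _; first by rewrite ltW// w1p.
  by case: ifP => _ //; rewrite ltW// w2p.
have gf k t : 0 <= g k t <= fw k t.
  rewrite /g; have [x01 x1] : 0 <= (if k == last then (fun t => chi r (t - s)) else chi (2 * r)) t
    /\ (if k == last then (fun t => chi r (t - s)) else chi (2 * r)) t <= 1.
    by case: (k == last); apply/andP; [exact: b01|exact: b01'].
  by rewrite mulr_ge0//= ler_piMr.
pose B k := if k == idx1 p then weight_mass1 (4 * r) else
  if k == idx2 p then weight_mass2 (4 * r) else if k == last then 4 * r else 8 * r.
have inc k : 0 <= integral_from0 (g k) A - integral_from0 (g k) (- A) <= B k.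
  have sym (F : R -> R) : (forall t : R, is_derive t 1 F (fw k t)) -> k != last ->
    0 <= integral_from0 (g k) A - integral_from0 (g k) (- A) <= F (4 * r) - F (- (4 * r)).
    move=> dF kl; apply: (antiderivative_increment (dG k) dF); rewrite /A; try lra.
      move=> t tr; rewrite /g (negPf kl) (bz' _ _).1 ?mulr0// ler_normr.
      by case: tr => tr; apply/orP; [right|left]; lra.
    exact: gf.
  rewrite /B; have [k1|k1] := eqVneq k (idx1 p).
    have D1 t : is_derive t 1 (integral_from0 (weight1 a1)) (fw k t).
      have -> : fw k t = weight1 a1 t by rewrite /fw k1 eqxx.
      exact: is_derive_integral_from0 cw1.
    have kl : k != last by rewrite k1.
    exact: sym D1 kl.
  have [k2|k2] := eqVneq k (idx2 p).
    have D2 t : is_derive t 1 (integral_from0 (weight2 a2)) (fw k t).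
      have -> : fw k t = weight2 a2 t by rewrite /fw (negPf k1) k2 eqxx.
      exact: is_derive_integral_from0 cw2.
    have kl : k != last by rewrite k2.
    exact: sym D2 kl.
  have did t : is_derive t 1 id (fw k t).
    by rewrite /fw (negPf k1) (negPf k2); exact: is_derive_id.
  have [kl|kl] := eqVneq k last; last first.
    by have := sym id did kl; rewrite /= opprK -mulrDl; congr (_ <= _ <= _ * _); lra.
  have := @antiderivative_increment _ _ _ _ _ (s - 2 * r) (s + 2 * r) A (dG k) did.
  have -> : id (s + 2 * r) - id (s - 2 * r) = 4 * r by rewrite /=; ring.
  apply; rewrite /A; try lra.
    move=> t tr; rewrite /g kl eqxx (bz _ _).1 ?mulr0// ler_normr.
    by case: tr => tr; apply/orP; [right|left]; lra.
  exact: gf.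
apply/andP; split; first by apply: prodr_ge0 => k _; case/andP: (inc k).
have r80 : 8 * r != 0 by rewrite gt_eqF// mulr_gt0.
rewrite /volume -(@prod_except_three B _ _ (4 * r) _ r80)//; last first.
- by move=> k k1 k2 k3; rewrite /B (negPf k1) (negPf k2) (negPf k3).
- by rewrite /B eqxx.
- by apply: ler_prod => k _; exact: inc.
Qed.

End WeightedVolume.

(** * The energy estimate *)

Section EnergyEstimate.
Variables (R : realType) (p : nat).
Local Notation n := p.+3.
Local Notation V := ('rV[R]_n).
Variables (a1 a2 : R -> R) (u : V -> R) (L : R).
Hypotheses (L0 : 0 <= L) (a1L : forall t, `|a1 t| <= L) (a2L : forall t, `|a2 t| <= L).
Hypotheses (u_solution : classical_solution a1 a2 u) (u_monotone : monotone_last u)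
  (u_convergent : asymptotically_convergent u).
Hypotheses (a1_continuous : continuous a1) (a2_continuous : continuous a2).
Implicit Types (x y : V) (i j k : 'I_n) (s t T A d : R).
Local Notation last := (@ord_max p.+2).
Local Notation weight := (weight a1 a2).
Local Notation energy := (energy u).
Variables (chi dchi : R -> R -> R) (c : R).
Hypotheses (c0 : 0 <= c) (chiP : cutoffs chi dchi c).
Local Notation volume := (volume p a1 a2).
Implicit Types r : R.

(** One-variable functions for the last coordinate: [th] is a primitive of the
    difference of two bumps at distance [T], and [ka] is a plateau, equal to 1 where
    [th] does not vanish, with slopes of length [r] so that the derivative of [ka] has
    an integral bounded independently of [T]. *)
Lemma last_variable_functions r T : 0 < r -> 0 <= T ->
  exists (th ka dka : R -> R),
  [/\ forall t : R, is_derive t 1 th (chi r t - chi r (t - T)),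
      forall t, 0 <= th t <= 4 * r,
      forall t, t <= - (2 * r) \/ T + 2 * r <= t ->
        th t = 0 /\ chi r t - chi r (t - T) = 0,
      [/\ forall t : R, is_derive t 1 ka (dka t), continuous dka,
      forall t, 0 <= ka t,
      forall t, - (2 * r) <= t <= T + 2 * r -> ka t = 1 &
      forall t, T + 6 * r <= `|t| -> ka t = 0]
    & forall t, `|dka t| <= (chi r (t - - (4 * r)) + chi r (t - (T + 4 * r))) / (2 * r)].
Proof.
move=> r0 T0; have [d1 _ b01 b1 [bz _]] := chiP r0.
have bz1 t : 2 * r <= `|t| -> chi r t = 0 by move=> /bz[].
pose X := integral_from0 (chi r).
have dX (t : R) : is_derive t 1 X (chi r t).
  by apply: is_derive_integral_from0; exact: (chi_continuous chiP r0).
have Xmono s t : s <= t -> X s <= X t.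
  move=> st; have [h _ E] := mvt s (t - s) dX.
  rewrite -subr_ge0; move: E; rewrite subrKC => ->.
  by rewrite mulr_ge0 ?subr_ge0//; case/andP: (b01 (s + h * (t - s))).
have Xhi t : 2 * r <= t -> X t = X (2 * r).
  move=> rt; have [h h01] := mvt (2 * r) (t - 2 * r) dX.
  rewrite subrKC bz1; first by rewrite mulr0 => /subr0_eq.
  by rewrite ler_normr; apply/orP; left; nra.
have Xlo t : t <= - (2 * r) -> X t = X (- (2 * r)).
  move=> rt; have [h h01] := mvt t (- (2 * r) - t) dX.
  rewrite subrKC bz1; first by rewrite mulr0 => /subr0_eq.
  by rewrite ler_normr; apply/orP; right; nra.
have Xb t : X (- (2 * r)) <= X t <= X (2 * r).
  apply/andP; split.
    by have [/ltW/Xlo->//|/Xmono] := ltP t (- (2 * r)).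
  by have [/ltW/Xmono//|/Xhi->] := ltP t (2 * r).
pose m := X (2 * r) - X (- (2 * r)).
have m_le : m <= 4 * r.
  have [h h01] := mvt (- (2 * r)) (4 * r) dX.
  have -> : - (2 * r) + 4 * r = 2 * r by ring.
  rewrite /m => ->; rewrite ler_piMr ?mulr_ge0 ?(ltW r0)//.
  by case/andP: (b01 (- (2 * r) + h * (4 * r))).
have m_ge : 2 * r <= m.
  have [h h01] := mvt (- r) (2 * r) dX.
  have -> : - r + 2 * r = r by ring.
  rewrite (b1 _ _).1 ?mulr1; last by rewrite ler_norml; nra.
  have := Xmono (- (2 * r)) (- r); have := Xmono r (2 * r); rewrite /m; lra.
have m0 : 0 < m by lra.
have dS (s t : R) : is_derive t 1 (fun t : R => X (t - s)) (chi r (t - s)).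
  have D : is_derive t 1 (fun t : R => t - s) 1.
    by have := is_derive_sub (is_derive_id t 1) (is_derive_const s t 1); rewrite subr0.
  by have := @is_derive_comp R R X (fun t => t - s) t 1 _ _ (dX (t - s)) D; rewrite mulr1.
exists (fun t => X t - X (t - T)).
exists (fun t => m^-1 * (X (t - - (4 * r)) - X (t - (T + 4 * r)))).
exists (fun t => m^-1 * (chi r (t - - (4 * r)) - chi r (t - (T + 4 * r)))).
split.
- by move=> t; exact: is_derive_sub.
- move=> t; have := Xb t; have := Xb (t - T); have := Xmono (t - T) t.
  by move: m_le; rewrite /m; move: (X _) (X _) (X _) (X _) => *; lra.
- move=> t [tr|tr].
    rewrite Xlo// (Xlo (t - T)); last by lra.
    rewrite !bz1 ?subrr//; rewrite ler_normr; apply/orP; right; lra.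
  rewrite Xhi ?(Xhi (t - T)); [|lra|lra].
  rewrite !bz1 ?subrr//; rewrite ler_normr; apply/orP; left; lra.
- split.
  + by move=> t; apply: is_derive_scale; apply: is_derive_sub.
  + apply: continuous_mul; first exact: continuous_const.
    apply: continuous_add; first exact: (chi_shift chiP r0).
    by apply: continuous_opp; exact: (chi_shift chiP r0).
  + move=> t; rewrite mulr_ge0 ?invr_ge0 ?(ltW m0)// subr_ge0; apply: Xmono; lra.
  + move=> t tr; rewrite (Xhi (t - - (4 * r))) ?(Xlo (t - (T + 4 * r))); [|lra|lra].
    by rewrite mulVf// gt_eqF.
  + move=> t; rewrite ler_normr => /orP[tr|tr].
      by rewrite Xhi ?(Xhi (t - _)) ?subrr ?mulr0//; lra.
    by rewrite Xlo ?(Xlo (t - (T + 4 * r))) ?subrr ?mulr0//; lra.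
- move=> t; rewrite normrM normfV (gtr0_norm m0) mulrC.
  have := b01 (t - - (4 * r)); have := b01 (t - (T + 4 * r)).
  move: (chi r _) (chi r _) => q v q01 v01.
  have r20 : 0 < 2 * r by rewrite mulr_gt0.
  apply: ler_pM; rewrite ?normr_ge0 ?invr_ge0 ?(ltW m0)//.
    by rewrite ler_norml; lra.
  by rewrite lef_pV2.
Qed.

(** Every term of the energy is quadratic in quantities of order [d], and [d <= 1]. *)
Lemma energy_small x (C d : R) : 0 < d <= 1 -> 0 <= C -> -1 <= u x <= 1 ->
    1 - u x <= d -> (forall i, `|partial i u x| <= C * d) ->
  energy x <= (n%:R * C ^+ 2 + 1) * d.
Proof.
move=> /andP[d0 d1] C0 u1 ud dux.
have sq j : partial j u x ^+ 2 <= C ^+ 2 * d.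
  rewrite -real_normK ?num_real//; have := dux j; have := normr_ge0 (partial j u x).
  move: (`|_|) => q q0 qC.
  have h1 : q ^+ 2 <= (C * d) ^+ 2.
    by rewrite ler_pXn2r ?nnegrE ?(le_trans q0 qC).
  have h2 : (C * d) ^+ 2 <= C ^+ 2 * d by rewrite exprMn ler_wpM2l ?sqr_ge0//; nra.
  lra.
have s1 : \sum_j partial j u x ^+ 2 <= n%:R * (C ^+ 2 * d).
  apply: (le_trans (ler_sum _ (fun j _ => sq j))).
  by rewrite sumr_const card_ord -[_ *+ n]mulr_natl.
have s0 : 0 <= n%:R * (C ^+ 2 * d).
  exact: mulr_ge0 (ler0n _ _) (mulr_ge0 (sqr_ge0 _) (ltW d0)).
have s2 : (1 - u x ^+ 2) ^+ 2 <= 4 * d.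
  have -> : (1 - u x ^+ 2) ^+ 2 = (1 - u x) ^+ 2 * (1 + u x) ^+ 2 by ring.
  have h1 : (1 - u x) ^+ 2 <= d by nra.
  have h2 : (1 + u x) ^+ 2 <= 4 by nra.
  by rewrite [leRHS]mulrC; apply: ler_pM => //; exact: sqr_ge0.
rewrite /energy mulrDl mul1r -[n%:R * _ * d]mulrA; move: s1 s0 s2.
move: (\sum_j _) (_ * (C ^+ 2 * d)) => q v.
by lra.
Qed.

(** A derivative in one of the first directions costs [c / r], but the factor [th] is at
    most [4 r]; the derivative of [th] in the last direction is a difference of bumps.
    Hence no power of [r] appears. *)
Lemma cutoff_gradient r T (th ka : R -> R) j x : 0 < r -> 0 <= T ->
    (forall t : R, is_derive t 1 th (chi r t - chi r (t - T))) ->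
    (forall t, 0 <= th t <= 4 * r) ->
    (forall t, t <= - (2 * r) \/ T + 2 * r <= t ->
       th t = 0 /\ chi r t - chi r (t - T) = 0) ->
    (forall t, 0 <= ka t) -> (forall t, - (2 * r) <= t <= T + 2 * r -> ka t = 1) ->
  `|partial j (prodlast (chi r) th) x| <= (4 * c + 1) * prodlast (chi (2 * r)) ka x.
Proof.
move=> r0 T0 thP thb thz ka0 ka1; have r20 : 0 < 2 * r by rewrite mulr_gt0.
have [d1 cd b01 _ [bz bc]] := chiP r0.
have [_ _ b01' b1' _] := chiP r20.
pose dth t := chi r t - chi r (t - T).
have cdth : continuous dth.
  apply: continuous_add; first exact: (chi_continuous chiP r0).
  by apply: continuous_opp; exact: (chi_shift chiP r0).
pose g k := if k == last then th else chi r.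
pose dg k := if k == last then dth else dchi r.
have [||_ P] := @C1_prod R n g dg.
- by move=> k t; rewrite /g /dg; case: (k == last).
- by move=> k; rewrite /dg; case: (k == last).
have -> : partial j (prodlast (chi r) th) x =
    dg j (x ord0 j) * \prod_(k | k != j) g k (x ord0 k) by rewrite /prodlast P.
have Psi0 : 0 <= prodlast (chi (2 * r)) ka x.
  apply: prodr_ge0 => k _; case: (k == last); first exact: ka0.
  by case/andP: (b01' (x ord0 k)).
have c41 : 0 <= 4 * c + 1 by rewrite addr_ge0 ?mulr_ge0.
case: (pselect (exists2 k, g k (x ord0 k) = 0 & dg k (x ord0 k) = 0)) => [[k gk dgk]|good].
  have [<-|kj] := eqVneq k j; first by rewrite dgk mul0r normr0 mulr_ge0.
  by rewrite (bigD1 k)//= gk mul0r mulr0 normr0 mulr_ge0.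
have xk k : k != last -> `|x ord0 k| <= 2 * r.
  move=> kl; rewrite leNgt; apply/negP => xk; apply: good; exists k;
  by rewrite /g /dg (negPf kl); have [? ?] := bz _ (ltW xk).
have xl : - (2 * r) <= x ord0 last <= T + 2 * r.
  apply/andP; split; rewrite leNgt; apply/negP => xl; apply: good; exists last;
  rewrite /g /dg eqxx.
  - by apply: (thz _ _).1; left; exact: ltW.
  - by apply: (thz _ _).2; left; exact: ltW.
  - by apply: (thz _ _).1; right; exact: ltW.
  - by apply: (thz _ _).2; right; exact: ltW.
have -> : prodlast (chi (2 * r)) ka x = 1.
  rewrite prodlastE ka1// mul1r big1// => k kl.
  by rewrite (b1' _ _).1//; exact: xk.
rewrite mulr1 normrM normr_prod.
have prod_le : \prod_(k | k != j) `|g k (x ord0 k)| <=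
    \prod_(k | k != j) (if k == last then 4 * r else 1).
  apply: ler_prod => k _; rewrite normr_ge0 /g /=; case: (k == last).
    by have /andP[h0 h1] := thb (x ord0 k); rewrite ger0_norm.
  by have /andP[h0 h1] := b01 (x ord0 k); rewrite ger0_norm.
have [jl|jl] := eqVneq j last.
  rewrite jl in prod_le *; apply: le_trans (_ : 1 <= _); last by rewrite lerDr mulr_ge0.
  apply: mulr_ile1 => //; first exact: prodr_ge0.
    have /andP[? ?] := b01 (x ord0 last); have /andP[? ?] := b01 (x ord0 last - T).
    by rewrite /dg eqxx /dth ler_norml; apply/andP; split; lra.
  by apply: (le_trans prod_le); rewrite big1// => k /negPf->.
apply: le_trans (_ : c / r * (4 * r) <= _); last first.
  have -> : c / r * (4 * r) = 4 * c by field; rewrite gt_eqF.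
  by rewrite lerDl.
apply: ler_pM => //; first exact: prodr_ge0.
  by rewrite /dg (negPf jl).
apply: (le_trans prod_le); rewrite (bigD1 last) 1?eq_sym//= eqxx big1 ?mulr1//.
by move=> k /andP[_ /negPf->].
Qed.

(** Integrating by parts in the last direction transfers the derivative from [u], which
    is bounded, to the plateau [ka]; hence a bound independent of the length [T]. *)
Lemma plateau_flux r T (ka dka : R -> R) : 0 < r -> 0 <= T ->
    (forall t : R, is_derive t 1 ka (dka t)) -> continuous dka ->
    (forall t, T + 6 * r <= `|t| -> ka t = 0) ->
    (forall t, `|dka t| <=
       (chi r (t - - (4 * r)) + chi r (t - (T + 4 * r))) / (2 * r)) ->
  rV_integral (fun x => weight x * partial last u x * prodlast (chi (2 * r)) ka x)
    <= 4 * volume r.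
Proof.
move=> r0 T0 dkap cdka kaz dkab; have r20 : 0 < 2 * r by rewrite mulr_gt0.
have [d1 cd b01 _ [bz _]] := chiP r20.
have u2 := solution_C2 u_solution; have u1 := C2_C1 u2.
have [W1 PW] := weight_C1 p a1_continuous a2_continuous.
pose Psi : V -> R := prodlast (chi (2 * r)) ka.
have [psi1 psil _] := prodlast_C1 p d1 dkap cd cdka.
have cka := is_derive_continuous dkap; have cchi := chi_continuous chiP r20.
have TA0 : 0 <= T + 6 * r by lra.
have psiC : Cc Psi.
  apply: (@Cc_prodlast R p _ _ _ TA0) => // t Tt; last exact: kaz (ltW Tt).
  by apply: (bz _ _).1; lra.
have cu := C1_continuous u1; have cW := C1_continuous W1.
have cun : continuous (partial last u) by exact: C1_partial_continuous.
have [uW1 uWP] := C1_mul u1 W1; have [f1 fP] := C1_mul uW1 psi1.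
have cuW : continuous (fun x => u x * weight x) by exact: continuous_mul.
have fC : Cc (fun x => u x * weight x * Psi x) by exact: Cc_mull.
have dpsiC : Cc (partial last Psi).
  by apply: Cc_partial => //; exact: C1_partial_continuous psi1.
have Z : rV_integral (partial last (fun x => u x * weight x * Psi x)) = 0.
  by apply: rV_integral_partial => //; have [_ /(_ last)[]] := f1.
have E : partial last (fun x => u x * weight x * Psi x) = fun x =>
    weight x * partial last u x * Psi x - - (u x * weight x * partial last Psi x).
  apply/funext => x; rewrite fP uWP PW drift_last /Psi; ring.
have C1' : Cc (fun x => weight x * partial last u x * Psi x).
  by apply: Cc_mull => //; exact: continuous_mul.
have C2' : Cc (fun x => - (u x * weight x * partial last Psi x)).
  by apply: Cc_opp; exact: Cc_mull.
move: Z; rewrite E rV_integral_sub// => /subr0_eq ->.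
have [f1C /andP[_ f1v]] :=
  weighted_box_volume p a1_continuous a2_continuous chiP (- (4 * r)) r0.
have [f2C /andP[_ f2v]] :=
  weighted_box_volume p a1_continuous a2_continuous chiP (T + 4 * r) r0.
have C3 := Cc_scale (2 * r)^-1 (Cc_add f1C f2C).
apply: le_trans (le_rV_integral C2' C3 _) _ => [x|].
  have Wx := weight_gt0 a1 a2 x.
  have := solution_bound u_solution u_monotone u_convergent x => ux.
  have P0 : 0 <= \prod_(k < n | k != last) chi (2 * r) (x ord0 k).
    by apply: prodr_ge0 => k _; case/andP: (b01 (x ord0 k)).
  apply: (le_trans (ler_norm _)); rewrite normrN /Psi psil !prodlastE.
  rewrite normrM [`|u x * _|]normrM [`|dka _ * _|]normrM.
  rewrite (gtr0_norm Wx) (ger0_norm P0).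
  move: P0 (dkab (x ord0 last)); move: (\prod_(k < n | _) _) => P P0.
  move: (`|dka _|) (normr_ge0 (dka (x ord0 last))) => q q0.
  move: (chi r _) (chi r _) => v w qvw.
  apply: (@le_trans _ _ (weight x * (q * P))).
    rewrite ler_wpM2r ?mulr_ge0// ler_piMl ?(ltW Wx)// ler_norml; lra.
  have E' : weight x * ((v + w) / (2 * r) * P) =
    (2 * r)^-1 * (weight x * (w * P) + weight x * (v * P)) by ring.
  apply: le_trans (_ : weight x * ((v + w) / (2 * r) * P) <= _); last first.
    by rewrite E'; exact: lexx.
  by rewrite ler_pM2l// ler_wpM2r// [v + w]addrC.
rewrite rV_integral_scale ?rV_integral_add//; last exact: Cc_add.
rewrite ler_pdivrMl//; lra.
Qed.

(** The energy on a box of side [r] is bounded by the weighted volume of its [n - 1]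
    dimensional section, not of the box itself. Let the box move upwards by [T]. By the
    stress-energy identity, applied to the cutoff whose last factor is the primitive
    [th], the energies of the two boxes differ by a flux, at most a constant times the
    integral of [weight * d_n u] over a long tube. As [d_n u > 0] and [u] is bounded,
    this integral is of the order of the volume of the section whatever [T] is. As [T]
    grows, the energy of the upper box tends to 0, because [u] tends to 1 and its
    gradient to 0 locally uniformly. *)
Lemma energy_estimate : exists2 K : R, 0 <= K & forall r, 0 < r ->
  rV_integral (fun x => weight x * energy x * prodlast (chi r) (chi r) x) <= K * volume r.
Proof.
have u2 := solution_C2 u_solution.
have [G G0 uG] := solution_gradient_bounded L0 a1L a2L u_solution u_monotone u_convergent.
have [C C0 decay] := solution_decay L0 a1L a2L u_solution u_monotone u_convergent.
pose nR : R := n%:R; have nR0 : 0 <= nR by exact: ler0n.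
have c41 : 0 <= 4 * c + 1 by rewrite addr_ge0 ?mulr_ge0.
pose K1 := nR * G * (4 * c + 1); have K10 : 0 <= K1.
  exact: mulr_ge0 (mulr_ge0 nR0 (ltW G0)) c41.
exists (4 * K1) => [|r r0]; first by rewrite mulr_ge0.
have r20 : 0 < 2 * r by rewrite mulr_gt0.
have [d1 cd b01 b1 [bz bc]] := chiP r0.
have [d1' cd' b01' b1' [bz' bc']] := chiP r20.
have cchi := chi_continuous chiP r0; have cchi2 := chi_continuous chiP r20.
have [W1 PW] := weight_C1 p a1_continuous a2_continuous.
have [E1 PE] := energy_C1 u_solution.
have [cW cE] := conj (C1_continuous W1) (C1_continuous E1).
have cu := C1_continuous (C2_C1 u2).
have cp j := C1_continuous (C2_partial_C1 j u2).
have vol0 : 0 <= volume r.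
  have [_ /andP[h0 h1]] := weighted_box_volume p a1_continuous a2_continuous chiP 0 r0.
  have := le_trans h0 h1; rewrite pmulr_lge0//; lra.
(* The energy of the box moved by [T] in the last direction is at most [e] once [T] is so
   large that [u] is within [d] of 1 there; it is then discarded. *)
apply/ler_addgt0Pl; move=> e; move: (e : R) => {}e e0.
pose K2 := nR * C ^+ 2 + 1; have K20 : 0 < K2 by rewrite ltr_wpDl// mulr_ge0// sqr_ge0.
pose d := Num.min 1 (e / (K2 * (volume r * (4 * r) + 1))).
have D0 : 0 < K2 * (volume r * (4 * r) + 1).
  by rewrite mulr_gt0// ltr_wpDl// mulr_ge0//; lra.
have d01 : 0 < d <= 1.
  by rewrite /d lt_min ltr01 divr_gt0//= ge_min lexx.
have [T0 far] := decay (2 * r) d d01.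
pose T : R := Num.max 0 (T0 + 2 * r).
have T0' : 0 <= T by rewrite /T le_max lexx.
have [th [ka [dka [dth thb thz [dkap cdka ka0 ka1 kaz] dkab]]]] :=
  last_variable_functions r0 T0'.
have cdth : continuous (fun t => chi r t - chi r (t - T)).
  apply: continuous_add => //; apply: continuous_opp; exact: (chi_shift chiP r0).
pose rho : V -> R := prodlast (chi r) th; pose Psi : V -> R := prodlast (chi (2 * r)) ka.
have [rho1 rlast rj] := prodlast_C1 p d1 dth cd cdth.
have [psi1 psil _] := prodlast_C1 p d1' dkap cd' cdka.
have chiz A t : 2 * r <= A -> A < `|t| -> chi r t = 0.
  by move=> rA At; apply: (bz _ _).1; lra.
have chiz2 A t : 4 * r <= A -> A < `|t| -> chi (2 * r) t = 0.
  by move=> rA At; apply: (bz' _ _).1; lra.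
have chiT A t : 2 * r <= A -> T + A < `|t| -> chi r (t - T) = 0.
  move=> rA At; apply: (bz _ _).1; have := lerB_dist t T; rewrite (ger0_norm T0'); lra.
have TA0 : 0 <= T + 6 * r by lra.
have rhoC : Cc rho.
  apply: (@Cc_prodlast R p _ _ _ TA0) => //; try exact: is_derive_continuous dth.
  - by move=> t; apply: chiz; lra.
  - move=> t; rewrite ltr_normr => tA.
    by apply: (thz _ _).1; case/orP: tA => tA; [right|left]; lra.
have psiC : Cc Psi.
  apply: (@Cc_prodlast R p _ _ _ TA0) => //; try exact: is_derive_continuous dkap.
  - by move=> t; apply: chiz2; lra.
  - by move=> t /ltW; exact: kaz.
pose eta : V -> R := prodlast (chi r) (chi r).
pose fb : V -> R := prodlast (chi r) (fun t => chi r (t - T)).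
have etaC : Cc eta.
  by apply: (@Cc_prodlast R p _ _ _ (ltW r20)) => // t; exact: chiz.
have fbC : Cc fb.
  apply: (@Cc_prodlast R p _ _ _ TA0) => //; first exact: (chi_shift chiP r0).
  - by move=> t; apply: chiz; lra.
  - by move=> t; apply: chiT; lra.
have cWE : continuous (fun x => weight x * energy x) by exact: continuous_mul.
have cWu : continuous (fun x => weight x * partial last u x) by exact: continuous_mul.
have se := stress_energy u_solution a1_continuous a2_continuous rho1 rhoC.
have LHS : rV_integral (fun x => weight x * energy x * partial last rho x) =
    rV_integral (fun x => weight x * energy x * eta x) -
    rV_integral (fun x => weight x * energy x * fb x).
  rewrite -rV_integral_sub; [|exact: Cc_mull|exact: Cc_mull].
  congr rV_integral; apply/funext => x; rewrite rlast -mulrBr; congr (_ * _).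
  by rewrite /eta /fb !prodlastE mulrBl.
have chi0 k (h : R -> R) (g : R -> R) x : (forall t, 0 <= g t) -> (forall t, 0 <= h t) ->
    0 <= (if k == last then h else g) (x ord0 k).
  by move=> g0 h0; case: ifP.
have chip t : 0 <= chi r t by case/andP: (b01 t).
have chip2 t : 0 <= chi (2 * r) t by case/andP: (b01' t).
have pl0 g h x : (forall t, 0 <= g t) -> (forall t, 0 <= h t) -> 0 <= prodlast g h x.
  by move=> g0 h0; apply: prodr_ge0 => k _; exact: chi0.
have Psi0 x : 0 <= Psi x by exact: pl0.
pose fb2 : V -> R := prodlast (chi (2 * r)) (fun t => chi r (t - T)).
have [fb2C /andP[_ fb2v]] := weighted_box_volume p a1_continuous a2_continuous chiP T r0.
have fb_small x : weight x * energy x * fb x <= K2 * d * (weight x * fb2 x).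
  have fb20 : 0 <= fb2 x by exact: pl0.
  have Kd0 : 0 <= K2 * d by rewrite mulr_ge0// ltW//; case/andP: d01.
  have Wx := weight_gt0 a1 a2 x.
  have R0 : 0 <= K2 * d * (weight x * fb2 x) by exact: mulr_ge0 Kd0 (mulr_ge0 (ltW Wx) fb20).
  case: (pselect (exists2 k, k != last & 2 * r < `|x ord0 k|)) => [[k kl xk]|nk].
    rewrite /fb /prodlast (bigD1 k)//= (negPf kl) (chiz _ _ (lexx _) xk).
    by rewrite mul0r mulr0.
  have [xT|xT] := ltP (2 * r) `|x ord0 last - T|.
    by rewrite /fb prodlastE (chiz _ _ (lexx _) xT) mul0r mulr0.
  have xk k : k != last -> `|x ord0 k| <= 2 * r.
    by move=> kl; rewrite leNgt; apply/negP => xk; apply: nk; exists k.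
  have TT : T0 + 2 * r <= T by rewrite /T le_max lexx orbT.
  have [|ux dux] := far x xk; first by move: xT; rewrite ler_norml; lra.
  have eK : energy x <= K2 * d.
    apply: energy_small => //; first exact: ltW.
    exact: (solution_bound u_solution u_monotone u_convergent x).
  have ff : fb x <= fb2 x.
    apply: ler_prod => k _; apply/andP; split; first exact: chi0.
    by case: ifP => // _; exact: (chi_le_double chiP _ r0).
  rewrite [leRHS]mulrCA -[leLHS]mulrA ler_pM2l//.
  by apply: ler_pM => //; [exact: energy_ge0|exact: pl0].
have far_le : rV_integral (fun x => weight x * energy x * fb x) <= e.
  have Cfb : Cc (fun x => weight x * energy x * fb x) by exact: Cc_mull.
  have := le_rV_integral Cfb (Cc_scale (K2 * d) fb2C) fb_small.
  rewrite rV_integral_scale// => /le_trans; apply.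
  have dE : d <= e / (K2 * (volume r * (4 * r) + 1)) by rewrite /d ge_min lexx orbT.
  have /andP[dp _] := d01.
  rewrite ler_pdivlMr// in dE.
  have : K2 * d * rV_integral (fun x => weight x * fb2 x) <= K2 * d * (volume r * (4 * r)).
    by rewrite ler_pM2l// mulr_gt0.
  by have := mulr_gt0 K20 dp; lra.
have drho j x : `|partial j rho x| <= (4 * c + 1) * Psi x.
  exact: cutoff_gradient.
have cross x : weight x * partial last u x * \sum_j partial j u x * partial j rho x <=
    K1 * (weight x * partial last u x * Psi x).
  have Wx := weight_gt0 a1 a2 x; have ux := u_monotone x.
  have Wu : 0 < weight x * partial last u x by exact: mulr_gt0.
  rewrite [leRHS]mulrCA ler_pM2l//.
  apply: le_trans (_ : \sum_(j < n) G * ((4 * c + 1) * Psi x) <= _); last first.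
    by rewrite sumr_const card_ord -[_ *+ n]mulr_natl /K1 !mulrA.
  apply: ler_sum => j _; apply: (le_trans (ler_norm _)); rewrite normrM.
  by apply: ler_pM => //; exact: drho.
have psi_le : rV_integral (fun x => weight x * partial last u x * Psi x) <= 4 * volume r.
  exact: plateau_flux dkap cdka kaz dkab.
have CL : Cc (fun x => weight x * partial last u x * \sum_j partial j u x * partial j rho x).
  apply: Cc_mull => //; apply: Cc_sum => j; apply: Cc_mull => //.
  by apply: Cc_partial => //; exact: C1_partial_continuous rho1.
have CR : Cc (fun x => weight x * partial last u x * Psi x) by exact: Cc_mull.
have := le_rV_integral CL (Cc_scale K1 CR) cross.
rewrite rV_integral_scale// -se LHS.
have := ler_wpM2l K10 psi_le; lra.
Qed.

End EnergyEstimate.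

(** * The linearized equation *)

Section Translation.
Variables (R : realType) (n : nat).
Local Notation V := ('rV[R]_n).
Implicit Types (x y w : V) (i j k : 'I_n).

Lemma continuous_translate (f : V -> R) (w : V) : continuous f ->
  continuous (fun x => f (x + w)).
Proof.
move=> cf; apply: continuous_of_eps => x e e0.
have [d d0 dP] := continuous_eps (x + w) cf e0.
by exists d => // y yx; apply: dP => k; rewrite !mxE opprD addrACA subrr addr0.
Qed.

Lemma partial_translate (f : V -> R) i (w : V) : has_partial i f ->
  has_partial i (fun x => f (x + w)) /\
  partial i (fun x => f (x + w)) = fun x => partial i f (x + w).
Proof.
move=> df; have D x := is_derive_translate x w df.
split=> [x|]; first exact: is_derive_ex (D x).
by apply/funext => x; exact: is_derive_unique.
Qed.

End Translation.

Section TranslatedSolution.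
Variables (R : realType) (p : nat).
Local Notation n := p.+3.
Local Notation V := ('rV[R]_n).
Variables (a1 a2 : R -> R) (u : V -> R).
Hypothesis u_solution : classical_solution a1 a2 u.
Implicit Types (x : V) (i j k : 'I_n) (h : R).

Lemma classical_solution_translate i h : i != idx1 p -> i != idx2 p ->
  classical_solution a1 a2 (fun x => u (x + h *: basis i)).
Proof.
move=> i1 i2; have [[cu u1 u2] eq] := u_solution.
have P1 j := partial_translate (h *: basis i) (u1 j).1.
have P2 j k := partial_translate (h *: basis i) (u2 j k).1.
split; first split.
- exact: continuous_translate.
- move=> j; split; first exact: (P1 j).1.
  by rewrite (P1 j).2; apply: continuous_translate; exact: (u1 j).2.
- move=> j k; rewrite (P1 j).2; split; first exact: (P2 j k).1.
  by rewrite (P2 j k).2; apply: continuous_translate; exact: (u2 j k).2.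
- move=> x; rewrite (P1 (idx1 p)).2 (P1 (idx2 p)).2.
  have -> : laplacian (fun x => u (x + h *: basis i)) x = laplacian u (x + h *: basis i).
    by rewrite /laplacian; apply: eq_bigr => j _; rewrite (P1 j).2 (P2 j j).2.
  have := eq (x + h *: basis i).
  have -> : (x + h *: basis i) ord0 (idx1 p) = x ord0 (idx1 p).
    by rewrite coord_shift eq_sym (negPf i1) mulr0 addr0.
  have -> : (x + h *: basis i) ord0 (idx2 p) = x ord0 (idx2 p).
    by rewrite coord_shift eq_sym (negPf i2) mulr0 addr0.
  by [].
Qed.

End TranslatedSolution.

Section WeakEquation.
Variables (R : realType) (p : nat) (a1 a2 : R -> R) (v : 'rV[R]_p.+3 -> R).
Hypotheses (a1_continuous : continuous a1) (a2_continuous : continuous a2).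
Hypothesis v_solution : classical_solution a1 a2 v.
Local Notation weight := (weight a1 a2).

Lemma weak_equation (ze : 'rV[R]_p.+3 -> R) : C1 ze -> Cc ze ->
  \sum_j rV_integral (fun x => partial j v x * (weight x * partial j ze x)) =
  rV_integral (fun x => (v x - v x ^+ 3) * (weight x * ze x)).
Proof.
move=> z1 zc; have v2 := solution_C2 v_solution.
have [W1 PW] := weight_C1 p a1_continuous a2_continuous.
have P1 j := C2_partial_C1 j v2; have cp j := C1_continuous (P1 j).
have cW := C1_continuous W1; have cz := C1_continuous z1.
have cv := C1_continuous (C2_C1 v2).
have f1 j := C1_mul z1 (C1_mul W1 (P1 j)).1.
have fc j : Cc (fun x => ze x * (weight x * partial j v x)).
  by apply: Cc_mulr => //; exact: continuous_mul.
have dfc j : Cc (partial j (fun x => ze x * (weight x * partial j v x))).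
  by apply: Cc_partial => //; exact: C1_partial_continuous (f1 j).1.
have dzc j : Cc (partial j ze).
  by apply: Cc_partial => //; exact: C1_partial_continuous z1.
have Z j : rV_integral (partial j (fun x => ze x * (weight x * partial j v x))) = 0.
  by apply: rV_integral_partial => //; have [_ /(_ j)[]] := (f1 j).1.
have c1 j : Cc (fun x => partial j v x * (weight x * partial j ze x)).
  by apply: Cc_mull => //; exact: Cc_mull.
have c2 : Cc (fun x => (v x - v x ^+ 3) * (weight x * ze x)).
  apply: Cc_mull; first exact: Cc_mull.
  by apply: continuous_add => //; apply: continuous_opp; exact: continuous_pow.
rewrite -rV_integral_sum//; apply/eqP; rewrite -subr_eq0 -rV_integral_sub//; last exact: Cc_sum.
apply/eqP; have -> : (fun x => \sum_j partial j v x * (weight x * partial j ze x)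
    - (v x - v x ^+ 3) * (weight x * ze x)) =
  (fun x => \sum_j partial j (fun x => ze x * (weight x * partial j v x)) x).
  apply/funext => x.
  have -> : \sum_j partial j (fun x => ze x * (weight x * partial j v x)) x =
    \sum_j partial j v x * (weight x * partial j ze x) +
    ze x * weight x * (laplacian v x - \sum_j drift a1 a2 j x * partial j v x).
    rewrite /laplacian -sumrB mulr_sumr -big_split /=; apply: eq_bigr => j _.
    rewrite (f1 j).2 (C1_mul W1 (P1 j)).2 PW.
    move: (partial j (partial j v) x) (partial j v x) (partial j ze x) => b q w; ring.
  rewrite (solution_equation v_solution) (addrC (\sum_j drift a1 a2 j x * _)) addrK.
  by congr (_ + _); ring.
by rewrite rV_integral_sum// big1// => j _; exact: Z.
Qed.

End WeakEquation.

Section DifferenceQuotients.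
Variables (R : realType) (n : nat).
Local Notation V := ('rV[R]_n).
Implicit Types (g psi : V -> R) (i : 'I_n) (h : R).

Definition diff_quotient i h g x : R := h^-1 * (g (x + h *: basis i) - g x).

Lemma diff_quotient_cvg i g psi : continuous g -> has_partial i g ->
    continuous (partial i g) -> Cc psi ->
  rV_integral (fun x => diff_quotient i h g x * psi x) @[h --> 0^'] -->
  rV_integral (fun x => partial i g x * psi x).
Proof.
move=> cg dg cdg psic; have [cpsi [A A0 psi0]] := psic.
have cq h : continuous (fun x => diff_quotient i h g x).
  apply: continuous_mul; first exact: continuous_const.
  apply: continuous_add; first exact: continuous_translate.
  exact: continuous_opp.
apply/cvgrPdist_le => e e0; pose K := rV_integral (fun x => `|psi x|) + 1.
have K0 : 0 < K.
  by rewrite ltr_wpDl// rV_integral_ge0//; exact: Cc_abs.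
have [d d0 dP] := uniform_continuity_on_box A cdg (divr_gt0 e0 K0).
exists d => // h /=; rewrite sub0r normrN => hd h0.
have Cq : Cc (fun x => diff_quotient i h g x * psi x) by exact: Cc_mull.
have Cp : Cc (fun x => partial i g x * psi x) by exact: Cc_mull.
rewrite -rV_integral_sub//; have Cd := Cc_sub Cp Cq.
apply: (le_trans (ler_norm_rV_integral Cd)).
have Ce : Cc (fun x => e / K * `|psi x|) by apply: Cc_scale; exact: Cc_abs.
apply: le_trans (le_rV_integral (Cc_abs Cd) Ce _) _ => [x|]; last first.
  rewrite rV_integral_scale; last exact: Cc_abs.
  rewrite -[leRHS](divfK (lt0r_neq0 K0)) ler_wpM2l ?divr_ge0 ?(ltW e0) ?(ltW K0)//.
  by rewrite /K lerDl.
rewrite -mulrBl normrM.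
case: (pselect (forall k, `|x ord0 k| <= A)) => [xA|]; last first.
  by move=> /existsNP[k /negP]; rewrite -ltNge => /psi0->; rewrite normr0 !mulr0.
rewrite ler_wpM2r// distrC; have [t /andP[t0 t1] E] := mvt_coord x h dg.
rewrite /diff_quotient E mulrA mulVf// mul1r ltW//; apply: dP => // k.
rewrite coord_shift addrAC subrr add0r.
apply: le_lt_trans hd; rewrite !normrM (ger0_norm t0).
have k1 : `|(k == i)%:R| <= 1 :> R by case: (k == i); rewrite ?normr1 ?normr0.
rewrite -mulrA; apply: le_trans (ler_piMl _ t1) _; first exact: mulr_ge0.
by rewrite ler_piMr.
Qed.

End DifferenceQuotients.

Section LinearizedEquation.
Variables (R : realType) (p : nat).
Local Notation n := p.+3.
Local Notation V := ('rV[R]_n).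
Variables (a1 a2 : R -> R) (u : V -> R).
Hypotheses (u_solution : classical_solution a1 a2 u) (u_monotone : monotone_last u).
Hypotheses (a1_continuous : continuous a1) (a2_continuous : continuous a2).
Implicit Types (x y : V) (i j k : 'I_n) (s t T A d : R).
Local Notation last := (@ord_max p.+2).
Local Notation weight := (weight a1 a2).

(** The coefficients do not depend on the variable of index [i], so translates of [u] in
    that direction are solutions as well. The difference of the two weak equations is
    divided by the step, which tends to 0; this needs no third derivatives of [u]. *)
Lemma linearized_equation i (ze : V -> R) : i != idx1 p -> i != idx2 p ->
    C1 ze -> Cc ze ->
  \sum_j rV_integral (fun x => partial j (partial i u) x * (weight x * partial j ze x)) =
  rV_integral (fun x => (1 - 3 * u x ^+ 2) * partial i u x * (weight x * ze x)).
Proof.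
move=> i1 i2 z1 zc; have u2 := solution_C2 u_solution; have u1 := C2_C1 u2.
have [W1 PW] := weight_C1 p a1_continuous a2_continuous.
have cW := C1_continuous W1; have cu := C1_continuous u1.
have P1 j := C2_partial_C1 j u2; have cp j := C1_continuous (P1 j).
have dzc j : Cc (fun x => weight x * partial j ze x).
  by apply: Cc_mull => //; apply: Cc_partial => //; exact: C1_partial_continuous z1.
have Wzc : Cc (fun x => weight x * ze x) by exact: Cc_mull.
pose f x := u x - u x ^+ 3.
have [f1 fP] : C1 f /\ forall j, partial j f = fun x => (1 - 3 * u x ^+ 2) * partial j u x.
  apply: (@C1_comp R n (fun t => t - t ^+ 3) (fun t => 1 - 3 * t ^+ 2)) => //.
    move=> t; have D := is_derive_id t 1.
    have := is_derive_sub D (is_derive_mul D (is_derive_mul D D)).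
    under eq_fun do rewrite /= -!expr2 -exprS.
    by move=> D'; apply: (is_derive_eq D'); ring.
  apply: continuous_add; first exact: continuous_const.
  apply: continuous_opp; apply: continuous_mul; first exact: continuous_const.
  by apply: continuous_pow => t; exact: cvg_id.
have cf := C1_continuous f1.
pose lhs h := \sum_j rV_integral (fun x => diff_quotient i h (partial j u) x *
   (weight x * partial j ze x)).
pose rhs h := rV_integral (fun x => diff_quotient i h f x * (weight x * ze x)).
have E : lhs = rhs.
  apply/funext => h; rewrite /lhs /rhs.
  have sol := classical_solution_translate u_solution h i1 i2.
  have W0 := weak_equation a1_continuous a2_continuous u_solution z1 zc.
  have Wh := weak_equation a1_continuous a2_continuous sol z1 zc.
  have cT (g : V -> R) : continuous g -> continuous (fun x => g (x + h *: basis i)).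
    exact: continuous_translate.
  transitivity (h^-1 * (rV_integral (fun x => f (x + h *: basis i) * (weight x * ze x))
     - rV_integral (fun x => f x * (weight x * ze x)))); last first.
    rewrite -rV_integral_sub; [|by apply: Cc_mull => //; exact: cT|exact: Cc_mull].
    rewrite -rV_integral_scale; last first.
      by apply: Cc_sub; apply: Cc_mull => //; exact: cT.
    congr rV_integral; apply/funext => x; rewrite /diff_quotient.
    by move: (weight x * _) (f _) (f _) => w b q; ring.
  rewrite -[X in _ * (X - _)]Wh -W0 -sumrB mulr_sumr; apply: eq_bigr => j _.
  rewrite (partial_translate (h *: basis i) _).2; last by have [_ /(_ j)[]] := u1.
  rewrite -rV_integral_sub; [|by apply: Cc_mull => //; exact: cT|exact: Cc_mull].
  rewrite -rV_integral_scale; last first.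
    by apply: Cc_sub; apply: Cc_mull => //; exact: cT.
  congr rV_integral; apply/funext => x; rewrite /diff_quotient.
  by move: (weight x * _) (partial j u _) (partial j u _) => w b q; ring.
have l1 : lhs h @[h --> 0^'] -->
    \sum_j rV_integral (fun x => partial i (partial j u) x * (weight x * partial j ze x)).
  apply: cvg_big => [|j _]; first exact: add_continuous.
  apply: diff_quotient_cvg => //.
    by have [_ /(_ i)[]] := P1 j.
  exact: C1_partial_continuous (P1 j).
have l2 : rhs h @[h --> 0^'] --> rV_integral (fun x => partial i f x * (weight x * ze x)).
  apply: diff_quotient_cvg => //; first by have [_ /(_ i)[]] := f1.
  exact: C1_partial_continuous f1.
rewrite E in l1; have := cvg_unique _ l1 l2; rewrite (fP i) => <-; last exact: Rhausdorff.
by apply: eq_bigr => j _; rewrite (partial_comm j i u2).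
Qed.

(** The quotient of two solutions of the linearized equation satisfies an equation
    without zeroth order term. *)
Lemma quotient_equation i (xi : V -> R) : i != idx1 p -> i != idx2 p ->
    C1 xi -> Cc xi ->
  let phi := partial last u in
  let sig x := partial i u x / phi x in
  rV_integral (fun x => \sum_j weight x * phi x ^+ 2 * (partial j sig x * partial j xi x)) = 0.
Proof.
move=> i1 i2 xi1 xic phi sig.
have u2 := solution_C2 u_solution; have u1 := C2_C1 u2.
have [W1 PW] := weight_C1 p a1_continuous a2_continuous.
have cW := C1_continuous W1; have cu := C1_continuous u1.
have P1 j := C2_partial_C1 j u2; have cp j := C1_continuous (P1 j).
have phi0 x : phi x != 0 by rewrite gt_eqF// u_monotone.
have [iphi1 _] := C1_inv phi0 (P1 last).
have [sig1 _] := C1_mul (P1 i) iphi1; rewrite -/sig in sig1.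
have vE : partial i u = fun x => sig x * phi x.
  by apply/funext => x; rewrite /sig divfK.
have [_ vP] := C1_mul sig1 (P1 last).
pose z2 x := xi x * phi x; pose z1 x := sig x * z2 x.
have [z21 z2P] := C1_mul xi1 (P1 last); rewrite -/phi -/z2 in z21 z2P.
have [z11 z1P] := C1_mul sig1 z21; rewrite -/z1 in z11 z1P.
have cs := C1_continuous sig1.
have z2c : Cc z2 by apply: Cc_mulr => //; exact: cp.
have z1c : Cc z1 by exact: Cc_mull.
have E1 := linearized_equation i1 i2 z21 z2c.
have E2 := @linearized_equation last z1 isT isT z11 z1c.
have RR : rV_integral (fun x => (1 - 3 * u x ^+ 2) * partial i u x * (weight x * z2 x)) =
  rV_integral (fun x => (1 - 3 * u x ^+ 2) * partial last u x * (weight x * z1 x)).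
  congr rV_integral; apply/funext => x; rewrite vE /z1 -/phi.
  by move: (sig x) (phi x) (z2 x) => a b d; ring.
rewrite RR -E2 in E1.
have cd j (g z : V -> R) : C1 g -> C1 z -> Cc z ->
    Cc (fun x => partial j g x * (weight x * partial j z x)).
  move=> g1 zz1 zc; have cg := C1_partial_continuous j g1.
  have cz := C1_partial_continuous j zz1.
  by apply: (Cc_mull _ cg); apply: (Cc_mull _ cW); exact: (Cc_partial zc cz).
pose A j x := partial j (partial i u) x * (weight x * partial j z2 x).
pose B j x := partial j (partial last u) x * (weight x * partial j z1 x).
have c1 j : Cc (A j) by exact: cd (P1 i) z21 z2c.
have c2 j : Cc (B j) by exact: cd (P1 last) z11 z1c.
have S1 : rV_integral (fun x => \sum_j A j x - \sum_j B j x) = 0.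
  rewrite rV_integral_sub; [|exact: Cc_sum|exact: Cc_sum].
  rewrite (rV_integral_sum _ _ c1) (rV_integral_sum _ _ c2); apply/eqP.
  by rewrite subr_eq0; apply/eqP; exact: E1.
transitivity (rV_integral (fun x => \sum_j A j x - \sum_j B j x)); last exact: S1.
apply: (congr1 (@rV_integral R n)); apply/funext => x; rewrite -sumrB.
apply: eq_bigr => j _; rewrite /A /B z1P z2P vE vP -/phi.
move: (partial j phi x) (partial j sig x) (partial j xi x) => a b d.
by rewrite /z2; move: (phi x) (sig x) (xi x) (weight x) => ? ? ? ?; ring.
Qed.

End LinearizedEquation.

(** * The Liouville theorem for quotients of derivatives *)

Section Positivity.
Variables (R : realType) (n : nat).
Local Notation V := ('rV[R]_n).
Variables (chi dchi : R -> R -> R) (c : R).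
Hypothesis chiP : cutoffs chi dchi c.

(** Where it is positive, [f] dominates a multiple of a bump, whose integral is positive by
    the product formula. *)
Lemma rV_integral_eq0 (f : V -> R) : Cc f -> (forall x, 0 <= f x) ->
  rV_integral f = 0 -> forall x, f x = 0.
Proof.
move=> fc f0 intf x; apply/eqP; rewrite eq_le f0 andbT leNgt; apply/negP => fx.
have fx2 : 0 < f x / 2 by rewrite divr_gt0.
have [d d0 dP] := continuous_eps x (Cc_continuous fc) fx2.
pose s := d / 2; have s0 : 0 < s by rewrite divr_gt0.
have [d1 _ b01 b1 [bz _]] := chiP s0.
pose g k t := chi s (t - x ord0 k).
have cg k : continuous (g k) by exact: (chi_shift chiP s0).
have dG k t := is_derive_integral_from0 t (cg k).
pose A := \sum_k `|x ord0 k| + 2 * s + s.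
have xA k : `|x ord0 k| <= \sum_k `|x ord0 k| by rewrite (bigD1 k)//= lerDl sumr_ge0.
have A0 : 0 <= A by rewrite /A !addr_ge0 ?sumr_ge0 ?mulr_ge0// ltW.
have gz k t : A <= `|t| -> g k t = 0.
  rewrite /A => At; apply: (bz _ _).1; have := lerB_dist t (x ord0 k); have := xA k; lra.
have g0 k t : 0 <= g k t by case/andP: (b01 (t - x ord0 k)).
have mono k a b : a <= b -> integral_from0 (g k) a <= integral_from0 (g k) b.
  move=> ab; have [h _ E] := mvt a (b - a) (dG k).
  by rewrite -subr_ge0; move: E; rewrite subrKC => ->; rewrite mulr_ge0 ?subr_ge0.
have pos k : 0 < integral_from0 (g k) A - integral_from0 (g k) (- A).
  have [h h01 E] := mvt (x ord0 k - s) (2 * s) (dG k).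
  have e1 : x ord0 k - s + 2 * s = x ord0 k + s by ring.
  have g1 : g k (x ord0 k - s + h * (2 * s)) = 1.
    apply: (b1 _ _).1; have -> : x ord0 k - s + h * (2 * s) - x ord0 k = h * (2 * s) - s by ring.
    by rewrite ler_norml; nra.
  rewrite g1 e1 mulr1 in E.
  have h1 := mono k (- A) (x ord0 k - s); have h2 := mono k (x ord0 k + s) A.
  have := xA k; rewrite ler_norml => xk; rewrite /A in h1 h2 *; lra.
have bumpc : Cc (fun y : V => \prod_k g k (y ord0 k)).
  have [k0|nok] := pselect (exists k : 'I_n, True).
    have [k _] := k0; apply: (@Cc_prod R n g k A A0 cg) => j t At; exact: gz (ltW At).
  split; first by apply: continuous_prod => k; case: nok; exists k.
  by exists 0 => // y k; case: nok; exists k.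
have intb := rV_integral_prod A0 dG cg gz.
have : rV_integral (fun y : V => f x / 2 * \prod_k g k (y ord0 k)) <= rV_integral f.
  apply: le_rV_integral => //; first exact: Cc_scale.
  move=> y; have p0 : 0 <= \prod_k g k (y ord0 k) by exact: prodr_ge0.
  case: (pselect (forall k, `|y ord0 k - x ord0 k| < d)) => [yx|].
    have p1 : \prod_k g k (y ord0 k) <= 1.
      by apply: prodr_ile1 => k _; rewrite g0; case/andP: (b01 (y ord0 k - x ord0 k)).
    have := dP y yx; rewrite ltr_norml => /andP[h1 _].
    have : f x / 2 * \prod_k g k (y ord0 k) <= f x / 2 by rewrite ler_piMr// ltW.
    by lra.
  move=> /existsNP[k /negP]; rewrite -leNgt => yk.
  rewrite (bigD1 k)//= /g (bz _ _).1 ?mul0r ?mulr0// /s; lra.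
rewrite rV_integral_scale// intb intf leNgt => /negP; apply.
by rewrite mulr_gt0// prodr_gt0.
Qed.

End Positivity.

(** The iteration of the Liouville theorem: optimizing in [lam] gives
    [D (j+1)^2 <= 4 K (G j) (D (j+1) - D j)], hence
    [1 / (4 K (G j)) <= 1 / D j - 1 / D (j+1)], whose sum telescopes. *)
Lemma dyadic_liouville (R : realType) (D G : nat -> R) (K : R) : 0 < K ->
    (forall j, 0 <= D j) -> (forall j, D j <= D j.+1) -> (forall j, 0 < G j) ->
    (forall j lam, 0 < lam ->
       D j.+1 <= lam * (D j.+1 - D j) + lam^-1 * (K * G j)) ->
    (forall m B, exists J, B < \sum_(m <= j < J) (G j)^-1) ->
  forall j, D j = 0.
Proof.
move=> K0 D0 Dm G0 H Gdiv m; apply/eqP; rewrite eq_le D0 andbT leNgt; apply/negP => Dpos.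
have Dp j : (m <= j)%N -> 0 < D j.
  elim: j => [|j ih]; first by rewrite leqn0 => /eqP <-.
  rewrite leq_eqVlt => /orP[/eqP<-//|mj]; exact: lt_le_trans (ih mj) (Dm j).
have step j : (m <= j)%N -> (4 * K)^-1 * (G j)^-1 <= (D j)^-1 - (D j.+1)^-1.
  move=> mj; have p0 := Dp _ mj; have p1 := Dp _ (leqW mj).
  have KG : 0 < K * G j by rewrite mulr_gt0.
  pose lam := 2 * (K * G j) / D j.+1.
  have lam0 : 0 < lam by rewrite divr_gt0// mulr_gt0.
  have := H j lam lam0.
  have -> : lam^-1 * (K * G j) = D j.+1 / 2 by rewrite /lam; field; rewrite !gt_eqF.
  have -> : lam * (D j.+1 - D j) = 2 * (K * G j) * (D j.+1 - D j) / D j.+1.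
    by rewrite /lam; ring.
  move=> h1.
  have h2 : D j.+1 * D j.+1 <= 4 * (K * G j) * (D j.+1 - D j).
    have h3 : D j.+1 / 2 <= 2 * (K * G j) * (D j.+1 - D j) / D j.+1 by lra.
    by move: h3; rewrite ler_pdivlMr//; lra.
  have -> : (D j)^-1 - (D j.+1)^-1 = (D j.+1 - D j) / (D j * D j.+1).
    by field; rewrite !gt_eqF.
  rewrite ler_pdivlMr ?mulr_gt0// -invfM.
  have KG4 : 0 < 4 * K * G j by rewrite !mulr_gt0.
  rewrite ler_pdivrMl//.
  have := Dm j; nra.
have [J] := Gdiv m (4 * K / D m).
have [mJ|mJ] := leqP m J; last first.
  rewrite big_geq ?(ltnW mJ)// => h; have : 0 <= 4 * K / D m by rewrite divr_ge0 ?mulr_ge0 ?ltW.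
  by lra.
have tele : \sum_(m <= j < J) (4 * K)^-1 * (G j)^-1 <= (D m)^-1.
  apply: (@le_trans _ _ (\sum_(m <= j < J) - ((D j.+1)^-1 - (D j)^-1))).
    by apply: ler_sum_nat => j /andP[mj _]; rewrite opprB; exact: step.
  rewrite sumrN (telescope_sumr (fun j => (D j)^-1))// opprB.
  by rewrite gerDl oppr_le0 invr_ge0.
rewrite -mulr_sumr in tele; rewrite ltNge => /negP; apply.
have K4 : 0 < 4 * K by rewrite mulr_gt0.
by rewrite ler_pdivrMl// in tele.
Qed.

Section Caccioppoli.
Variables (R : realType) (p : nat).
Local Notation n := p.+3.
Local Notation V := ('rV[R]_n).
Variables (a1 a2 : R -> R) (u : V -> R) (L : R).
Hypotheses (L0 : 0 <= L) (a1L : forall t, `|a1 t| <= L) (a2L : forall t, `|a2 t| <= L).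
Hypotheses (u_solution : classical_solution a1 a2 u) (u_monotone : monotone_last u)
  (u_convergent : asymptotically_convergent u).
Hypotheses (a1_continuous : continuous a1) (a2_continuous : continuous a2).
Implicit Types (x y : V) (i j k : 'I_n) (s t T A d : R).
Local Notation last := (@ord_max p.+2).
Local Notation weight := (weight a1 a2).
Local Notation energy := (energy u).
Variables (chi dchi : R -> R -> R) (c : R).
Hypotheses (c0 : 0 <= c) (chiP : cutoffs chi dchi c).
Local Notation volume := (volume p a1 a2).
Implicit Types r : R.

Definition eta r x : R := prodlast (chi r) (chi r) x.

Lemma etaE r x : eta r x = \prod_k chi r (x ord0 k).
Proof. by apply: eq_bigr => k _; rewrite if_same. Qed.

Lemma eta_bounds r x : 0 < r -> 0 <= eta r x <= 1.
Proof.
move=> /chiP[_ _ b01 _ _]; rewrite etaE; apply/andP; split.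
  by apply: prodr_ge0 => k _; case/andP: (b01 (x ord0 k)).
by apply: prodr_ile1 => k _; exact: b01.
Qed.

Lemma eta_le_double r x : 0 < r -> eta r x <= eta (2 * r) x.
Proof.
move=> r0; rewrite !etaE; apply: ler_prod => k _.
by have [_ _ b01 _ _] := chiP r0; case/andP: (b01 (x ord0 k)) => -> _;
  exact: (chi_le_double chiP _ r0).
Qed.

Lemma eta_one r x : 0 < r -> (forall k, `|x ord0 k| <= r) -> eta r x = 1.
Proof.
move=> /chiP[_ _ _ b1 _] xr; rewrite etaE big1// => k _.
exact: (b1 _ (xr k)).1.
Qed.

Lemma eta_C1 r : 0 < r -> [/\ C1 (eta r), Cc (eta r) &
  forall j, partial j (eta r) = fun x =>
    dchi r (x ord0 j) * \prod_(k | k != j) chi r (x ord0 k)].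
Proof.
move=> r0; have [d1 cd b01 b1 [bz _]] := chiP r0.
have [h1 hP] := @C1_prod R n (fun=> chi r) (fun=> dchi r) (fun=> d1) (fun=> cd).
have E : eta r = fun x => \prod_k chi r (x ord0 k) by apply/funext => x; exact: etaE.
rewrite E; split=> //.
have r20 : 0 <= 2 * r by rewrite mulr_ge0// ltW.
apply: (@Cc_prod R n (fun=> chi r) last _ r20) => [_|_ t tr].
  exact: (chi_continuous chiP r0).
exact: (bz _ (ltW tr)).1.
Qed.

Lemma eta_gradient r j x : 0 < r ->
  partial j (eta r) x ^+ 2 <= (c / r) ^+ 2 * eta (2 * r) x.
Proof.
move=> r0; have [_ _ P] := eta_C1 r0; have [_ _ b01 _ [bz bc]] := chiP r0.
have r20 : 0 < 2 * r by rewrite mulr_gt0.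
have cr0 : 0 <= c / r by rewrite divr_ge0// ltW.
have /andP[e0 e1] := eta_bounds x r20.
case: (pselect (forall k, `|x ord0 k| <= 2 * r)) => [xr|].
  rewrite (eta_one r20 xr) mulr1 -real_normK ?num_real// ler_pXn2r ?nnegrE//.
  rewrite P normrM normr_prod -[leRHS]mulr1; apply: ler_pM => //.
    exact: prodr_ge0.
  by apply: prodr_ile1 => k _; rewrite normr_ge0 ger0_norm; case/andP: (b01 (x ord0 k)).
move=> /existsNP[k /negP]; rewrite -ltNge => xk.
have [z1 z2] := bz _ (ltW xk).
have -> : partial j (eta r) x = 0.
  rewrite P; have [<-|kj] := eqVneq k j; first by rewrite z2 mul0r.
  by rewrite (bigD1 k)//= z1 mul0r mulr0.
by rewrite expr0n mulr_ge0// sqr_ge0.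
Qed.

Lemma eta_disjoint r j x : 0 < r -> partial j (eta (2 * r)) x != 0 -> eta r x = 0.
Proof.
move=> r0; have r20 : 0 < 2 * r by rewrite mulr_gt0.
have [_ _ P] := eta_C1 r20; have [_ _ _ b1 _] := chiP r20.
have [_ _ _ _ [bz _]] := chiP r0; rewrite P => nz.
have xj : 2 * r <= `|x ord0 j|.
  rewrite leNgt; apply/negP => /ltW/b1[_ z]; by rewrite z mul0r eqxx in nz.
by rewrite etaE (bigD1 j)//= (bz _ xj).1 mul0r.
Qed.

Variable i : 'I_n.
Hypotheses (i1 : i != idx1 p) (i2 : i != idx2 p).

Definition quotient x : R := partial i u x / partial last u x.

Definition dirichlet x : R :=
  weight x * partial last u x ^+ 2 * \sum_j partial j quotient x ^+ 2.

Lemma quotient_C1 : C1 quotient.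
Proof.
have u2 := solution_C2 u_solution.
have phi0 x : partial last u x != 0 by rewrite gt_eqF// u_monotone.
have [iphi1 _] := C1_inv phi0 (C2_partial_C1 last u2).
exact: (C1_mul (C2_partial_C1 i u2) iphi1).1.
Qed.

Lemma dirichlet_continuous : continuous dirichlet.
Proof.
have u2 := solution_C2 u_solution; have q1 := quotient_C1.
have [W1 _] := weight_C1 p a1_continuous a2_continuous.
apply: continuous_mul.
  apply: continuous_mul; first exact: (C1_continuous W1).
  by apply: continuous_pow; exact: (C1_continuous (C2_partial_C1 last u2)).
by apply: continuous_sum => j; apply: continuous_pow; exact: C1_partial_continuous q1.
Qed.

Lemma dirichlet_ge0 x : 0 <= dirichlet x.
Proof.
apply: mulr_ge0; last by apply: sumr_ge0 => j _; exact: sqr_ge0.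
by apply: mulr_ge0; [exact: ltW (weight_gt0 a1 a2 x)|exact: sqr_ge0].
Qed.

Lemma young (lam a b : R) : 0 < lam -> - (2 * a * b) <= lam * a ^+ 2 + lam^-1 * b ^+ 2.
Proof.
move=> l0; rewrite -subr_ge0.
have -> : lam * a ^+ 2 + lam^-1 * b ^+ 2 - - (2 * a * b) = lam^-1 * (lam * a + b) ^+ 2.
  by field; rewrite gt_eqF.
by rewrite mulr_ge0 ?sqr_ge0 ?invr_ge0 ?(ltW l0).
Qed.

Definition dirichlet_integral r : R := rV_integral (fun x => eta r x ^+ 2 * dirichlet x).

Lemma Cc_dirichlet r : 0 < r -> Cc (fun x => eta r x ^+ 2 * dirichlet x).
Proof.
move=> /eta_C1[e1 ec _]; apply: Cc_mulr; last exact: dirichlet_continuous.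
under eq_fun do rewrite expr2.
by apply: Cc_mulr => //; exact: C1_continuous e1.
Qed.

(** The equation of the quotient is tested with [eta^2 * quotient]. The cross term
    contains the gradient of [eta (2 r)], which vanishes where [eta r] does not; by
    Young's inequality it costs a multiple of the Dirichlet integral over the difference
    of the two boxes only, plus the integral of [weight * (d_i u)^2 / r^2], since the
    square of [quotient * d_n u] is that of [d_i u]. The energy estimate bounds the
    latter. *)
Lemma caccioppoli : exists2 K : R, 0 <= K & forall r lam, 0 < r -> 0 < lam ->
  dirichlet_integral (2 * r) <=
    lam * (dirichlet_integral (2 * r) - dirichlet_integral r)
    + lam^-1 * (K * (volume (4 * r) / r ^+ 2)).
Proof.
have [K K0 est] := energy_estimate L0 a1L a2L u_solution u_monotone u_convergent
  a1_continuous a2_continuous c0 chiP.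
pose nR : R := n%:R; have nR0 : 0 <= nR by exact: ler0n.
exists (nR * c ^+ 2 * K / 2) => [|r lam r0 lam0].
  by rewrite divr_ge0// !mulr_ge0// sqr_ge0.
have r20 : 0 < 2 * r by rewrite mulr_gt0.
have r40 : 0 < 4 * r by rewrite mulr_gt0.
have [e1 ec eP] := eta_C1 r20; have [e4 ec4 _] := eta_C1 r40.
have [W1 _] := weight_C1 p a1_continuous a2_continuous.
have [E1 _] := energy_C1 u_solution.
have q1 := quotient_C1; have ce := C1_continuous e1; have cq := C1_continuous q1.
have [ee1 eeP] := C1_mul e1 e1; have [xi1 xiP] := C1_mul ee1 q1.
have xic : Cc (fun x => eta (2 * r) x * eta (2 * r) x * quotient x).
  by apply: Cc_mulr => //; exact: Cc_mulr.
have QE := quotient_equation u_solution u_monotone a1_continuous a2_continuous i1 i2 xi1 xic.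
pose I0 x := \sum_j weight x * partial last u x ^+ 2 * (partial j quotient x *
  partial j (fun x => eta (2 * r) x * eta (2 * r) x * quotient x) x).
have cI0 : Cc I0.
  have cphi := C1_continuous (C2_partial_C1 last (solution_C2 u_solution)).
  apply: Cc_sum => j; apply: Cc_mull.
    apply: Cc_mull; last exact: C1_partial_continuous q1.
    by apply: (Cc_partial xic); exact: C1_partial_continuous xi1.
  apply: continuous_mul; first exact: (C1_continuous W1).
  exact: continuous_pow.
pose I2 x := weight x * energy x * eta (4 * r) x.
have cI2 : Cc I2.
  apply: Cc_mull => //; apply: continuous_mul; first exact: (C1_continuous W1).
  exact: (C1_continuous E1).
have cD2 := Cc_dirichlet r20; have cD1 := Cc_dirichlet r0.
pose k2 := 2 * nR * (c / (2 * r)) ^+ 2.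
have k20 : 0 <= k2 := mulr_ge0 (mulr_ge0 (ler0n _ 2) nR0) (sqr_ge0 _).
have pw x : eta (2 * r) x ^+ 2 * dirichlet x <= I0 x +
    (lam * (eta (2 * r) x ^+ 2 * dirichlet x - eta r x ^+ 2 * dirichlet x)
     + lam^-1 * k2 * I2 x).
  have Wx := weight_gt0 a1 a2 x.
  set Wp := weight x * partial last u x ^+ 2.
  have Wp0 : 0 <= Wp := mulr_ge0 (ltW Wx) (sqr_ge0 _).
  have I0E : I0 x = eta (2 * r) x ^+ 2 * dirichlet x +
      Wp * \sum_j 2 * (eta (2 * r) x * partial j quotient x) *
                      (quotient x * partial j (eta (2 * r)) x).
    rewrite /dirichlet -/Wp mulrCA -mulrDr mulr_sumr -big_split /I0 mulr_sumr /=.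
    apply: eq_bigr => j _; rewrite -/Wp xiP eeP.
    move: (partial j quotient x) (partial j (eta (2 * r)) x) => a b.
    by move: (eta (2 * r) x) (quotient x) => q v; ring.
  have I20 : 0 <= I2 x.
    have /andP[h _] := eta_bounds x r40.
    exact: mulr_ge0 (mulr_ge0 (ltW Wx) (energy_ge0 u x)) h.
  have D0 := dirichlet_ge0 x.
  have il0 : 0 <= lam^-1 by rewrite invr_ge0 ltW.
  have tail0 : 0 <= lam^-1 * k2 * I2 x := mulr_ge0 (mulr_ge0 il0 k20) I20.
  rewrite I0E -addrA lerDl -lerBlDl sub0r.
  have [/existsP[j0 nz]|] := boolP [exists j, partial j (eta (2 * r)) x != 0]; last first.
    move=> /existsPn allz; rewrite big1 ?mulr0 ?oppr0; last first.
      by move=> j _; have := allz j; rewrite negbK => /eqP->; rewrite !mulr0.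
    have h2 : eta r x ^+ 2 <= eta (2 * r) x ^+ 2.
      have /andP[h _] := eta_bounds x r0; have h' := eta_le_double x r0.
      by rewrite ler_pXn2r ?nnegrE ?(le_trans h h').
    apply: addr_ge0 => //; apply: (mulr_ge0 (ltW lam0)).
    by rewrite -mulrBl; apply: mulr_ge0 => //; rewrite subr_ge0.
  rewrite (eta_disjoint r0 nz) expr0n mul0r subr0.
  have -> : lam * (eta (2 * r) x ^+ 2 * dirichlet x) =
     Wp * \sum_j lam * (eta (2 * r) x * partial j quotient x) ^+ 2.
    rewrite -mulr_sumr (eq_bigr (fun j => eta (2 * r) x ^+ 2 * partial j quotient x ^+ 2)).
      by rewrite -mulr_sumr /dirichlet -/Wp; ring.
    by move=> j _; rewrite exprMn.
  rewrite -mulrN -sumrN.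
  apply: (@le_trans _ _ (Wp * \sum_j (lam * (eta (2 * r) x * partial j quotient x) ^+ 2 +
      lam^-1 * (quotient x * partial j (eta (2 * r)) x) ^+ 2))).
    by apply: ler_wpM2l => //; apply: ler_sum => j _; exact: young.
  rewrite big_split /= mulrDr lerD2l -mulr_sumr mulrCA -[leRHS]mulrA.
  rewrite ler_pM2l ?invr_gt0//.
  have r4E : 4 * r = 2 * (2 * r) by ring.
  have grad : \sum_j (quotient x * partial j (eta (2 * r)) x) ^+ 2 <=
      quotient x ^+ 2 * (nR * ((c / (2 * r)) ^+ 2 * eta (4 * r) x)).
    rewrite (eq_bigr (fun j => quotient x ^+ 2 * partial j (eta (2 * r)) x ^+ 2)).
      rewrite -mulr_sumr; apply: ler_wpM2l; first exact: sqr_ge0.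
      apply: (@le_trans _ _ (\sum_(j < n) (c / (2 * r)) ^+ 2 * eta (4 * r) x)).
        by apply: ler_sum => j _; rewrite r4E; exact: eta_gradient.
      by rewrite sumr_const card_ord -[_ *+ n]mulr_natl.
    by move=> j _; rewrite exprMn.
  apply: (le_trans (ler_wpM2l Wp0 grad)).
  have v2 : Wp * quotient x ^+ 2 = weight x * partial i u x ^+ 2.
    rewrite /Wp /quotient expr_div_n; field.
    by rewrite gt_eqF// u_monotone.
  rewrite [leLHS]mulrA v2 /k2 /I2.
  have ei : partial i u x ^+ 2 <= 2 * energy x.
    have h := gradient_energy_le u x.
    have h' : partial i u x ^+ 2 <= \sum_j partial j u x ^+ 2.
      by rewrite (bigD1 i)//= lerDl; apply: sumr_ge0 => j _; exact: sqr_ge0.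
    lra.
  have tl0 : 0 <= nR * ((c / (2 * r)) ^+ 2 * eta (4 * r) x).
    have /andP[h _] := eta_bounds x r40.
    exact: mulr_ge0 nR0 (mulr_ge0 (sqr_ge0 _) h).
  have -> : 2 * nR * (c / (2 * r)) ^+ 2 * (weight x * energy x * eta (4 * r) x) =
    weight x * (2 * energy x) * (nR * ((c / (2 * r)) ^+ 2 * eta (4 * r) x)).
    by move: (_ ^+ 2) (weight x) (energy x) (eta _ x) => ? ? ? ?; ring.
  by apply: (ler_wpM2r tl0); apply: ler_wpM2l => //; exact: ltW.
have := le_rV_integral cD2 (Cc_add cI0 (Cc_add (Cc_scale lam (Cc_sub cD2 cD1))
  (Cc_scale (lam^-1 * k2) cI2))) pw.
rewrite (rV_integral_add cI0); last first.
  by apply: Cc_add; apply: Cc_scale => //; exact: Cc_sub.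
rewrite rV_integral_add; [|by apply: Cc_scale; exact: Cc_sub|exact: Cc_scale].
rewrite rV_integral_scale; last exact: Cc_sub.
rewrite rV_integral_sub// rV_integral_scale// -/(dirichlet_integral _) -/(dirichlet_integral _).
have -> : rV_integral I0 = 0 by exact: QE.
rewrite add0r => /le_trans; apply; rewrite lerD2l.
rewrite -(mulrA lam^-1 k2); apply: ler_wpM2l; first by rewrite invr_ge0 ltW.
have := ler_wpM2l k20 (est (4 * r) r40) => /le_trans; apply.
have -> : k2 * (K * volume (4 * r)) = nR * c ^+ 2 * K / 2 * (volume (4 * r) / r ^+ 2).
  by rewrite /k2; field; rewrite gt_eqF.
by [].
Qed.

End Caccioppoli.

(** * Reduction of the dimension *)

Section DimensionReduction.
Variables (R : realType) (n : nat).
Local Notation V := ('rV[R]_n).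
Implicit Types (f : V -> R) (x y : V) (i j : 'I_n) (h c d : R).

(** The derivative of [f] along [basis i - c basis j] vanishes. Moving along the two
    coordinates in turn, the mean value theorem writes a difference quotient as [c]
    times a difference of two values of [partial j f] at nearby points. *)
Lemma invariant_direction f i j c : C1 f ->
    (forall x, partial i f x = c * partial j f x) ->
  forall h x, f (x + h *: (basis i - c *: basis j)) = f x.
Proof.
move=> f1 fij; set v := basis i - c *: basis j.
have der0 y : is_derive y v f 0.
  have lim0 : (fun h : R => h^-1 *: (f (h *: v + y) - f y)) @ 0^' --> (0 : R).
    apply/cvgr0Pnorm_lt => e e0; pose M : R := `|c| + 1.
    have M0 : 0 < M by rewrite ltr_wpDl.
    have eM : 0 < e / (2 * M) by rewrite divr_gt0// mulr_gt0.
    have [d d0 dP] := continuous_eps y (C1_partial_continuous j f1) eM.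
    exists (d / M) => [|h /=]; first exact: divr_gt0.
    rewrite sub0r normrN ltr_pdivlMr// => hd h0.
    have [_ /(_ i)[di _]] := f1; have [_ /(_ j)[dj _]] := f1.
    have [s /andP[s0 s1] E1] := mvt_coord y h di.
    have [t /andP[t0 t1] E2] := mvt_coord (y + h *: basis i) (- (h * c)) dj.
    have -> : h *: v + y = y + h *: basis i + - (h * c) *: basis j.
      by rewrite /v scalerBr scalerA scaleNr addrC addrA.
    rewrite -[f _](subrK (f (y + h *: basis i))) -addrA E2 E1 fij.
    set x1 := y + _ + _; set x2 := y + _.
    have -> : h^-1 *: (- (h * c) * partial j f x1 + h * (c * partial j f x2)) =
        c * ((partial j f x2 - partial j f y) - (partial j f x1 - partial j f y)).
      move: (partial j f x1) (partial j f x2) (partial j f y) => A B C.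
      by rewrite -[h^-1 *: _]/(h^-1 * _); field.
    have small x : (forall k, `|x ord0 k - y ord0 k| <= `|h| * M) ->
        `|partial j f x - partial j f y| < e / (2 * M).
      by move=> xk; apply: dP => k; exact: le_lt_trans (xk k) hd.
    have nb (b : bool) (a : R) : `|a * b%:R| <= `|a|.
      by rewrite normrM normr_nat ler_piMr//; case: b.
    have hc : `|h| * M = `|h| * `|c| + `|h| by rewrite mulrDr mulr1.
    have s2 : `|partial j f x2 - partial j f y| < e / (2 * M).
      apply: small => k; rewrite coord_shift [y ord0 k + _]addrC addrK.
      apply: (le_trans (nb _ _)); rewrite hc normrM (ger0_norm s0).
      by rewrite ler_wpDl ?mulr_ge0// ler_piMl.
    have s3 : `|partial j f x1 - partial j f y| < e / (2 * M).
      apply: small => k; rewrite !coord_shift [_ - y ord0 k]addrC !addrA addNr add0r.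
      apply: (le_trans (ler_normD _ _)); rewrite hc addrC; apply: lerD (nb _ _).
      apply: (le_trans (nb _ _)); rewrite normrM normrN normrM (ger0_norm t0).
      by rewrite ler_piMl// mulr_ge0.
    rewrite normrM; apply: (@le_lt_trans _ _ (`|c| * (e / M))).
      apply: ler_wpM2l => //; apply: (le_trans (ler_normB _ _)).
      have -> : e / M = e / (2 * M) + e / (2 * M) by field; rewrite gt_eqF.
      exact: lerD (ltW s2) (ltW s3).
    by rewrite mulrCA gtr_pMr// ltr_pdivrMr// mul1r /M ltrDl.
  split; first by apply/cvg_ex; exists 0.
  exact: cvg_lim lim0.
move=> h x; have [th _ E] := @mvt_line R V f x v h (fun s => is_derive_ex (der0 _)).
by apply/eqP; rewrite -subr_eq0 E (is_derive_unique (der0 _)) mulr0.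
Qed.

Lemma invariant_span f (P : pred 'I_n) (v : 'I_n -> V) :
    (forall i, P i -> forall h x, f (x + h *: v i) = f x) ->
  forall (h : 'I_n -> R) x, f (x + \sum_(i | P i) h i *: v i) = f x.
Proof.
move=> inv h x.
apply: (@big_ind _ (fun w => forall x, f (x + w) = f x)) => [|w w' Ew Ew'|i Pi] {}x.
- by rewrite addr0.
- by rewrite addrA Ew' Ew.
- exact: inv.
Qed.

Lemma constant_of_gradient0 f : C1 f -> (forall i x, partial i f x = 0) ->
  forall x, f x = f 0.
Proof.
move=> [_ f1] f0 x; have h0 i h y : f (y + h *: basis i) = f y.
  by have [t _ E] := mvt_coord y h (f1 i).1; apply/eqP; rewrite -subr_eq0 E f0 mulr0.
have := @invariant_span f xpredT (@basis R n) (fun i _ => h0 i) (fun i => x ord0 i) 0.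
by rewrite add0r -row_sum_delta.
Qed.

End DimensionReduction.

(** [f] is invariant under translations along [basis i - c i * basis ord_max], so all
    coordinates but the first two can be transferred to the last one, with the factors
    [c i]. *)
Lemma three_dimensional_of_ratio (R : realType) (p : nat) (f : 'rV[R]_p.+3 -> R)
    (c : 'I_p.+3 -> R) : C1 f ->
    (forall i, i != idx1 p -> i != idx2 p ->
       forall x, partial i f x = c i * partial ord_max f x) ->
  at_most_dimensional 3 f.
Proof.
move=> f1 ratio; pose other i := (i != idx1 p) && (i != idx2 p).
pose M : 'M[R]_(p.+3, 3) := \matrix_(i, k)
  if k == 0 then (i == idx1 p)%:R else if k == 1 then (i == idx2 p)%:R
  else if other i then c i else 0.
exists (mulmxr M), (fun y => f (y ord0 0 *: basis (idx1 p) +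
  y ord0 1 *: basis (idx2 p) + y ord0 2%:R *: basis ord_max)) => x /=.
have inv i : other i -> forall h y, f (y + h *: (basis i - c i *: basis ord_max)) = f y.
  by move=> /andP[i1 i2]; apply: invariant_direction => //; exact: ratio.
rewrite -(invariant_span inv (fun i => - x ord0 i) x); congr f.
have pick (j : 'I_p.+3) : \sum_i x ord0 i * (i == j)%:R = x ord0 j.
  rewrite (bigD1 j)//= eqxx mulr1 big1 ?addr0// => i /negPf->; exact: mulr0.
have -> : (x *m M) ord0 0 = x ord0 (idx1 p).
  by rewrite mxE -[RHS]pick; apply: eq_bigr => i _; rewrite !mxE.
have -> : (x *m M) ord0 1 = x ord0 (idx2 p).
  by rewrite mxE -[RHS]pick; apply: eq_bigr => i _; rewrite !mxE.
have -> : (x *m M) ord0 2%:R = \sum_(i | other i) x ord0 i * c i.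
  rewrite mxE [RHS]big_mkcond; apply: eq_bigr => i _; rewrite !mxE /=.
  by case: ifP => // _; exact: mulr0.
rewrite {1}[x]row_sum_delta (bigD1 (idx1 p))//= (bigD1 (idx2 p))//= -!addrA.
congr (_ + (_ + _)); rewrite scaler_suml -big_split /=.
apply: eq_big => // i _.
by rewrite scaleNr scalerBr scalerA opprB addrCA subrr addr0.
Qed.

Section VolumeGrowth.
Variables (R : realType) (p : nat) (a1 a2 : R -> R).
Hypotheses (a1_continuous : continuous a1) (a2_continuous : continuous a2).
Local Notation mu := (@lebesgue_measure R).

Lemma increment_integral_from0 (w : R -> R) s : continuous w -> 0 < s ->
  integral_from0 w s - integral_from0 w (- s) = \int[mu]_(t in `[- s, s]) w t.
Proof.
move=> cw s0; rewrite !(@integral_from0_base R w s)//; last by rewrite ge0_cp// ltW.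
by rewrite set_itv1 Rintegral_set1 sub0r opprK subrK.
Qed.

(** The square of half-side [16 r] lies in the disc of radius [32 r], and the [p]
    remaining factors have total degree [p <= eps], so that the powers of the radius add
    up to at most 2. This is the only use of the relation between the dimension and the
    growth. *)
Lemma volume_growth (k eps : R) g : classG g -> 0 <= eps -> p%:R <= eps ->
    (forall r, 1 < r -> (weighted_disc_integral a1 a2 r
                          <= (k * r `^ (2 - eps) * g r)%:E)%E) ->
  forall r, 1 <= r -> volume p a1 a2 (4 * r) / r ^+ 2 <= 1024 * `|k| * g (32 * r).
Proof.
move=> [g0 _ _] e0 pe growth r r1; have r0 : 0 < r by exact: lt_le_trans r1.
have [_ _ c1] := weight_calculus a1_continuous; have [_ _ c2] := weight_calculus a2_continuous.
pose T : R := 32 * r; pose s : R := 16 * r.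
have T1 : 1 < T by rewrite /T; lra.
have T0 : 0 < T by exact: lt_trans T1.
have s0 : 0 < s by rewrite mulr_gt0.
have sT : 2 * s ^+ 2 <= T ^+ 2 by rewrite /s /T; nra.
have gT : 0 < g T by exact: g0.
have mass : weight_mass1 a1 s * weight_mass2 a2 s <= `|k| * T `^ (2 - eps) * g T.
  rewrite (increment_integral_from0 c1 s0 : weight_mass1 a1 s = _).
  rewrite (increment_integral_from0 c2 s0 : weight_mass2 a2 s = _).
  have := le_trans (square_in_disc a1_continuous a2_continuous s0 sT) (growth T T1).
  rewrite lee_fin => /le_trans; apply.
  apply: (ler_wpM2r (ltW gT)); apply: ler_wpM2r; first exact: powR_ge0.
  exact: ler_norm.
have power : T `^ (2 - eps) * T ^+ p <= T ^+ 2.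
  rewrite -!powR_mulrn ?(ltW T0)// -powRD; last by apply/implyP => _; rewrite gt_eqF.
  by apply: ler_powR; [exact: ltW|lra].
rewrite ler_pdivrMr ?exprn_gt0// /volume.
have -> : 4 * (4 * r) = s by rewrite /s; ring.
have -> : 8 * (4 * r) = T by rewrite /T; ring.
have Tp : 0 <= T ^+ p by rewrite exprn_ge0// ltW.
apply: (le_trans (ler_wpM2r Tp mass)).
have kg : 0 <= `|k| * g T := mulr_ge0 (normr_ge0 k) (ltW gT).
have -> : `|k| * T `^ (2 - eps) * g T * T ^+ p =
  `|k| * g T * (T `^ (2 - eps) * T ^+ p) by ring.
apply: (le_trans (ler_wpM2l kg power)).
suff -> : `|k| * g T * T ^+ 2 = 1024 * `|k| * g T * r ^+ 2 by [].
by rewrite {2}/T; ring.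
Qed.

End VolumeGrowth.

Section Rigidity.
Variables (R : realType) (p : nat).
Local Notation n := p.+3.
Local Notation V := ('rV[R]_n).
Variables (a1 a2 : R -> R) (u : V -> R) (L : R).
Hypotheses (L0 : 0 <= L) (a1L : forall t, `|a1 t| <= L) (a2L : forall t, `|a2 t| <= L).
Hypotheses (u_solution : classical_solution a1 a2 u) (u_monotone : monotone_last u)
  (u_convergent : asymptotically_convergent u).
Hypotheses (a1_continuous : continuous a1) (a2_continuous : continuous a2).
Variables (k eps : R) (g : R -> R).
Hypotheses (gG : classG g) (eps0 : 0 <= eps) (p_le_eps : p%:R <= eps).
Hypothesis growth : forall r, 1 < r ->
  (weighted_disc_integral a1 a2 r <= (k * r `^ (2 - eps) * g r)%:E)%E.

(** The Dirichlet integrals over dyadic boxes satisfy the recursive inequality of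
    [dyadic_liouville], hence vanish; the weight and the last derivative are positive,
    so the gradient of the quotient is zero. *)
Lemma quotient_constant i : i != idx1 p -> i != idx2 p -> forall x,
  quotient u i x = quotient u i 0.
Proof.
move=> i1 i2; have [chi [dchi [c [c0 chiP]]]] := cutoff_family R.
have [K K0 cacc] := caccioppoli L0 a1L a2L u_solution u_monotone u_convergent
  a1_continuous a2_continuous c0 chiP i1 i2.
pose D j := dirichlet_integral a1 a2 u chi i (2 ^+ j).
have p2 j : 0 < 2 ^+ j :> R by rewrite exprn_gt0.
have Cd (r : R) : 0 < r -> Cc (fun x => eta chi r x ^+ 2 * dirichlet a1 a2 u i x).
  exact: (Cc_dirichlet u_solution u_monotone a1_continuous a2_continuous chiP).
have d0 x : 0 <= dirichlet a1 a2 u i x by exact: dirichlet_ge0.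
have f0 r x : 0 <= eta chi r x ^+ 2 * dirichlet a1 a2 u i x.
  exact: mulr_ge0 (sqr_ge0 _) (d0 x).
have [g0 _ _] := gG.
have D0 : forall j, D j = 0.
  have B0 : 0 <= 1024 * `|k| := mulr_ge0 (ler0n R 1024) (normr_ge0 k).
  apply: (@dyadic_liouville R D (fun j => g (2 ^+ (j + 5))) (K * (1024 * `|k|) + 1)).
  - exact: ltr_wpDl (mulr_ge0 K0 B0) ltr01.
  - by move=> j; apply: rV_integral_ge0 => //; exact: Cd.
  - move=> j; rewrite /D exprS; have p2j : 0 < 2 * 2 ^+ j :> R by rewrite mulr_gt0.
    apply: (le_rV_integral (Cd _ (p2 j)) (Cd _ p2j)) => x.
    apply: ler_wpM2r => //; have h := eta_le_double chiP x (p2 j).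
    have /andP[h0 _] := eta_bounds chiP x (p2 j).
    by rewrite ler_pXn2r ?nnegrE ?(le_trans h0 h).
  - by move=> j; exact: g0.
  - move=> j lam lam0; rewrite /D exprS; apply: le_trans (cacc _ _ (p2 j) lam0) _.
    rewrite lerD2l; apply: ler_wpM2l; first by rewrite invr_ge0 ltW.
    have vg := @volume_growth R p a1 a2 a1_continuous a2_continuous k eps g gG eps0
      p_le_eps growth (2 ^+ j).
    have -> : 2 ^+ (j + 5) = 32 * 2 ^+ j :> R by rewrite exprD mulrC; congr (_ * _); ring.
    apply: (le_trans (ler_wpM2l K0 (vg _))); first by rewrite exprn_ege1// ler1n.
    by rewrite [leLHS]mulrA [leRHS]mulrDl lerDl mul1r ltW// g0// mulr_gt0.
  - move=> m B; have [J BJ] := dyadic_divergence (m + 5) B gG; exists (J - 5)%N.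
    apply: (lt_le_trans BJ); rewrite big_addn//.
have grad0 j x : partial j (quotient u i) x = 0.
  have [N xN] : exists N : nat, forall l, `|x ord0 l| <= 2 ^+ N.
    have S0 : 0 <= \sum_l `|x ord0 l| by apply: sumr_ge0.
    exists (Num.bound (\sum_l `|x ord0 l|)) => l.
    apply: (@le_trans _ _ (\sum_l `|x ord0 l|)).
      by rewrite (bigD1 l)//= lerDl sumr_ge0.
    apply: (le_trans (ltW (archi_boundP S0))).
    by rewrite -natrX ler_nat ltnW// ltn_expl.
  have /(_ x) := rV_integral_eq0 chiP (Cd _ (p2 N)) (f0 _) (D0 N).
  rewrite (eta_one chiP (p2 N) xN) expr1n mul1r /dirichlet.
  have W0 : 0 < weight a1 a2 x * partial ord_max u x ^+ 2.
    by apply: mulr_gt0; [exact: weight_gt0|rewrite exprn_gt0].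
  move=> /eqP; rewrite mulf_eq0 gt_eqF//= psumr_eq0 => [|l _]; last exact: sqr_ge0.
  by move=> /allP/(_ j (mem_index_enum _)); rewrite sqrf_eq0 => /eqP.
exact: constant_of_gradient0 (quotient_C1 u_solution u_monotone i) grad0.
Qed.

End Rigidity.

Theorem corollary2 (R : realType) (p : nat) (a1 a2 : R -> R) (eps : R)
  (a1_bounded : a1 \in Lfun (@lebesgue_measure R) +oo%E)
  (a2_bounded : a2 \in Lfun (@lebesgue_measure R) +oo%E)
  (a1_smooth : smooth a1) (a2_smooth : smooth a2)
  (eps_range : 0 <= eps <= 2)
  (growth : exists g : R -> R, classG g /\
     exists k : R, forall r : R, 1 < r ->
       (weighted_disc_integral a1 a2 r <= (k * r `^ (2 - eps) * g r)%:E)%E)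
  (dim_bound : (p.+3)%:R <= 3 + eps)
  (u : 'rV[R]_p.+3 -> R)
  (u_solution : classical_solution a1 a2 u)
  (u_monotone : monotone_last u)
  (u_convergent : asymptotically_convergent u) :
  at_most_dimensional 3 u.
Proof.
have c1 := smooth_continuous a1_smooth; have c2 := smooth_continuous a2_smooth.
have [L1 L10 b1] := Linfty_bounded a1_bounded c1.
have [L2 L20 b2] := Linfty_bounded a2_bounded c2.
have L0 : 0 <= L1 + L2 by rewrite addr_ge0 ?(ltW L10) ?(ltW L20).
have b1' t : `|a1 t| <= L1 + L2 by apply: (le_trans (b1 t)); rewrite lerDl ltW.
have b2' t : `|a2 t| <= L1 + L2 by apply: (le_trans (b2 t)); rewrite lerDr ltW.
have [g [gG [k growthk]]] := growth; have /andP[eps0 _] := eps_range.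
have pe : p%:R <= eps.
  by move: dim_bound; rewrite -addn3 natrD [_ + 3%:R]addrC lerD2l.
apply: (@three_dimensional_of_ratio R p u (fun i => quotient u i 0)).
  exact: C2_C1 (solution_C2 u_solution).
move=> i i1 i2 x; rewrite -(quotient_constant L0 b1' b2' u_solution u_monotone u_convergent
  c1 c2 gG eps0 pe growthk i1 i2 x) /quotient divfK//.
by rewrite gt_eqF// u_monotone.
Qed.
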